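(* Suppose that $\varphi:\mathcal J_2\to\mathcal J_2$ is a bijective continuous transformation that commutes with the shift, $S\varphi=\varphi S$, and preserves spectra: $\sigma(\varphi(J))=\sigma(J)$ for all $J\in\mathcal J_2$. Then $\varphi\mu\in\mathcal M_0$ for every $\mu\in\mathcal M_0$, and $w_{\varphi\mu}=w_\mu$.
   Context: Jacobi matrices: $\mathcal J_2$ is the set of all Jacobi matrices $(Ju)_n=a_nu_{n+1}+a_{n-1}u_{n-1}+b_nu_n$ on $\ell^2(\mathbb Z)$ with bounded coefficients $a_n\ge 0$, $b_n\in\mathbb R$ and operator norm $\|J\|\le 2$, made into a compact metric space by $d(J,J')=\sum_{n\in\mathbb Z}2^{-|n|}(|a_n-a_n'|+|b_n-b_n'|)$. The shift $S(a,b)_n=(a,b)_{n+1}$ is a homeomorphism of $\mathcal J_2$. $\mathcal M_0$ is the set of $S$-invariant Borel probability measures $\mu$ on $\mathcal J_2$ with $\int\ln a_0(J)\,d\mu(J)>-\infty$. $\sigma(J)$ is the spectrum of $J$ as an operator on $\ell^2(\mathbb Z)$. The image measure $\varphi\mu$ is defined by $\int f\,d(\varphi\mu)=\int f\circ\varphi\,d\mu$ for continuous $f$. For $\mu\in\mathcal M_0$: $A_\mu>0$ is defined by $\ln A_\mu=\int\ln a_0\,d\mu$; $dk_\mu$ is the probability measure on $[-2,2]$ with $\int f\,dk_\mu=\int d\mu(J)\int f(t)\,d\rho_0(t;J)$ for all $f\in C[-2,2]$, where $d\rho_0(t;J)=d\|E_J(t)\delta_0\|^2$ is the spectral measure of $J$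 and $\delta_0$; and for $z\in\mathbb C^+$ (open upper half plane) $w_\mu(z)=\ln A_\mu-\int_{[-2,2]}\ln(t-z)\,dk_\mu(t)$, with $\mathrm{Im}\,\ln\zeta\in(-\pi,0)$ for $\zeta$ in the open lower half plane. *)

(* Defs.v *)
From HB Require Import structures.
From mathcomp Require Import all_boot all_order all_algebra.
From mathcomp Require Import all_classical all_reals all_analysis.
From mathcomp Require Import measurable_realfun.
From mathcomp Require Import complex.

Set Implicit Arguments.
Unset Strict Implicit.
Unset Printing Implicit Defensive.

Import Order.TTheory GRing.Theory Num.Theory.
Import numFieldNormedType.Exports.

Local Open Scope classical_set_scope.
Local Open Scope complex_scope.
Local Open Scope ring_scope.

Section l2.
Context {R : realType}.
Implicit Types (u v : int -> R[i]) (T B : (int -> R[i]) -> int -> R[i]).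

Definition l2norm u : \bar R :=
  sqrte (\esum_(n in [set: int]) (ComplexField.Normc.normc (u n) ^+ 2)%:E).

Definition in_l2 u := (l2norm u < +oo)%E.

(* Unconditional sum; meaningful when f is absolutely summable. *)
Definition sumZ (f : int -> R) : R :=
  fine (\esum_(n in [set: int]) (EFin \o f)^\+ n -
        \esum_(n in [set: int]) (EFin \o f)^\- n)%E.

Definition inner u v : R[i] :=
  sumZ (fun n => complex.Re ((u n)^* * v n)) +i*
  sumZ (fun n => complex.Im ((u n)^* * v n)).

Definition delta0 : int -> R[i] := fun n => (n == 0)%:R.

Definition opnorm T : \bar R :=
  ereal_sup [set l2norm (T u) | u in [set u | (l2norm u <= 1)%E]].

Definition linear_l2 T := forall (c : R[i]) u v,
  in_l2 u -> in_l2 v -> T (c *: u + v) = c *: T u + T v.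

Definition bounded_op T := [/\ linear_l2 T,
  (forall u, in_l2 u -> in_l2 (T u)) & (opnorm T < +oo)%E].

Definition spectrum T : set R[i] := [set z | ~ exists B, bounded_op B /\
  forall u, in_l2 u -> B (T u - z *: u) = u /\ T (B u) - z *: B u = u].

Definition orthogonal_projection T := [/\ bounded_op T,
  (forall u, in_l2 u -> T (T u) = T u) &
  (forall u v, in_l2 u -> in_l2 v -> inner (T u) v = inner u (T v))].

(* E t is the spectral projection of the self-adjoint operator T for the
   half-line ]-oo, t]. The last clause says T = \int t dE(t), through the
   quadratic form: <u, T u> is the integral of t against d||E(t) u||^2. *)
Definition spectral_family T (E : R -> (int -> R[i]) -> int -> R[i]) :=
  [/\ (forall t, orthogonal_projection (E t)),
      (forall s t u, s <= t -> in_l2 u -> E s (E t u) = E s u),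
      (forall t u, in_l2 u -> l2norm (E s u - E t u) @[s --> t^'+] --> 0%E),
      (forall u, in_l2 u -> l2norm (E t u) @[t --> -oo] --> 0%E /\
                            l2norm (E t u - u) @[t --> +oo] --> 0%E) &
      (forall u, in_l2 u ->
        exists m : {measure set (measurableTypeR R) -> \bar R},
        [/\ (forall t, m `]-oo, t]%classic = l2norm (E t u) ^+ 2)%E,
            m.-integrable setT (EFin : measurableTypeR R -> \bar R) &
            inner u (T u) = (\int[m]_t t)%:C])].

End l2.

Section jacobi.
Context {R : realType}.

Definition jacobi_op (a b : int -> R) (u : int -> R[i]) : int -> R[i] :=
  fun n => (a n)%:C * u (n + 1) + (a (n - 1))%:C * u (n - 1) + (b n)%:C * u n.

End jacobi.

Record jacobi2 (R : realType) := Jacobi2 {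
  ja : int -> R;
  jb : int -> R;
  ja_ge0 : forall n, 0 <= ja n;
  jab_bounded : exists M, forall n, `|ja n| <= M /\ `|jb n| <= M;
  jab_norm : (opnorm (jacobi_op ja jb) <= 2%:E)%E }.

HB.instance Definition _ (R : realType) := gen_eqMixin (jacobi2 R).
HB.instance Definition _ (R : realType) := gen_choiceMixin (jacobi2 R).

Section jacobi2_theory.
Context {R : realType}.
Implicit Types J : jacobi2 R.

Definition jop J := jacobi_op (ja J) (jb J).

Lemma jacobi2_eq J J' : ja J = ja J' -> jb J = jb J' -> J = J'.
Proof.
case: J => a b h1 h2 h3; case: J' => a' b' h1' h2' h3' /= ea eb; subst.
by congr Jacobi2; exact: Prop_irrelevance.
Qed.

Definition jdist_term J J' (n : int) : R :=
  2 ^- `|n|%N * (`|ja J n - ja J' n| + `|jb J n - jb J' n|).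

Definition jdist J J' : R :=
  fine (\esum_(n in [set: int]) (jdist_term J J' n)%:E).

Lemma jdist_term_ge0 J J' n : 0 <= jdist_term J J' n.
Proof. by rewrite mulr_ge0// ?invr_ge0 ?exprn_ge0// addr_ge0. Qed.

Lemma esum_geoZ : (\esum_(n in [set: int]) (2 ^- `|n|%N)%:E < +oo :> \bar R)%E.
Proof.
have geo : (\esum_(n in [set: nat]) (2 ^- n)%:E < +oo :> \bar R)%E.
  rewrite -nneseries_esumT; last by move=> n; rewrite lee_fin invr_ge0 exprn_ge0.
  have -> : (fun n => \sum_(0 <= i < n) (2 ^- i)%:E)%E =
      EFin \o (series (geometric 1 2^-1) : R^nat).
    apply/funext => n /=; rewrite /series/= sumEFin; congr EFin.
    by apply: eq_bigr => i _; rewrite /geometric/= mul1r exprVn.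
  have c : series (geometric 1 2^-1) @ \oo --> (1 * (1 - 2^-1)^-1 : R).
    by apply: cvg_geometric_series; rewrite ger0_norm ?invf_lt1 ?invr_ge0// ltr1n.
  rewrite EFin_lim; last by apply/cvg_ex; eexists; exact: c.
  by rewrite ltry.
have -> : [set: int] = (Posz @` [set: nat]) `|` (Negz @` [set: nat]).
  by apply/seteqP; split => // -[n|n] _; [left|right]; exists n.
rewrite (esumID (Posz @` [set: nat])); last first.
  by move=> n _; rewrite lee_fin invr_ge0 exprn_ge0.
have -> : ((Posz @` [set: nat]) `|` (Negz @` [set: nat])) `&`
    Posz @` [set: nat] = Posz @` [set: nat].
  by rewrite setIUl setIid; apply/setUidPl => ? [].
have -> : ((Posz @` [set: nat]) `|` (Negz @` [set: nat])) `&`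
    ~` (Posz @` [set: nat]) = Negz @` [set: nat].
  apply/seteqP; split => [n [[//|//]]|n [m _ <-]]; split.
    by right; exists m.
  by case.
rewrite lte_add_pinfty//.
  rewrite (reindex_esum [set: nat] _ Posz)//.
  by apply: inj_bij => x y _ _ [].
rewrite (reindex_esum [set: nat] _ Negz)//; last first.
  by apply: inj_bij => x y _ _ [].
apply: le_lt_trans geo; apply: le_esum => n _ /=.
by rewrite lee_fin lef_pV2 ?posrE ?exprn_gt0// exprS ler_peMl ?exprn_ge0// ler1n.
Qed.

Lemma jdist_fin J J' :
  (\esum_(n in [set: int]) (jdist_term J J' n)%:E)%E \is a fin_num.
Proof.
rewrite ge0_fin_numE; last by apply: esum_ge0 => n _; rewrite lee_fin jdist_term_ge0.
have [M HM] := jab_bounded J; have [M' HM'] := jab_bounded J'.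
pose K := (M + M') + (M + M').
have tK n : (jdist_term J J' n <= 2 ^- `|n|%N * K).
  rewrite ler_wpM2l ?invr_ge0 ?exprn_ge0// lerD//.
    by rewrite (le_trans (ler_normB _ _))// lerD// ?(HM n).1 ?(HM' n).1.
  by rewrite (le_trans (ler_normB _ _))// lerD// ?(HM n).2 ?(HM' n).2.
have K0 : 0 <= K.
  have := le_trans (jdist_term_ge0 J J' 0) (tK 0).
  by rewrite expr0 invr1 mul1r.
have [N KN] : exists N : nat, K <= N%:R.
  by exists (Num.truncn K).+1; apply/ltW/truncnS_gt.
apply: (@le_lt_trans _ _
   (\esum_(n in [set: int]) \sum_(i < N) (2 ^- `|n|%N)%:E)%E).
  apply: le_esum => n _; rewrite sumEFin lee_fin (le_trans (tK n))//.
  by rewrite sumr_const card_ord -[leRHS]mulr_natr ler_wpM2l// invr_ge0 exprn_ge0.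
rewrite esum_sum; last by move=> n i _ _; rewrite lee_fin invr_ge0 exprn_ge0.
by apply: lte_sum_pinfty => i _; exact: esum_geoZ.
Qed.

Lemma jdistxx J : jdist J J = 0.
Proof.
rewrite /jdist esum1// => n _.
by rewrite /jdist_term !subrr normr0 addr0 mulr0.
Qed.

Lemma jdist_positivity J J' : jdist J J' = 0 -> J = J'.
Proof.
move=> d0.
have t0 n : jdist_term J J' n = 0.
  apply/eqP; rewrite eq_le jdist_term_ge0 andbT.
  rewrite -lee_fin -[leRHS]/(0%:E) -d0 /jdist fineK ?jdist_fin//.
  apply: esum_ge; exists [set n]; first by split => //; exact: finite_set1.
  by rewrite fsbig_set1.
have h n : `|ja J n - ja J' n| = 0 /\ `|jb J n - jb J' n| = 0.
  move: (t0 n) => /eqP; rewrite mulf_eq0 invr_eq0 expf_eq0 pnatr_eq0 andbF/=.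
  by rewrite paddr_eq0// => /andP[/eqP-> /eqP->].
by apply: jacobi2_eq; apply/funext => n; apply/eqP;
  rewrite -subr_eq0 -normr_eq0; case: (h n) => e1 e2; apply/eqP.
Qed.

Lemma jdist_sym J J' : jdist J J' = jdist J' J.
Proof.
congr fine; apply: eq_esum => n _.
by rewrite /jdist_term distrC (distrC (jb J n)).
Qed.

Lemma jdist_triangle J' J J'' : jdist J J'' <= jdist J J' + jdist J' J''.
Proof.
rewrite -lee_fin EFinD !fineK ?jdist_fin// -esumD; last 2 first.
- by move=> n _; rewrite lee_fin jdist_term_ge0.
- by move=> n _; rewrite lee_fin jdist_term_ge0.
apply: le_esum => n _; rewrite -EFinD lee_fin /jdist_term -mulrDr.
rewrite ler_wpM2l ?invr_ge0 ?exprn_ge0// addrACA.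
by rewrite lerD// ler_distD.
Qed.

End jacobi2_theory.

HB.instance Definition _ (R : realType) := isMetric.Build R (jacobi2 R)
  (@jdistxx R) (@jdist_positivity R) (@jdist_sym R) (@jdist_triangle R).

Section jacobi2_shift.
Context {R : realType}.
Implicit Types J : jacobi2 R.

Lemma l2norm_shift (u : int -> R[i]) (k : int) :
  l2norm (fun n => u (n + k)) = l2norm u.
Proof.
rewrite /l2norm; congr sqrte.
rewrite [RHS](reindex_esum [set: int] _ (fun n => n + k))//.
by split => // [x y _ _ /addIr//|n _]; exists (n - k); rewrite ?subrK.
Qed.

Lemma shift_norm J :
  (opnorm (jacobi_op (fun n => ja J (n + 1)%R) (fun n => jb J (n + 1)%R))
    <= 2%:E)%E.
Proof.
apply: le_trans (jab_norm J); apply: ge_ereal_sup => _ [u /= u1 <-].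
apply: ereal_sup_ubound; exists (fun n => u (n - 1)).
  by rewrite /= (l2norm_shift u (-1)).
rewrite -[LHS](l2norm_shift _ 1); congr l2norm; apply/funext => n.
by rewrite /jacobi_op (subrK 1 n) !addrK.
Qed.

Definition jshift J : jacobi2 R.
Proof.
refine (@Jacobi2 R (fun n => ja J (n + 1)) (fun n => jb J (n + 1)) _ _ _).
- by move=> n; exact: ja_ge0.
- by have [M HM] := jab_bounded J; exists M => n; exact: HM.
- exact: shift_norm.
Defined.

Definition jacobi2_zero : jacobi2 R.
Proof.
refine (@Jacobi2 R (fun=> 0) (fun=> 0) _ _ _) => //.
- by exists 0 => n; rewrite normr0.
- apply: ge_ereal_sup => _ [u /= u1 <-].
  rewrite /l2norm esum1 ?sqrte0 ?lee_fin// => n _.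
  rewrite /jacobi_op !mul0r !addr0 /ComplexField.Normc.normc /=.
  by rewrite expr0n/= addr0 sqrtr0 expr0n.
Defined.

End jacobi2_shift.

HB.instance Definition _ (R : realType) :=
  isPointed.Build (jacobi2 R) jacobi2_zero.

Definition borelJ2 (R : realType) := g_sigma_algebraType (@open (jacobi2 R)).
HB.instance Definition _ (R : realType) := Measurable.on (borelJ2 R).

Section measures.
Context {R : realType}.
Implicit Types (mu : probability (borelJ2 R) R) (J : jacobi2 R).

(* lne, unlike ln, takes the value -oo at 0. *)
Definition int_lna0 mu : \bar R := (\int[mu]_J lne (ja J 0)%:E)%E.

Definition M0 mu : Prop :=
  (forall A : set (borelJ2 R), measurable A -> mu (jshift @^-1` A) = mu A) /\
  (-oo < int_lna0 mu)%E.

Lemma continuous_borel_measurable (phi : jacobi2 R -> jacobi2 R) :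
  continuous phi ->
  measurable_fun setT (phi : borelJ2 R -> borelJ2 R).
Proof.
move=> /continuousP cphi; apply: (measurability (@open (jacobi2 R) : set (set (borelJ2 R)))) => //.
by move=> _ [A oA <-]; rewrite setTI; apply: sub_sigma_algebra; exact: cphi.
Qed.

Definition borel_mfun (phi : jacobi2 R -> jacobi2 R) (cphi : continuous phi)
    : {mfun borelJ2 R >-> borelJ2 R} :=
  HB.pack (phi : borelJ2 R -> borelJ2 R)
    (isMeasurableFun.Build _ _ _ _ _ (continuous_borel_measurable cphi)).

Definition image_measure (phi : jacobi2 R -> jacobi2 R)
    (cphi : continuous phi) mu : probability (borelJ2 R) R :=
  distribution mu (borel_mfun cphi).

Lemma image_measureE (phi : jacobi2 R -> jacobi2 R) (cphi : continuous phi) mu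
    (f : jacobi2 R -> R) : continuous f ->
  (\int[image_measure cphi mu]_J (f J)%:E = \int[mu]_J (f (phi J))%:E)%E.
Proof.
move=> /continuousP cf.
have mf : measurable_fun setT (f : borelJ2 R -> measurableTypeR R).
  apply: (measurability _ (RGenOpens.measurableE R)) => _ [_ [a [b ->]] <-].
  by rewrite setTI; apply: sub_sigma_algebra; apply: cf; exact: interval_open.
have mF : measurable_fun setT (EFin \o f : borelJ2 R -> \bar R).
  exact/measurable_EFinP.
rewrite [LHS]integralE [RHS]integralE; congr (_ - _)%E.
  rewrite ge0_integral_distribution//; last exact: measurable_funepos.
  by apply: eq_integral => J _; rewrite /= !(funeposE, funenegE).
rewrite ge0_integral_distribution//; last exact: measurable_funeneg.
by apply: eq_integral => J _; rewrite /= !(funeposE, funenegE).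
Qed.

(* rho is d||E_J(t) delta_0||^2. *)
Definition is_spectral_measure J
    (rho : {measure set (measurableTypeR R) -> \bar R}) : Prop :=
  exists E, spectral_family (jop J) E /\
    forall t, (rho `]-oo, t]%classic = l2norm (E t delta0) ^+ 2)%E.

(* k is dk_mu; each rho J is determined by is_spectral_measure, and then k by
   its integrals. *)
Definition is_dk mu (k : probability (measurableTypeR R) R) : Prop :=
  k `[(-2)%R, 2%R]%classic = 1%E /\
  exists rho : jacobi2 R -> {measure set (measurableTypeR R) -> \bar R},
    (forall J, is_spectral_measure J (rho J)) /\
    forall f : R -> R, {within `[-2, 2], continuous f} ->
      (\int[k]_(t in `[(-2)%R, 2%R]) (f t)%:E =
       \int[mu]_J \int[rho J]_(t in `[(-2)%R, 2%R]) (f t)%:E)%E.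

Definition Amu mu : R := expR (fine (int_lna0 mu)).

Definition cexp (z : R[i]) : R[i] :=
  (expR (complex.Re z))%:C * (cos (complex.Im z) +i* sin (complex.Im z)).

(* The branch on the open lower half plane with imaginary part in ]-pi, 0[. *)
Definition ln_lower (z : R[i]) : R[i] :=
  ln (ComplexField.Normc.normc z) +i*
    - acos (complex.Re z / ComplexField.Normc.normc z).

Lemma ln_lowerP (z : R[i]) : complex.Im z < 0 ->
  cexp (ln_lower z) = z /\ - pi < complex.Im (ln_lower z) < 0.
Proof.
case: z => x y /= y0; rewrite /cexp /ln_lower /=.
set r := Num.sqrt _.
have y2 : 0 < y ^+ 2 by rewrite exprn_even_gt0//= lt_eqF.
have s0 : 0 < x ^+ 2 + y ^+ 2 by rewrite ltr_wpDl// sqr_ge0.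
have r0 : 0 < r by rewrite sqrtr_gt0.
have r2 : r ^+ 2 = x ^+ 2 + y ^+ 2 by rewrite sqr_sqrtr// ltW.
have xr : `|x / r| < 1.
  rewrite normrM normfV (gtr0_norm r0) ltr_pdivrMr// mul1r.
  by rewrite -ltr_sqr ?nnegrE ?(ltW r0)// real_normK ?num_real// r2 ltrDl.
have /andP[xr1 xr2] : -1 < x / r < 1 by rewrite -ltr_norml.
have xrI : x / r \in `[-1, 1] by rewrite in_itv/= !ltW.
split; last first.
  by rewrite ltrN2 oppr_lt0 acos_ltpi ?acos_gt0 ?xr1 ?xr2 ?ltW.
rewrite lnK ?posrE// cosN sinN acosK// sin_acos ?(ltW xr1) ?(ltW xr2)//.
have -> : 1 - (x / r) ^+ 2 = (- y / r) ^+ 2.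
  rewrite !exprMn !exprVn sqrrN r2.
  apply: (mulIf (lt0r_neq0 s0)); rewrite mulrBl !mulfVK ?(lt0r_neq0 s0)//.
  by rewrite mul1r addrAC subrr add0r.
rewrite sqrtr_sqr ger0_norm; last by rewrite divr_ge0 ?(ltW r0)// oppr_ge0 ltW.
have cM (a b c : R) : a%:C * (b +i* c) = (a * b) +i* (a * c).
  by apply/eqP; rewrite eq_complex /= !mul0r subr0 addr0 !eqxx.
by rewrite cM mulNr opprK; congr (_ +i* _); rewrite mulrC mulfVK ?gt_eqF.
Qed.

Definition cintegral (k : probability (measurableTypeR R) R)
    (D : set (measurableTypeR R)) (f : R -> R[i]) : R[i] :=
  (\int[k]_(t in D) complex.Re (f t)) +i* (\int[k]_(t in D) complex.Im (f t)).

Definition w_fun mu (k : probability (measurableTypeR R) R) (z : R[i]) : R[i] :=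
  (ln (Amu mu))%:C - cintegral k `[-2, 2] (fun t => ln_lower (t%:C - z)).

End measures.

(* Main.v *)
(* By invariance of mu, the integral of a continuous function of J is that of its
   average over N consecutive translates of J, and along these J is mostly close
   to an N-periodic matrix K with positive off-diagonal entries. By uniform
   continuity phi J is close to phi K along the same sites, and phi K is
   N-periodic with the spectrum of K. Let A be the product of the a_n over a
   period and S the shift by N sites. The monic characteristic polynomial P of
   the Floquet matrix at the multiplier i satisfies P(K) = A (S + S^-1).
   Polynomials of isospectral matrices have the same norm; testing P and the
   analogous polynomial of phi K on combs of period N gives that A, then P, agree
   for K and phi K. Hence so do the averages of ln a_n and of <delta_n, (K + 2)^m
   delta_n>, m < N. Integrating, mu and phi mu give the same moments of dk, and
   the integral of ln a_0 does not decrease (only semicontinuity is available, as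
   ln is unbounded at 0); equality follows by applying this to the inverse of
   phi, which is continuous by compactness. *)

(* For an N-periodic matrix with positive off-diagonal entries, potential theory explains why the
   spectrum knows both invariants: its capacity is A^(1/N) and its equilibrium measure is dk. The
   combs replace this by an extremal property: P is the Chebyshev polynomial of the spectrum. A
   monic polynomial of degree N is P + D with deg D < N, and on the combs with multipliers 1 and -1
   it takes the values 2A + d and -2A + d at a tooth, d being a diagonal entry of D(K). One of them
   has modulus at least 2A, and a norm equal to 2A leaves room for no D but 0. For a general J the
   spectrum alone gives nothing of the kind, and a periodic approximation spoils the sites near the
   ends of a period. Averaging over the period makes this harmless for bounded observables. For ln
   a_0 it is not: cutting puts a zero at the end of each block. Mixing in the free matrix with
   weight 1/N raises it to 1/N, so that the loss is one term of size ln N among N. *)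
From HB Require Import structures.
Require Import Defs.
From mathcomp Require Import all_boot all_order all_algebra.
From mathcomp Require Import all_classical all_reals all_analysis.
From mathcomp Require Import measurable_realfun.
From mathcomp Require Import complex ring lra zify.

Set Implicit Arguments.
Unset Strict Implicit.
Unset Printing Implicit Defensive.

Import Order.TTheory GRing.Theory Num.Theory.
Import numFieldNormedType.Exports.

Local Open Scope classical_set_scope.
Local Open Scope complex_scope.
Local Open Scope ring_scope.

(** * Square-summable sequences *)

Section nsq.
Context {R : realType}.
Implicit Types z w : R[i].

(** The squared modulus as a polynomial in the two coordinates, so that [ring] and [nra] apply. *)
Definition nsq z : R := complex.Re z ^+ 2 + complex.Im z ^+ 2.

Lemma normc_sqr z : ComplexField.Normc.normc z ^+ 2 = nsq z.
Proof.
by case: z => x y; rewrite /= sqr_sqrtr// addr_ge0// sqr_ge0.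
Qed.

Lemma nsq_ge0 z : 0 <= nsq z.
Proof. by rewrite addr_ge0// sqr_ge0. Qed.

Lemma nsq0 : nsq 0 = 0.
Proof. by rewrite /nsq/= expr0n addr0. Qed.

Lemma nsq1 : nsq 1 = 1.
Proof. by rewrite /nsq/= expr1n expr0n addr0. Qed.

Lemma nsqM z w : nsq (z * w) = nsq z * nsq w.
Proof. by case: z => x y; case: w => x' y'; rewrite /nsq/=; ring. Qed.

Lemma nsq_real (r : R) : nsq r%:C = r ^+ 2.
Proof. by rewrite /nsq/= expr0n addr0. Qed.

Lemma nsqD_le z w : nsq (z + w) <= 2 * nsq z + 2 * nsq w.
Proof.
case: z => x y; case: w => x' y'; rewrite /nsq/=.
have := sqr_ge0 (x - x'); have := sqr_ge0 (y - y'); nra.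
Qed.

Lemma nsq_eq0 z : nsq z = 0 -> z = 0.
Proof.
case: z => x y /eqP; rewrite /nsq/= paddr_eq0 ?sqr_ge0// !sqrf_eq0.
by move=> /andP[/eqP-> /eqP->].
Qed.

Lemma Re_addC z w : complex.Re (z + w) = complex.Re z + complex.Re w.
Proof. by case: z; case: w. Qed.

Lemma Im_addC z w : complex.Im (z + w) = complex.Im z + complex.Im w.
Proof. by case: z; case: w. Qed.

Lemma Re_sumC I (r : seq I) (P : pred I) (F : I -> R[i]) :
  complex.Re (\sum_(i <- r | P i) F i) = \sum_(i <- r | P i) complex.Re (F i).
Proof. by elim/big_rec2: _ => // i _ y _ <-; rewrite Re_addC. Qed.

Lemma Im_sumC I (r : seq I) (P : pred I) (F : I -> R[i]) :
  complex.Im (\sum_(i <- r | P i) F i) = \sum_(i <- r | P i) complex.Im (F i).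
Proof. by elim/big_rec2: _ => // i _ y _ <-; rewrite Im_addC. Qed.

Lemma complexP z w : complex.Re z = complex.Re w -> complex.Im z = complex.Im w ->
  z = w.
Proof. by case: z; case: w => a b c d /= -> ->. Qed.

End nsq.

Section isum.
Context {R : realType}.
Implicit Types (f g : int -> R) (u v : int -> R[i]).

(** Sums over the window of n sites starting at m. Bounds on l2 norms become uniform bounds on these
    finite real sums. *)
Definition isum (m : int) (n : nat) f : R := \sum_(i < n) f (m + i%:Z).

Lemma isum_ge0 m n f : (forall k, 0 <= f k) -> 0 <= isum m n f.
Proof. by move=> f0; apply: sumr_ge0. Qed.

Lemma eq_isum m n f g : (forall k, m <= k < m + n%:Z -> f k = g k) ->
  isum m n f = isum m n g.
Proof. by move=> fg; apply: eq_bigr => i _; apply: fg; have := ltn_ord i; lia. Qed.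

Lemma le_isum m n f g : (forall k, m <= k < m + n%:Z -> f k <= g k) ->
  isum m n f <= isum m n g.
Proof. by move=> fg; apply: ler_sum => i _; apply: fg; have := ltn_ord i; lia. Qed.

Lemma isumD m n f g : isum m n (fun k => f k + g k) = isum m n f + isum m n g.
Proof. exact: big_split. Qed.

Lemma isumZ m n c f : isum m n (fun k => c * f k) = c * isum m n f.
Proof. by rewrite /isum mulr_sumr. Qed.

Lemma isum_shift m n p f : isum m n (fun k => f (k + p)) = isum (m + p) n f.
Proof. by apply: eq_bigr => i _; rewrite addrAC. Qed.

Lemma isum_cat m n p f :
  isum m (n + p) f = isum m n f + isum (m + n%:Z) p f.
Proof.
rewrite /isum big_split_ord; congr (_ + _).
by apply: eq_bigr => i _; congr f; rewrite /= PoszD addrA.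
Qed.

Lemma isum1 m f : isum m 1 f = f m.
Proof. by rewrite /isum big_ord1 addr0. Qed.

Lemma le_isum_sub (m : int) n (m' : int) n' f : (forall k, 0 <= f k) ->
  m' <= m -> m + n%:Z <= m' + n'%:Z -> isum m n f <= isum m' n' f.
Proof.
move=> f0 mm' nn'.
have -> : n' = (absz (m - m') + (n + absz (m' + n'%:Z - (m + n%:Z))%R))%N by lia.
have e : m' + (absz (m - m'))%:Z = m by lia.
rewrite !isum_cat e addrCA lerDl addr_ge0// isum_ge0//.
Qed.

Lemma ler_isum_term m n k f : (forall k, 0 <= f k) ->
  m <= k < m + n%:Z -> f k <= isum m n f.
Proof.
by move=> f0 mk; rewrite -[f k]isum1; apply: le_isum_sub => //; lia.
Qed.

(** Every finite set of integers lies in a symmetric window, so windows are cofinal among the finite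
    partial sums. *)
Lemma esum_isum f C : (forall k, 0 <= f k) ->
  (\esum_(n in [set: int]) (f n)%:E <= C%:E)%E <-> (forall m n, isum m n f <= C).
Proof.
move=> f0; split=> [uC m n|uC].
  rewrite -lee_fin; apply: le_trans uC.
  apply: esum_ge; exists ((fun i : nat => m + i%:Z) @` `I_n).
    by split => //; apply: finite_image; exact: finite_II.
  rewrite fsbig_image/=; last by move=> x y _ _ /addrI[].
  rewrite -fsbig_ord/= /isum -sumEFin; apply: lee_sum => i _ //.
apply: ge_ereal_sup => _ [X [fX _] <-].
have [N XN] : exists N : nat, X `<=` [set k : int | (`|k| <= N)%N].
  have /finite_seqP[s sX] := fX.
  exists (\max_(k <- s) `|k|)%N => k; rewrite sX /= => ks.
  by apply: (@leq_bigmax_seq _ _ _ (fun k : int => `|k|%N)).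
apply: (@le_trans _ _ (isum (- N%:Z) (N + N).+1 f)%:E); last first.
  by rewrite lee_fin.
rewrite /isum -sumEFin; pose h (i : nat) : int := - N%:Z + i%:Z.
rewrite (_ : (\sum_(i < (N + N).+1) _)%E =
  \sum_(i \in h @` `I_(N + N).+1) (f i)%:E)%E.
  apply: lee_fsum_nneg_subset => //.
  - by apply: finite_image; exact: finite_II.
  - move=> k; rewrite !inE => /XN/= kN; exists (absz (k + N%:Z)); rewrite /= ?/h; lia.
  - by move=> k _; rewrite lee_fin f0.
rewrite fsbig_image/=; last by move=> x y _ _ /addrI[].
by rewrite -fsbig_ord.
Qed.

End isum.

Section l2b.
Context {R : realType}.
Implicit Types (u v : int -> R[i]).

(** C bounds the square of the norm; constants attached to operators below are therefore squares of
    operator norms. *)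
Definition l2b u (C : R) := forall m n, isum m n (nsq \o u) <= C.

Lemma l2b_ge0 u C : l2b u C -> 0 <= C.
Proof. by move=> /(_ 0 0%N); rewrite /isum big_ord0. Qed.

Lemma l2b_term u C k : l2b u C -> nsq (u k) <= C.
Proof. by move=> /(_ k 1%N); rewrite isum1. Qed.

Lemma l2b0 : l2b 0 0.
Proof. by move=> m n; rewrite /isum big1// => i _; rewrite /= nsq0. Qed.

Lemma l2b_eq0 u : l2b u 0 -> u = 0.
Proof.
move=> u0; apply/funext => k; apply: nsq_eq0; apply/eqP.
by rewrite eq_le nsq_ge0 andbT (l2b_term _ u0).
Qed.

Lemma le_l2b u C D : C <= D -> l2b u C -> l2b u D.
Proof. by move=> CD h m n; apply: le_trans CD. Qed.

Lemma l2bZ c u C : l2b u C -> l2b (c *: u) (nsq c * C).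
Proof.
move=> h m n; rewrite (_ : isum _ _ _ = nsq c * isum m n (nsq \o u)).
  by rewrite ler_wpM2l ?nsq_ge0.
by rewrite -isumZ; apply: eq_isum => k _; rewrite /= nsqM.
Qed.

Lemma l2bD u v C D : l2b u C -> l2b v D -> l2b (u + v) (2 * C + 2 * D).
Proof.
move=> h h' m n.
apply: (@le_trans _ _ (2 * isum m n (nsq \o u) + 2 * isum m n (nsq \o v))).
  by rewrite -!isumZ -isumD; apply: le_isum => k _; exact: nsqD_le.
by rewrite lerD// ler_wpM2l.
Qed.

Lemma l2b_shift u C p : l2b u C -> l2b (fun n => u (n + p)) C.
Proof. by move=> h m n; rewrite (isum_shift m n p (nsq \o u)). Qed.

Lemma l2b_esum u C :
  (\esum_(n in [set: int]) (nsq (u n))%:E <= C%:E)%E <-> l2b u C.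
Proof. exact: (esum_isum _ (fun k => nsq_ge0 (u k))). Qed.

Lemma l2normP u c : 0 <= c -> (l2norm u <= c%:E)%E <-> l2b u (c ^+ 2).
Proof.
move=> c0; rewrite -l2b_esum /l2norm.
have -> : (\esum_(n in [set: int]) (ComplexField.Normc.normc (u n) ^+ 2)%:E)%E =
          (\esum_(n in [set: int]) (nsq (u n))%:E)%E.
  by apply: eq_esum => n _; rewrite normc_sqr.
have : (0 <= \esum_(n in [set: int]) (nsq (u n))%:E)%E.
  by apply: esum_ge0 => n _; rewrite lee_fin nsq_ge0.
case: (esum _ _) => [r| |]//=; rewrite !lee_fin => r0.
by rewrite -(ler_sqr (x := Num.sqrt r)) ?nnegrE ?sqrtr_ge0// sqr_sqrtr.
Qed.

Lemma in_l2P u : in_l2 u <-> exists C, l2b u C.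
Proof.
split=> [ul|[C uC]].
  have l0 : (0 <= l2norm u)%E by rewrite sqrte_ge0.
  exists (fine (l2norm u) ^+ 2); apply/l2normP; first exact: fine_ge0.
  by rewrite fineK// ge0_fin_numE.
have := l2b_ge0 uC => C0.
apply: (@le_lt_trans _ _ (Num.sqrt C)%:E); last by rewrite ltry.
by apply/l2normP; rewrite ?sqrtr_ge0// sqr_sqrtr.
Qed.

(** [opnorm] tests the unit ball only, hence the division of u by the square root of C. The case C =
    0 admits no such division, but there u = 0. *)
Lemma opnorm_l2b (T : (int -> R[i]) -> int -> R[i]) (c : R) :
  linear_l2 T -> 0 <= c -> (opnorm T <= c%:E)%E ->
  forall u C, l2b u C -> l2b (T u) (c ^+ 2 * C).
Proof.
move=> lT c0 Tc u C uC.
have T0 : T 0 = 0.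
  have z : in_l2 (0 : int -> R[i]) by apply/in_l2P; exists 0; exact: l2b0.
  by have := lT 1 0 0 z z; rewrite scaler0 addr0 scale1r -{1}[T 0]addr0 => /addrI.
have := l2b_ge0 uC; rewrite le_eqVlt => /predU1P[C0|C0].
  by move: uC; rewrite -C0 => /l2b_eq0 ->; rewrite T0 mulr0; exact: l2b0.
pose s := Num.sqrt C; have s0 : 0 < s by rewrite sqrtr_gt0.
pose w := (s^-1)%:C *: u.
have w1 : l2b w (1 ^+ 2).
  have := l2bZ (s^-1)%:C uC.
  by rewrite nsq_real exprVn sqr_sqrtr ?(ltW C0)// mulVf ?expr1n// gt_eqF.
have uw : u = s%:C *: w.
  by rewrite scalerA -rmorphM/= divff ?gt_eqF// scale1r.
have : (l2norm (T w) <= c%:E)%E.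
  apply: le_trans Tc; apply: ereal_sup_ubound; exists w => //=.
  by apply/l2normP.
move=> /l2normP => /(_ c0) Twc.
have wl : in_l2 w by apply/in_l2P; eexists; exact: w1.
have zl : in_l2 (0 : int -> R[i]) by apply/in_l2P; exists 0; exact: l2b0.
have -> : T u = s%:C *: T w by rewrite uw -[in LHS](addr0 (_ *: w)) lT// T0 addr0.
have := l2bZ s%:C Twc.
by rewrite nsq_real sqr_sqrtr ?(ltW C0)// mulrC.
Qed.

Lemma bounded_op_l2b (T : (int -> R[i]) -> int -> R[i]) : bounded_op T ->
  exists2 K : R, 0 <= K & forall u C, l2b u C -> l2b (T u) (K * C).
Proof.
move=> [lT _ Tb].
have o0 : (0 <= opnorm T)%E.
  apply: (@le_trans _ _ (l2norm (T 0))); first by rewrite sqrte_ge0.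
  apply: ereal_sup_ubound; exists 0 => //=; apply/l2normP => //.
  by apply: (le_l2b _ l2b0); rewrite expr1n.
have of_ : opnorm T \is a fin_num by rewrite ge0_fin_numE.
exists (fine (opnorm T) ^+ 2); first exact: sqr_ge0.
by apply: opnorm_l2b => //; rewrite ?fine_ge0// fineK.
Qed.

Lemma l2b_bounded_op (T : (int -> R[i]) -> int -> R[i]) (K : R) :
  linear_l2 T -> (forall u C, l2b u C -> l2b (T u) (K * C)) -> bounded_op T.
Proof.
move=> lT TK; split => //.
  by move=> u /in_l2P[C /TK uC]; apply/in_l2P; eexists; exact: uC.
have K0 : 0 <= `|K|  by [].
apply: (@le_lt_trans _ _ (Num.sqrt `|K|)%:E); last by rewrite ltry.
apply: ge_ereal_sup => _ [u /= /l2normP u1 <-].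
apply/l2normP; first by rewrite sqrtr_ge0.
rewrite sqr_sqrtr//; apply: (@le_l2b _ (K * 1)); first by rewrite mulr1 ler_norm.
by apply: TK; rewrite -(expr1n _ 2); apply: u1.
Qed.

Definition cutoff (m : int) (n : nat) u : int -> R[i] :=
  fun k => if m <= k < m + n%:Z then u k else 0.

Lemma l2b_cutoff m n u : l2b (cutoff m n u) (isum m n (nsq \o u)).
Proof.
move=> m' n'.
have [N [h1 h2 h3]] : exists N : nat, [/\ (- N%:Z <= m), - N%:Z <= m' &
   (m + n%:Z <= N%:Z /\ m' + n'%:Z <= N%:Z)].
  by exists (`|m| + `|m'| + n + n')%N; split; lia.
apply: (@le_trans _ _ (isum (- N%:Z) (N + N) (nsq \o cutoff m n u))).
  by apply: le_isum_sub => [k||]; rewrite /= ?nsq_ge0//; lia.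
have -> : (N + N)%N = (absz (m + N%:Z)%R + (n + absz (N%:Z - (m + n%:Z))%R))%N by lia.
have e : - N%:Z + (absz (m + N%:Z))%:Z = m by lia.
rewrite !isum_cat e.
rewrite [X in X + _](_ : _ = 0) ?add0r; last first.
  rewrite /isum big1// => i _; rewrite /= /cutoff ifF ?nsq0//.
  by have := ltn_ord i; lia.
rewrite [X in _ + X](_ : _ = 0) ?addr0; last first.
  rewrite /isum big1// => i _; rewrite /= /cutoff ifF ?nsq0//.
  by lia.
by apply: le_isum => k mk; rewrite /= /cutoff mk.
Qed.

End l2b.

(** * Polynomials of a Jacobi matrix *)

Section pact.
Context {C : comNzRingType} {V : lmodType C} (L : {linear V -> V}).
Implicit Types (p q : {poly C}) (u v : V).

Definition pact p u : V := \sum_(i < size p) p`_i *: iter i L u.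

Lemma iter_linear i : linear (iter i L).
Proof. by move=> c u v; elim: i => //= i ->; rewrite linearP. Qed.

Lemma pact_linear p : linear (pact p).
Proof.
move=> c u v; rewrite /pact scaler_sumr -big_split/=; apply: eq_bigr => i _.
by rewrite iter_linear scalerDr !scalerA mulrC.
Qed.
HB.instance Definition _ p := GRing.isLinear.Build _ _ _ _ (pact p) (pact_linear p).

Lemma pact_wide n p u : (size p <= n)%N ->
  pact p u = \sum_(i < n) p`_i *: iter i L u.
Proof.
move=> pn; rewrite /pact (big_ord_widen _ (fun i => p`_i *: iter i L u) pn).
rewrite big_mkcond/=; apply: eq_bigr => i _; case: ifPn => //.
by rewrite -leqNgt => /(nth_default 0) ->; rewrite scale0r.
Qed.

Lemma pactD p q u : pact (p + q) u = pact p u + pact q u.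
Proof.
pose n := maxn (size p) (size q).
rewrite !(@pact_wide n) ?leq_maxl ?leq_maxr ?size_polyD// -big_split/=.
by apply: eq_bigr => i _; rewrite coefD scalerDl.
Qed.

Lemma pactZ c p u : pact (c *: p) u = c *: pact p u.
Proof.
rewrite !(@pact_wide (size p)) ?size_scale_leq// scaler_sumr.
by apply: eq_bigr => i _; rewrite coefZ scalerA.
Qed.

Lemma pactB p q u : pact (p - q) u = pact p u - pact q u.
Proof. by rewrite pactD -[- q]scaleN1r pactZ scaleN1r. Qed.

Lemma pactC c u : pact c%:P u = c *: u.
Proof. by rewrite (@pact_wide 1) ?size_polyC_leq1// big_ord1 coefC. Qed.

Lemma pactXM p u : pact (p * 'X) u = L (pact p u).
Proof.
have -> : L (pact p u) = \sum_(i < size p) p`_i *: iter i.+1 L u.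
  by rewrite linear_sum; apply: eq_bigr => i _; rewrite linearZ.
rewrite (@pact_wide (size p).+1).
  rewrite big_ord_recl coefMX eqxx scale0r add0r.
  by apply: eq_bigr => i _; rewrite coefMX.
by rewrite (leq_trans (size_polyMleq _ _))// size_polyX addn2.
Qed.

Lemma pactX u : pact 'X u = L u.
Proof. by rewrite -['X]mul1r pactXM pactC scale1r. Qed.

Lemma pactM p q u : pact (p * q) u = pact p (pact q u).
Proof.
elim/poly_ind: p => [|p c ih].
  by rewrite mul0r -polyC0 !pactC !scale0r.
rewrite mulrDl mulrAC !pactD !pactXM ih; congr (_ + _).
by rewrite mul_polyC pactZ pactC.
Qed.

Lemma pact_comm p u : pact p (L u) = L (pact p u).
Proof. by rewrite -pactX -pactM mulrC pactM pactX. Qed.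

End pact.

(** * Traces of polynomials of normal matrices *)

Section trace_char_poly.
Context {C : numClosedFieldType} (n : nat).
Implicit Types A B P : 'M[C]_n.+1.

Lemma char_poly_simil P A : P \in unitmx ->
  char_poly (invmx P *m A *m P) = char_poly A.
Proof.
move=> Pu; rewrite /char_poly.
have -> : char_poly_mx (invmx P *m A *m P) =
    map_mx polyC (invmx P) *m char_poly_mx A *m map_mx polyC P.
  rewrite /char_poly_mx mulmxBr mulmxBl !map_mxM/=; congr (_ - _).
  by rewrite scalar_mxC -mulmxA -map_mxM/= mulVmx// map_mx1 mulmx1.
rewrite !det_mulmx mulrAC -det_mulmx -map_mxM/= mulVmx//.
by rewrite map_mx1 det1 mul1r.
Qed.

Lemma char_poly_diag (d : 'rV[C]_n.+1) :
  char_poly (diag_mx d) = \prod_(x <- [seq d 0 i | i <- enum 'I_n.+1]) ('X - x%:P).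
Proof.
rewrite char_poly_trig ?diag_mx_is_trig// big_map big_enum/=.
by apply: eq_bigr => i _; rewrite mxE eqxx mulr1n.
Qed.

Lemma trace_horner_normal A p : A \is normalmx ->
  \tr (horner_mx A p) =
  \sum_(x <- [seq spectral_diag A 0 i | i <- enum 'I_n.+1]) p.[x].
Proof.
move=> /orthomx_spectralP {1}->; set P := spectralmx A.
have Pu : P \in unitmx by exact: spectral_unit.
rewrite horner_mx_uconjC//.
rewrite mxtrace_mulC mulmxA mulmxV// mul1mx horner_mx_diag mxtrace_diag.
by rewrite big_map big_enum/=; apply: eq_bigr => i _; rewrite mxE.
Qed.

(** In unitary diagonal form both matrices carry the roots of the common characteristic polynomial,
    with multiplicity, and the trace is a symmetric function of them. *)
Lemma trace_char_poly A B p : A \is normalmx -> B \is normalmx ->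
  char_poly A = char_poly B -> \tr (horner_mx A p) = \tr (horner_mx B p).
Proof.
move=> nA nB; rewrite !trace_horner_normal//.
move: (nA) (nB) => /orthomx_spectralP {1}-> /orthomx_spectralP {1}->.
rewrite !char_poly_simil ?spectral_unit// !char_poly_diag => /prod_XsubC_eq e.
exact: perm_big.
Qed.

End trace_char_poly.

(** * Band structure of polynomials of a Jacobi matrix *)

Section jacobi_band.
Context {R : realType} (a b : int -> R).
Local Notation T := (jacobi_op a b).
Implicit Types (u v : int -> R[i]) (p : {poly R[i]}).

Lemma jacobi_op_linear : linear T.
Proof.
move=> c u v; apply/funext => n; rewrite /jacobi_op /=.
change ((c *: u + v) (n + 1)) with (c * u (n + 1) + v (n + 1)).
change ((c *: u + v) (n - 1)) with (c * u (n - 1) + v (n - 1)).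
change ((c *: u + v) n) with (c * u n + v n).
change (?c *: ?f + ?g : int -> R[i]) with (fun n => c * f n + g n).
by cbn beta; ring.
Qed.
HB.instance Definition _ := GRing.isLinear.Build _ _ _ _ T jacobi_op_linear.

(** [T] acts on all sequences, square-summable or not: the polynomial calculus must also cover Bloch
    sequences and combs, which are not in l2. *)
Definition jlin : {linear (int -> R[i]) -> (int -> R[i])} := T.

Definition jpoly p : (int -> R[i]) -> int -> R[i] := pact jlin p.

Lemma jpoly_linear p : linear (jpoly p).
Proof. exact: pact_linear. Qed.
HB.instance Definition _ p := GRing.isLinear.Build _ _ _ _ (jpoly p) (jpoly_linear p).

Lemma jpoly_addE p u v n : jpoly p (u + v) n = jpoly p u n + jpoly p v n.
Proof. by rewrite linearD. Qed.

Lemma jpoly_subE p u v n : jpoly p (u - v) n = jpoly p u n - jpoly p v n.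
Proof. by rewrite linearB. Qed.

Lemma jpoly_scaleE p c u n : jpoly p (c *: u) n = c * jpoly p u n.
Proof. by rewrite linearZ. Qed.

Lemma jpolyD p q u : jpoly (p + q) u = jpoly p u + jpoly q u.
Proof. exact: pactD. Qed.

Lemma jpolyB p q u : jpoly (p - q) u = jpoly p u - jpoly q u.
Proof. exact: pactB. Qed.

Lemma jpolyZ c p u : jpoly (c *: p) u = c *: jpoly p u.
Proof. exact: pactZ. Qed.

Lemma jpolyC c u : jpoly c%:P u = c *: u.
Proof. exact: pactC. Qed.

Lemma jpolyXM p u : jpoly (p * 'X) u = T (jpoly p u).
Proof. exact: pactXM. Qed.

Lemma jpolyX u : jpoly 'X u = T u.
Proof. exact: pactX. Qed.

Lemma jpolyM p q u : jpoly (p * q) u = jpoly p (jpoly q u).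
Proof. exact: pactM. Qed.

Lemma jpoly_comm p u : jpoly p (T u) = T (jpoly p u).
Proof. exact: (@pact_comm _ _ jlin). Qed.

Lemma jpoly_coef p n u k : (size p <= n)%N ->
  jpoly p u k = \sum_(i < n) p`_i * iter i T u k.
Proof. by move=> pn; rewrite /jpoly (pact_wide _ _ pn) fct_sumE. Qed.

Definition dlt (k : int) : int -> R[i] := fun n => (n == k)%:R.

Lemma iter_band d u v n :
  (forall k : int, (`|k - n| <= d%:Z)%R -> u k = v k) ->
  iter d T u n = iter d T v n.
Proof.
elim: d n => [|d ih] n uv /=; first by apply: uv; rewrite subrr.
by rewrite /jacobi_op; congr (_ * _ + _ * _ + _ * _); apply: ih => k kn; apply: uv; lia.
Qed.

Lemma jpoly_band p (d : nat) u v n : (size p <= d.+1)%N ->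
  (forall k : int, (`|k - n| <= d%:Z)%R -> u k = v k) ->
  jpoly p u n = jpoly p v n.
Proof.
move=> pd uv; rewrite !(jpoly_coef _ _ (leqnn (size p))).
apply: eq_bigr => i _; congr (_ * _).
by apply: iter_band => k ki; apply: uv; have := leq_trans (ltn_ord i) pd; lia.
Qed.

Lemma iter_dlt_out d k n : (d%:Z < `|k - n|)%R -> iter d T (dlt k) n = 0.
Proof.
move=> dk; rewrite (@iter_band _ _ (fun=> 0)).
  elim: d n {dk} => //= d ih n; rewrite /jacobi_op !ih; ring.
by move=> j jn; rewrite /dlt; have -> : (j == k) = false by lia.
Qed.

(** A single path of d nearest-neighbour steps leads from k to k + d, and it picks up one
    coefficient a per edge. *)
Lemma iter_dlt_right d k :
  iter d T (dlt k) (k + d%:Z) = (\prod_(j < d) a (k + j%:Z))%:C.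
Proof.
elim: d => [|d ih]; first by rewrite big_ord0 /= /dlt addr0 eqxx.
rewrite big_ord_recr /= {1}/jacobi_op iter_dlt_out; last by lia.
rewrite (_ : k + d.+1%:Z - 1 = k + d%:Z); last by lia.
rewrite ih iter_dlt_out; last by lia.
by rewrite !mulr0 add0r addr0 mulrC rmorphM.
Qed.

Lemma iter_dlt_left d k :
  iter d T (dlt k) (k - d%:Z) = (\prod_(j < d) a (k - d%:Z + j%:Z))%:C.
Proof.
elim: d => [|d ih]; first by rewrite big_ord0 /= /dlt subr0 eqxx.
rewrite big_ord_recl /= {1}/jacobi_op.
rewrite (_ : k - d.+1%:Z + 1 = k - d%:Z); last by lia.
rewrite ih iter_dlt_out; last by lia.
rewrite iter_dlt_out; last by lia.
rewrite !mulr0 !addr0 -rmorphM/=; congr (_ * _)%:C.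
by apply: eq_bigr => i _; congr a; rewrite /bump/=; lia.
Qed.

Lemma iter_dlt_real d k n : complex.Im (iter d T (dlt k) n) = 0.
Proof.
elim: d n => [|d ih] n /=; first by rewrite /dlt; case: (_ == _).
rewrite {1}/jacobi_op !Im_addC.
have h (x : R) z : complex.Im z = 0 -> complex.Im (x%:C * z) = 0.
  by case: z => y w /= ->; rewrite mulr0 mul0r addr0.
by rewrite !h// !addr0.
Qed.

Lemma jpoly_dlt_real p k n : (forall i, complex.Im p`_i = 0) ->
  complex.Im (jpoly p (dlt k) n) = 0.
Proof.
move=> pr; rewrite (jpoly_coef _ _ (leqnn _)) Im_sumC big1// => i _.
move: (pr i) (iter_dlt_real i k n).
by case: (p`_i) => ? ?; case: (iter _ _ _ _) => ? ? /= -> ->; rewrite mulr0 mul0r addr0.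
Qed.

(** At distance d only the power d of T arrives; lower powers stop short. *)
Lemma jpoly_dlt_far p d k n : (size p <= d.+1)%N -> (`|k - n| = d%:Z)%R ->
  jpoly p (dlt k) n = p`_d * iter d T (dlt k) n.
Proof.
move=> pd dk; rewrite (jpoly_coef _ _ pd) big_ord_recr/=.
rewrite big1 ?add0r// => i _.
by rewrite iter_dlt_out ?mulr0//; have := ltn_ord i; lia.
Qed.

(** The matrix of p(T): row n has at most 2d + 1 nonzero entries, read off from the unit
    sequences. *)
Lemma jpoly_window p (d : nat) u n : (size p <= d.+1)%N ->
  jpoly p u n =
  \sum_(j < (d + d).+1) u (n - d%:Z + j%:Z) * jpoly p (dlt (n - d%:Z + j%:Z)) n.
Proof.
move=> pd.
pose v := \sum_(j < (d + d).+1) u (n - d%:Z + j%:Z) *: dlt (n - d%:Z + j%:Z).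
rewrite (jpoly_band (v := v) pd) => [|k kn].
  by rewrite linear_sum fct_sumE; apply: eq_bigr => j _; rewrite linearZ.
have kd : (absz (k - (n - d%:Z))%R < (d + d).+1)%N by lia.
rewrite /v fct_sumE (bigD1 (Ordinal kd))//= big1 ?addr0 => [|j jk].
  change (u k = u (n - d%:Z + (absz (k - (n - d%:Z))%R)%:Z) *
    dlt (n - d%:Z + (absz (k - (n - d%:Z))%R)%:Z) k).
  have -> : n - d%:Z + (absz (k - (n - d%:Z))%R)%:Z = k by lia.
  by rewrite /dlt eqxx mulr1.
change (u (n - d%:Z + j%:Z) * dlt (n - d%:Z + j%:Z) k = 0).
rewrite /dlt; have -> : (k == n - d%:Z + j%:Z) = false; last by rewrite mulr0.
apply/eqP => kj; move/eqP: jk; apply; apply/val_inj => /=; lia.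
Qed.

End jacobi_band.

(** * The real inner product *)

Section sumZ.
Context {R : realType}.
Implicit Types (f g h : int -> R).

Definition summableZ f := exists C, forall m n, isum m n (fun k => `|f k|) <= C.

Lemma le_summableZ f g : (forall k, `|f k| <= `|g k|) -> summableZ g -> summableZ f.
Proof.
move=> fg [C gC]; exists C => m n; apply: le_trans (gC m n).
by apply: le_isum => k _; exact: fg.
Qed.

Lemma summableZD f g : summableZ f -> summableZ g -> summableZ (fun k => f k + g k).
Proof.
move=> [C fC] [D gD]; exists (C + D) => m n; apply: le_trans (lerD (fC m n) (gD m n)).
by rewrite -isumD; apply: le_isum => k _; exact: ler_normD.
Qed.

Lemma summableZZ c f : summableZ f -> summableZ (fun k => c * f k).
Proof.
move=> [C fC]; exists (`|c| * C) => m n.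
rewrite (_ : isum _ _ _ = `|c| * isum m n (fun k => `|f k|)).
  by rewrite ler_wpM2l.
by rewrite -isumZ; apply: eq_isum => k _; rewrite normrM.
Qed.

Lemma summableZ_abs f : summableZ f -> summableZ (fun k => `|f k|).
Proof. by apply: le_summableZ => k; rewrite normr_id. Qed.

Let E h : R := fine (\esum_(n in [set: int]) (h n)%:E)%E.

Let E_fin h : (forall k, 0 <= h k) -> summableZ h ->
  (\esum_(n in [set: int]) (h n)%:E)%E \is a fin_num.
Proof.
move=> h0 [C hC]; rewrite ge0_fin_numE; last first.
  by apply: esum_ge0 => n _; rewrite lee_fin.
apply: (@le_lt_trans _ _ C%:E); last by rewrite ltry.
apply/esum_isum => // m n; apply: le_trans (hC m n).
by apply: le_isum => k _; rewrite ger0_norm.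
Qed.

Let E_le h C : (forall k, 0 <= h k) -> summableZ h ->
  E h <= C <-> forall m n, isum m n h <= C.
Proof. by move=> h0 sh; rewrite -esum_isum// -lee_fin fineK// E_fin. Qed.

Let ED h g : (forall k, 0 <= h k) -> (forall k, 0 <= g k) ->
  summableZ h -> summableZ g -> E (fun k => h k + g k) = E h + E g.
Proof.
move=> h0 g0 sh sg; rewrite /E -fineD ?E_fin// -esumD//.
- by move=> n _; rewrite lee_fin.
- by move=> n _; rewrite lee_fin.
Qed.

Let EZ_le c h : 0 <= c -> (forall k, 0 <= h k) -> summableZ h ->
  E (fun k => c * h k) <= c * E h.
Proof.
move=> c0 h0 sh; apply/E_le => [k||m n]; first by rewrite mulr_ge0.
  exact: summableZZ.
by rewrite isumZ ler_wpM2l//; apply: (iffLR (E_le _ h0 sh)).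
Qed.

Let EZ c h : 0 <= c -> (forall k, 0 <= h k) -> summableZ h ->
  E (fun k => c * h k) = c * E h.
Proof.
move=> c0 h0 sh; apply/eqP; rewrite eq_le EZ_le//=.
move: c0; rewrite [0 <= c]le_eqVlt => /predU1P[<-|c0].
  rewrite mul0r /E fine_ge0// esum_ge0// => n _.
  by rewrite mul0r.
rewrite -ler_pdivlMl//.
(* The reverse inequality is [EZ_le] for the inverse factor. *)
have := @EZ_le c^-1 (fun k => c * h k).
rewrite (_ : (fun k => c^-1 * (c * h k)) = h).
  apply; rewrite ?invr_ge0 ?(ltW c0)//; last exact: summableZZ.
  by move=> k; rewrite mulr_ge0// ltW.
by apply/funext => k; rewrite mulKf// gt_eqF.
Qed.

(** Positive and negative parts are not additive, so linearity is proved with the freedom to write f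
    as any difference of nonnegative summable sequences. *)
Let sumZ_sub f p q : (forall k, f k = p k - q k) ->
  (forall k, 0 <= p k) -> (forall k, 0 <= q k) -> summableZ p -> summableZ q ->
  sumZ f = E p - E q.
Proof.
move=> fpq p0 q0 sp sq; rewrite /sumZ.
have -> : EFin \o f = ((EFin \o p) \- (EFin \o q))%E.
  by apply/funext => k /=; rewrite fpq EFinB.
have sE h : (forall k, 0 <= h k) -> summableZ h -> summable [set: int] (EFin \o h).
  move=> h0 sh; rewrite summableE (@eq_esum _ _ _ _ (EFin \o h)) ?E_fin//.
  by move=> k _ /=; rewrite ger0_norm.
rewrite esumB; [|exact: sE|exact: sE|by move=> k _; rewrite lee_fin..].
by rewrite fineB ?E_fin.
Qed.

Let sumZE f : summableZ f -> sumZ f = E (fun k => `|f k|) - E (fun k => `|f k| - f k).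
Proof.
move=> sf; apply: sumZ_sub => //.
- by move=> k; rewrite opprB addrCA subrr addr0.
- by move=> k; rewrite subr_ge0 ler_norm.
- exact: summableZ_abs.
- apply: summableZD; first exact: summableZ_abs.
  by apply: le_summableZ sf => k; rewrite normrN.
Qed.

Let abs_sub f : summableZ f ->
  [/\ summableZ (fun k => `|f k|), summableZ (fun k => `|f k| - f k) &
      forall k, 0 <= `|f k| - f k].
Proof.
move=> sf; split; [exact: summableZ_abs| |by move=> k; rewrite subr_ge0 ler_norm].
apply: summableZD; first exact: summableZ_abs.
by apply: le_summableZ sf => k; rewrite normrN.
Qed.

Lemma sumZD f g : summableZ f -> summableZ g ->
  sumZ (fun k => f k + g k) = sumZ f + sumZ g.
Proof.
move=> sf sg; rewrite (sumZE sf) (sumZE sg).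
have [? ? ?] := abs_sub sf; have [? ? ?] := abs_sub sg.
rewrite (@sumZ_sub _ (fun k => `|f k| + `|g k|)
  (fun k => (`|f k| - f k) + (`|g k| - g k))).
- rewrite (@ED (fun k => `|f k|) (fun k => `|g k|))//.
  by rewrite (@ED (fun k => `|f k| - f k) (fun k => `|g k| - g k))//; ring.
- by move=> k; ring.
- by move=> k; rewrite addr_ge0.
- by move=> k; rewrite addr_ge0.
- exact: summableZD.
- exact: summableZD.
Qed.

Lemma sumZZ c f : summableZ f -> sumZ (fun k => c * f k) = c * sumZ f.
Proof.
move=> sf; rewrite (sumZE sf); have [? ? ?] := abs_sub sf.
have [c0|c0] := leP 0 c.
  rewrite (@sumZ_sub _ (fun k => c * `|f k|) (fun k => c * (`|f k| - f k))).
  - by rewrite !EZ// mulrBr.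
  - by move=> k; ring.
  - by move=> k; rewrite mulr_ge0.
  - by move=> k; rewrite mulr_ge0.
  - exact: summableZZ.
  - exact: summableZZ.
have c0' : 0 <= - c by rewrite oppr_ge0 ltW.
rewrite (@sumZ_sub _ (fun k => - c * (`|f k| - f k)) (fun k => - c * `|f k|)).
- by rewrite !EZ//; ring.
- by move=> k; ring.
- by move=> k; rewrite mulr_ge0.
- by move=> k; rewrite mulr_ge0.
- exact: summableZZ.
- exact: summableZZ.
Qed.

Lemma sumZ_shift f (p : int) : sumZ (fun k => f (k + p)) = sumZ f.
Proof.
have bp : set_bij [set: int] [set: int] (fun n => n + p).
  by split => // [x y _ _ /addIr//|n _]; exists (n - p); rewrite ?subrK.
have e (g : int -> \bar R) :
    (\esum_(n in [set: int]) g n = \esum_(n in [set: int]) g (n + p)%R)%E.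
  by rewrite (reindex_esum [set: int] _ (fun n => n + p)).
rewrite [RHS]/sumZ (e _ ^\+)%E (e _ ^\-)%E /sumZ; congr (fine (_ - _)).
all: by apply: eq_esum => n _; rewrite ?funeposE ?funenegE.
Qed.

Lemma sumZ_ge0 f : (forall k, 0 <= f k) -> summableZ f -> 0 <= sumZ f.
Proof.
move=> f0 sf; rewrite (@sumZ_sub _ f (fun=> 0)) //.
- rewrite [X in _ - X](_ : _ = 0) ?subr0; last by rewrite /E esum1.
  by rewrite fine_ge0// esum_ge0// => n _; rewrite lee_fin.
- by move=> k; rewrite subr0.
- by exists 0 => m n; rewrite /isum big1// => i _; rewrite normr0.
Qed.

Lemma sumZ_le f C : (forall k, 0 <= f k) -> summableZ f ->
  sumZ f <= C <-> forall m n, isum m n f <= C.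
Proof.
move=> f0 sf; rewrite (@sumZ_sub _ f (fun=> 0)) //.
- rewrite [X in _ - X](_ : _ = 0) ?subr0; last by rewrite /E esum1.
  exact: E_le.
- by move=> k; rewrite subr0.
- by exists 0 => m n; rewrite /isum big1// => i _; rewrite normr0.
Qed.

Lemma sumZ_esum f : (forall k, 0 <= f k) -> summableZ f ->
  (\esum_(n in [set: int]) (f n)%:E)%E = (sumZ f)%:E.
Proof.
move=> f0 sf; rewrite (@sumZ_sub _ f (fun=> 0)) //.
- rewrite [X in _ - X](_ : _ = 0) ?subr0; last by rewrite /E esum1.
  by rewrite fineK// E_fin.
- by move=> k; rewrite subr0.
- by exists 0 => m n; rewrite /isum big1// => i _; rewrite normr0.
Qed.

End sumZ.

Section real_inner.
Context {R : realType}.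
Implicit Types (u v w : int -> R[i]).

(** The real part of [inner]. It gives the norms, and the self-adjointness of T and of the spectral
    projections enters only through it. *)
Definition ri u v : R := sumZ (fun n => complex.Re ((u n)^* * v n)).

Lemma in_l2D u v : in_l2 u -> in_l2 v -> in_l2 (u + v).
Proof.
move=> /in_l2P[C uC] /in_l2P[D vD]; apply/in_l2P.
by exists (2 * C + 2 * D); exact: l2bD.
Qed.

Lemma in_l2Z c u : in_l2 u -> in_l2 (c *: u).
Proof. by move=> /in_l2P[C uC]; apply/in_l2P; eexists; exact: l2bZ uC. Qed.

Lemma in_l2N u : in_l2 u -> in_l2 (- u).
Proof. by move=> ul; rewrite -scaleN1r; exact: in_l2Z. Qed.

Lemma in_l2B u v : in_l2 u -> in_l2 v -> in_l2 (u - v).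
Proof. by move=> ul vl; apply: in_l2D => //; exact: in_l2N. Qed.

Lemma in_l20 : in_l2 (0 : int -> R[i]).
Proof. by apply/in_l2P; exists 0; exact: l2b0. Qed.

Lemma summable_ri u v : in_l2 u -> in_l2 v ->
  summableZ (fun n => complex.Re ((u n)^* * v n)).
Proof.
move=> /in_l2P[C uC] /in_l2P[D vD]; exists (C + D) => m n.
apply: (@le_trans _ _ (isum m n (nsq \o u) + isum m n (nsq \o v))).
  rewrite -isumD; apply: le_isum => k _ /=.
  case: (u k) => x y; case: (v k) => x' y'; rewrite /nsq/= ler_norml.
  have := sqr_ge0 (x - x'); have := sqr_ge0 (y - y').
  have := sqr_ge0 (x + x'); have := sqr_ge0 (y + y').
  by move=> *; apply/andP; split; nra.
by rewrite lerD.
Qed.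

Lemma riC u v : ri u v = ri v u.
Proof.
congr sumZ; apply/funext => n; case: (u n) => x y; case: (v n) => x' y' /=.
by ring.
Qed.

Lemma riDr u v w : in_l2 u -> in_l2 v -> in_l2 w -> ri u (v + w) = ri u v + ri u w.
Proof.
move=> ul vl wl; rewrite /ri -sumZD; [|exact: summable_ri|exact: summable_ri].
congr sumZ; apply/funext => n.
change (complex.Re ((u n)^* * (v n + w n)) =
 complex.Re ((u n)^* * v n) + complex.Re ((u n)^* * w n)).
by rewrite mulrDr Re_addC.
Qed.

Lemma riZr (c : R) u v : in_l2 u -> in_l2 v -> ri u (c%:C *: v) = c * ri u v.
Proof.
move=> ul vl; rewrite /ri -sumZZ; last exact: summable_ri.
congr sumZ; apply/funext => n.
change (complex.Re ((u n)^* * (c%:C * v n)) = c * complex.Re ((u n)^* * v n)).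
by case: (u n) => x y; case: (v n) => x' y' /=; ring.
Qed.

Lemma riNr u v : in_l2 u -> in_l2 v -> ri u (- v) = - ri u v.
Proof.
move=> ul vl; rewrite -scaleN1r -[RHS]mulN1r -riZr//; congr (ri u (_ *: v)).
by apply: complexP => //=; rewrite oppr0.
Qed.

Lemma riBr u v w : in_l2 u -> in_l2 v -> in_l2 w -> ri u (v - w) = ri u v - ri u w.
Proof. by move=> ul vl wl; rewrite riDr ?riNr//; exact: in_l2N. Qed.

Lemma ri0r u : in_l2 u -> ri u 0 = 0.
Proof. by move=> ul; have := riBr ul in_l20 in_l20; rewrite !subrr. Qed.

Lemma riDl u v w : in_l2 u -> in_l2 v -> in_l2 w -> ri (u + v) w = ri u w + ri v w.
Proof. by move=> ul vl wl; rewrite riC riDr// !(riC w). Qed.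

Lemma riBl u v w : in_l2 u -> in_l2 v -> in_l2 w -> ri (u - v) w = ri u w - ri v w.
Proof. by move=> ul vl wl; rewrite riC riBr// !(riC w). Qed.

Lemma Re_conjM_nsq (z : R[i]) : complex.Re (z^* * z) = nsq z.
Proof. by case: z => x y; rewrite /nsq/=; ring. Qed.

Lemma ri_selfE u : ri u u = sumZ (nsq \o u).
Proof. by congr sumZ; apply/funext => n; rewrite Re_conjM_nsq. Qed.

Lemma summable_nsq u : in_l2 u -> summableZ (nsq \o u).
Proof.
move=> ul; apply: le_summableZ (summable_ri ul ul) => n.
by rewrite Re_conjM_nsq.
Qed.

Lemma ri_ge0 u : in_l2 u -> 0 <= ri u u.
Proof.
by move=> ul; rewrite ri_selfE sumZ_ge0//; [move=> k; exact: nsq_ge0|exact: summable_nsq].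
Qed.

Lemma ri_le u C : in_l2 u -> ri u u <= C <-> l2b u C.
Proof.
move=> ul; rewrite ri_selfE; apply: sumZ_le; last exact: summable_nsq.
by move=> k; exact: nsq_ge0.
Qed.

Lemma l2b_ri u : in_l2 u -> l2b u (ri u u).
Proof. by move=> ul; apply/ri_le. Qed.

Lemma l2b_in_l2 u C : l2b u C -> in_l2 u.
Proof. by move=> uC; apply/in_l2P; exists C. Qed.

Lemma l2norm_ri u : in_l2 u -> (l2norm u ^+ 2 = (ri u u)%:E)%E.
Proof.
move=> ul; rewrite /l2norm.
have -> : (\esum_(n in [set: int]) (ComplexField.Normc.normc (u n) ^+ 2)%:E)%E =
          (\esum_(n in [set: int]) ((nsq \o u) n)%:E)%E.
  by apply: eq_esum => n _; rewrite normc_sqr.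
rewrite sumZ_esum; [|by move=> k; exact: nsq_ge0|exact: summable_nsq].
rewrite -ri_selfE /= -[in RHS](sqr_sqrtr (ri_ge0 ul)). by rewrite expr2 EFinM.
Qed.

Section bounded_jacobi.
Variables a b : int -> R.
Hypothesis ab : exists M, forall n, `|a n| <= M /\ `|b n| <= M.
Local Notation T := (jacobi_op a b).

Lemma ri_jacobi u v : in_l2 u -> in_l2 v -> ri (T u) v = ri u (T v).
Proof.
have [M abM] := ab => ul vl.
have sl w k : in_l2 w -> in_l2 (fun n => w (n + k)).
  by move=> /in_l2P[C wC]; apply/in_l2P; exists C; exact: l2b_shift.
have sm (c : int -> R) w w' : (forall n, `|c n| <= M) -> in_l2 w -> in_l2 w' ->
    summableZ (fun n => c n * complex.Re ((w n)^* * w' n)).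
  move=> cM wl wl'; apply: le_summableZ (summableZZ M (summable_ri wl wl')) => n.
  by rewrite !normrM ler_wpM2r// (le_trans (cM n))// ler_norm.
have aM n : `|a n| <= M by have [] := abM n.
have bM n : `|b n| <= M by have [] := abM n.
have aM' n : `|a (n - 1)| <= M by have [] := abM (n - 1).
(* [F u v] collects the edges with u at the right end and v at the left. The opposite orientation is
   [F v u] after a shift by one site, so the form is symmetric in u and v. *)
pose F u v := sumZ (fun n => a n * complex.Re ((u (n + 1))^* * v n)).
have E u' v' : in_l2 u' -> in_l2 v' -> ri (T u') v' =
    F u' v' + F v' u' + sumZ (fun n => b n * complex.Re ((u' n)^* * v' n)).
  move=> ul' vl'.
  have -> : F v' u' = sumZ (fun n => a (n - 1) * complex.Re ((u' (n - 1))^* * v' n)).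
    rewrite -(sumZ_shift _ 1); congr sumZ; apply/funext => n.
    rewrite addrK; congr (_ * _).
    by case: (u' n) => x y; case: (v' (n + 1)) => x' y' /=; ring.
  have s1 := sm _ _ _ aM (sl _ 1 ul') vl'.
  have s2 := sm _ _ _ aM' (sl _ (- 1) ul') vl'.
  have s3 := sm _ _ _ bM ul' vl'.
  rewrite -(sumZD s1 s2) -(sumZD (summableZD s1 s2) s3).
  congr sumZ; apply/funext => n; rewrite /jacobi_op.
  case: (u' n) => x y; case: (u' (n - 1)) => x1 y1; case: (u' (n + 1)) => x2 y2.
  by case: (v' n) => x' y' /=; ring.
rewrite E// riC E// (addrC (F v u)); congr (_ + sumZ _).
apply/funext => n; congr (_ * _).
by case: (u n) => x y; case: (v n) => x' y' /=; ring.
Qed.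

End bounded_jacobi.

Section jop.
Variable J : jacobi2 R.
Local Notation T := (jacobi_op (ja J) (jb J)).

Lemma jop_l2b u C : l2b u C -> l2b (T u) (4 * C).
Proof.
rewrite (_ : 4 = 2 ^+ 2 :> R); last by ring.
apply: opnorm_l2b => //; last exact: jab_norm.
by move=> c v w _ _; rewrite linearP.
Qed.

Lemma in_l2_jop u : in_l2 u -> in_l2 (T u).
Proof. by move=> /in_l2P[C /jop_l2b uC]; apply/in_l2P; eexists; exact: uC. Qed.

Lemma ri_jop u v : in_l2 u -> in_l2 v -> ri (T u) v = ri u (T v).
Proof. by apply: ri_jacobi; exact: jab_bounded. Qed.

Lemma jpoly_l2b (q : {poly R[i]}) :
  exists2 K, 0 <= K & forall u C, l2b u C -> l2b (jpoly (ja J) (jb J) q u) (K * C).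
Proof.
elim/poly_ind: q => [|q c [K K0 qK]].
  exists 0 => // u C uC; rewrite -polyC0 jpolyC scale0r mul0r; exact: l2b0.
exists (2 * (4 * K) + 2 * nsq c) => [|u C uC].
  by rewrite addr_ge0// !mulr_ge0// nsq_ge0.
rewrite jpolyD jpolyXM jpolyC mulrDl -!mulrA; apply: l2bD; last exact: l2bZ.
by apply: jop_l2b; exact: qK.
Qed.

Lemma in_l2_jpoly (q : {poly R[i]}) u : in_l2 u -> in_l2 (jpoly (ja J) (jb J) q u).
Proof.
have [K K0 qK] := jpoly_l2b q.
by move=> /in_l2P[C /qK uC]; apply/in_l2P; eexists; exact: uC.
Qed.

Lemma ri_jpoly (q : {poly R[i]}) u v : (forall i, complex.Im q`_i = 0) -> in_l2 u -> in_l2 v ->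
  ri (jpoly (ja J) (jb J) q u) v = ri u (jpoly (ja J) (jb J) q v).
Proof.
elim/poly_ind: q u v => [|q c ih] u v qr ul vl.
  by rewrite -polyC0 !jpolyC !scale0r riC !ri0r.
have [x cx] : exists x : R, c = x%:C.
  exists (complex.Re c); have := qr 0%N.
  by rewrite coefD coefMX coefC/= add0r; case: (c) => x y /= ->.
have {}qr i : complex.Im q`_i = 0.
  by have := qr i.+1; rewrite coefD coefMX coefC/= addr0.
have ql w : in_l2 w -> in_l2 (jpoly (ja J) (jb J) q w) by exact: in_l2_jpoly.
rewrite !jpolyD !jpolyXM !jpolyC cx.
rewrite (riDl (in_l2_jop (ql _ ul)) (in_l2Z _ ul) vl).
rewrite (riDr ul (in_l2_jop (ql _ vl)) (in_l2Z _ vl)) (riZr _ ul vl).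
rewrite [ri (_ *: u) v]riC (riZr _ vl ul) [ri v u]riC; congr (_ + _).
rewrite (ri_jop (ql _ ul) vl) (ih _ _ qr ul (in_l2_jop vl)).
by rewrite jpoly_comm.
Qed.

End jop.

End real_inner.

(** * Floquet matrices *)

Section floquet.
Context {R : realType} (a b : int -> R) (p : nat).
Local Notation N := p.+1.
Hypothesis aN : forall n, a (n + N%:Z) = a n.
Hypothesis bN : forall n, b (n + N%:Z) = b n.
Local Notation T := (jacobi_op a b).
Local Notation I := ('i%C : R[i]).
Implicit Types (u v : int -> R[i]) (q : {poly R[i]}) (x : 'cV[R[i]]_N).

Let I_neq0 : I != 0.
Proof. by apply/eqP => -[/eqP]; rewrite oner_eq0. Qed.

Let I_conj : I^* * I = 1.
Proof. by apply: complexP => /=; ring. Qed.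

(* The choice of the Floquet multiplier i makes the Hermitian matrix below have
   the discriminant itself as its characteristic polynomial: the boundary terms
   contribute i + 1/i = 0. *)
Definition twisted u := forall n, u (n + N%:Z) = I * u n.

Lemma twistedB u n : twisted u -> u (n - N%:Z) = - I * u n.
Proof.
move=> tu; have := tu (n - N%:Z); rewrite subrK => ->.
by rewrite mulrA (_ : - I * I = 1) ?mul1r//; apply: complexP => /=; ring.
Qed.

Lemma twistedXn u k n : twisted u -> u (n + (k * N)%N%:Z) = I ^+ k * u n.
Proof.
move=> tu; elim: k => [|k ih]; first by rewrite mul0n addr0 mul1r.
by rewrite exprS -mulrA -ih -tu; congr u; lia.
Qed.

Lemma twisted_eq u v : twisted u -> twisted v ->
  (forall k : int, 0 <= k < N%:Z -> u k = v k) -> u = v.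
Proof.
move=> tu tv uv; apply/funext => n.
have e := divz_eq n N%:Z.
have r0 : 0 <= (n %% N%:Z)%Z < N%:Z by rewrite modz_ge0//= ltz_pmod.
have [q0|q0] := leP 0 (n %/ N%:Z)%Z.
  rewrite (_ : n = (n %% N%:Z)%Z + (absz (n %/ N%:Z)%Z * N)%N%:Z); last by lia.
  by rewrite !twistedXn// uv.
have e' : (n %% N%:Z)%Z = n + (absz (n %/ N%:Z)%Z * N)%N%:Z by lia.
have := uv _ r0; rewrite e' !twistedXn//; apply: mulfI.
by rewrite expf_neq0// I_neq0.
Qed.

(** The twisted sequence whose values at the sites 0, ..., N - 1 are the entries of x. *)
Definition bloch x : int -> R[i] :=
  fun n => I ^ (n %/ N%:Z)%Z * x (inord (absz (n %% N%:Z)%Z)) 0.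

Lemma bloch_twisted x : twisted (bloch x).
Proof.
move=> n; rewrite /bloch modzDr divzDr ?dvdzz// divzz /=.
by rewrite expfzDr// expr1z mulrAC mulrC.
Qed.

Lemma blochE x (j : 'I_N) : bloch x j%:Z = x j 0.
Proof.
rewrite /bloch divz_nat modz_nat divn_small// modn_small//=.
by rewrite expr0z mul1r inord_val.
Qed.

Lemma bloch_linear : linear bloch.
Proof.
move=> c x y; apply/funext => n; rewrite /bloch.
change (I ^ (n %/ N%:Z)%Z * (c *: x + y) (inord (absz (n %% N%:Z)%Z)) 0 =
 c * (I ^ (n %/ N%:Z)%Z * x (inord (absz (n %% N%:Z)%Z)) 0) +
 I ^ (n %/ N%:Z)%Z * y (inord (absz (n %% N%:Z)%Z)) 0).
by rewrite !mxE; ring.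
Qed.
HB.instance Definition _ := GRing.isLinear.Build _ _ _ _ bloch bloch_linear.

Lemma jacobi_twisted u : twisted u -> twisted (T u).
Proof.
move=> tu n; rewrite /jacobi_op aN bN.
rewrite (_ : a (n + N%:Z - 1) = a (n - 1)); last by rewrite -[RHS]aN; congr a; lia.
rewrite (_ : n + N%:Z + 1 = n + 1 + N%:Z); last by lia.
rewrite (_ : n + N%:Z - 1 = n - 1 + N%:Z); last by lia.
by rewrite !tu; ring.
Qed.

Definition floquet_mx : 'M[R[i]]_N :=
  \matrix_(j, k) T (bloch (delta_mx k 0)) j%:Z.
Local Notation M := floquet_mx.

Lemma jacobi_bloch x : T (bloch x) = bloch (M *m x).
Proof.
apply: twisted_eq; [exact/jacobi_twisted/bloch_twisted|exact: bloch_twisted|].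
move=> k k0; have kN : (absz k < N)%N by lia.
have -> : k = (Ordinal kN)%:Z by rewrite /=; lia.
rewrite blochE mxE [x in LHS](_ : x = \sum_l x l 0 *: delta_mx l 0).
  rewrite !linear_sum fct_sumE; apply: eq_bigr => l _.
  by rewrite !linearZ mxE mulrC.
apply/colP => i; rewrite summxE (bigD1 i)//= big1 ?addr0 => [|l li].
  by rewrite !mxE !eqxx mulr1.
by rewrite !mxE eq_sym (negbTE li) mulr0.
Qed.

Lemma jpoly_bloch q x : jpoly a b q (bloch x) = bloch (horner_mx M q *m x).
Proof.
elim/poly_ind: q => [|q c ih].
  by rewrite -polyC0 jpolyC scale0r horner_mx_C mul_scalar_mx !scale0r linear0.
rewrite jpolyD jpolyXM jpolyC ih [X in X + _]jacobi_bloch rmorphD rmorphM/= horner_mx_X horner_mx_C.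
by rewrite mulmxDl mul_scalar_mx linearD linearZ mulmxA -comm_horner_mx.
Qed.

(* Green's formula; the Wronskian boundary terms cancel as |i| = 1. *)
Lemma jacobi_green u v : twisted u -> twisted v ->
  \sum_(j < N) (u j%:Z)^* * T v j%:Z = \sum_(j < N) (T u j%:Z)^* * v j%:Z.
Proof.
move=> tu tv; apply/eqP; rewrite -subr_eq0 -sumrB; apply/eqP.
pose W (j : nat) := (a (j%:Z - 1))%:C *
  ((u (j%:Z - 1))^* * v j%:Z - (u j%:Z)^* * v (j%:Z - 1)).
rewrite (eq_bigr (fun j : 'I_N => W j.+1 - W j)) => [|j _].
  rewrite -(big_mkord xpredT (fun j => W j.+1 - W j)) telescope_sumr// /W.
  rewrite (_ : N%:Z - 1 = 0%:Z - 1 + N%:Z); last by lia.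
  rewrite (_ : N%:Z = 0%:Z + N%:Z) 1?add0r// aN !tu !tv.
  have -> (z w z' w' : R[i]) : (I * z)^* * (I * w) - (I * z')^* * (I * w') =
     I^* * I * (z^* * w - z'^* * w').
    by rewrite !rmorphM/=; ring.
  by rewrite I_conj mul1r subrr.
rewrite /W /jacobi_op (_ : j.+1%:Z - 1 = j%:Z); last by lia.
rewrite (_ : j.+1%:Z = j%:Z + 1); last by lia.
have cr (x : R) : Num.conj x%:C = x%:C :> R[i] := conjc_real x.
by rewrite !rmorphD !rmorphM/= !cr; ring.
Qed.

Lemma floquet_mx_herm j k : M j k = (M k j)^*.
Proof.
rewrite !mxE.
have h (x : 'I_N) (f : 'I_N -> R[i]) :
   \sum_(l < N) (bloch (delta_mx x 0) l%:Z)^* * f l = f x.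
  rewrite (bigD1 x)//= big1 ?addr0 => [|l lx]; rewrite blochE mxE.
    by rewrite !eqxx rmorph1 mul1r.
  by rewrite eqxx andbT (negbTE lx) rmorph0 mul0r.
have := jacobi_green (@bloch_twisted (delta_mx j 0)) (@bloch_twisted (delta_mx k 0)).
rewrite (h j (fun l => T (bloch (delta_mx k 0)) l%:Z)) => ->.
have hk := h k (fun l => T (bloch (delta_mx j 0)) l%:Z); cbn beta in hk.
rewrite -hk rmorph_sum.
by apply: eq_bigr => l _; rewrite rmorphM/= conjCK mulrC.
Qed.

Lemma floquet_mx_conj : map_mx Num.conj M = M^T.
Proof. by apply/matrixP => j k; rewrite [RHS]mxE floquet_mx_herm [LHS]mxE. Qed.

Lemma floquet_mx_normal : M \is normalmx.
Proof.
apply: hermitian_normalmx; apply/is_hermitianmxP.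
by rewrite expr0 scale1r -map_trmx floquet_mx_conj trmxK.
Qed.

Lemma char_poly_trmx (n : nat) (A : 'M[R[i]]_n) : char_poly A^T = char_poly A.
Proof.
rewrite /char_poly -det_tr; congr (\det _); apply/matrixP => i j.
by rewrite !mxE eq_sym.
Qed.

(** Conjugation transposes a Hermitian matrix and so fixes its characteristic polynomial. *)
Lemma floquet_char_poly_real i : complex.Im (char_poly M)`_i = 0.
Proof.
have : map_poly (Num.conj : R[i] -> R[i]) (char_poly M) = char_poly M.
  by rewrite map_char_poly floquet_mx_conj char_poly_trmx.
move=> /(congr1 (fun q : {poly R[i]} => q`_i)); rewrite coef_map.
by case: (_`_i) => x y /= [] /eqP; rewrite eqNr => /eqP.
Qed.

Definition period_prod : R := \prod_(j < N) a j%:Z.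

Lemma period_prodE k : \prod_(j < N) a (k + j%:Z) = period_prod.
Proof.
have step m : \prod_(j < N) a (m + 1 + j%:Z) = \prod_(j < N) a (m + j%:Z).
  rewrite big_ord_recr [RHS]big_ord_recl /= mulrC addr0; congr (_ * _).
    by rewrite -[RHS]aN; congr a; lia.
  by apply: eq_bigr => i _; congr a; rewrite /bump/=; lia.
have up (m : nat) k' : \prod_(j < N) a (k' + m%:Z + j%:Z) = \prod_(j < N) a (k' + j%:Z).
  elim: m => [|m ih]; first by rewrite addr0.
  by rewrite (_ : k' + m.+1%:Z = k' + m%:Z + 1) ?step//; lia.
rewrite /period_prod; have [k0|k0] := leP 0 k.
  rewrite (_ : k = 0 + (absz k)%:Z) ?up; last by lia.
  by apply: eq_bigr => i _; rewrite add0r.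
by rewrite -(up (absz k) k); apply: eq_bigr => i _; congr a; lia.
Qed.

Lemma bloch_delta (r : 'I_N) (k n : int) : (k %% N%:Z)%Z = r%:Z ->
  (`|n - k| < N%:Z)%R -> bloch (delta_mx r 0) n = I ^ (k %/ N%:Z)%Z * dlt k n.
Proof.
move=> kr nk; rewrite /bloch /dlt mxE; have [->|nk'] := eqVneq n k.
  by rewrite kr absz_nat inord_val !eqxx.
rewrite (_ : (_ == r) = false) /= ?mulr0//.
apply/negP => /eqP/(congr1 val)/=.
have n0 : 0 <= (n %% N%:Z)%Z < N%:Z by rewrite modz_ge0//= ltz_pmod.
rewrite inordK; last by lia.
have := divz_eq n N%:Z; have := divz_eq k N%:Z.
set qn := (n %/ _)%Z; set qk := (k %/ _)%Z => e1 e2 e3.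
have e4 : n - k = (qn - qk) * N%:Z by rewrite mulrBl; lia.
by have : qn - qk = 0; [nia|move/eqP: nk'; lia].
Qed.

(** Seen from sites closer than N, a unit sequence is indistinguishable from a twisted one. This
    carries information from the Floquet matrix to the operator on the line. *)
Lemma dlt_bloch k : exists2 u, twisted u &
  (forall n : int, (`|n - k| < N%:Z)%R -> u n = dlt k n).
Proof.
have k0 : 0 <= (k %% N%:Z)%Z < N%:Z by rewrite modz_ge0//= ltz_pmod.
have rN : (absz (k %% N%:Z)%Z < N)%N by lia.
exists (I ^ (- (k %/ N%:Z)%Z) *: bloch (delta_mx (Ordinal rN) 0)).
  move=> n; set e := bloch _.
  change (I ^ (- (k %/ N%:Z)%Z) * e (n + N%:Z) = I * (I ^ (- (k %/ N%:Z)%Z) * e n)).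
  by rewrite /e (bloch_twisted _ n) mulrCA.
move=> n nk; have h := @bloch_delta (Ordinal rN) k n _ nk.
change (I ^ (- (k %/ N%:Z)%Z) * bloch (delta_mx (Ordinal rN) 0) n = dlt k n).
by rewrite h; [rewrite mulrA -expfzDr// addNr expr0z mul1r|rewrite /=; lia].
Qed.

(** The degree of q is less than N, so q(T) evaluated at j sees only the tooth at j of the Bloch
    basis sequence and never reaches the neighbouring periods. *)
Lemma trace_floquet q : (size q <= N)%N ->
  \tr (horner_mx M q) = \sum_(j < N) jpoly a b q (dlt j%:Z) j%:Z.
Proof.
move=> qN; rewrite /mxtrace; apply: eq_bigr => j _.
have -> (A : 'M[R[i]]_N) : A j j = (A *m delta_mx j 0) j (0 : 'I_1).
  by rewrite -colE mxE.
rewrite -blochE -jpoly_bloch; apply: (jpoly_band a b qN) => k kj.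
have jN : (j%:Z %% N%:Z)%Z = j%:Z by rewrite modz_nat modn_small.
rewrite (bloch_delta jN); last by lia.
rewrite divz_nat divn_small//.
by rewrite expr0z mul1r.
Qed.

Section annihilator.
Variable P : {poly R[i]}.
Hypothesis szP : (size P <= N.+1)%N.
Hypothesis PN : P`_N = 1.
Hypothesis Preal : forall i, complex.Im P`_i = 0.
Hypothesis Pkill : forall u, twisted u -> jpoly a b P u = 0.

Lemma floquet_dlt_right k : jpoly a b P (dlt k) (k + N%:Z) = period_prod%:C.
Proof.
rewrite (jpoly_dlt_far _ _ szP); last by lia.
by rewrite PN mul1r iter_dlt_right period_prodE.
Qed.

Lemma floquet_dlt_left k : jpoly a b P (dlt k) (k - N%:Z) = period_prod%:C.
Proof.
rewrite (jpoly_dlt_far _ _ szP); last by lia.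
by rewrite PN mul1r iter_dlt_left period_prodE.
Qed.

(** For n - N < m < n the window around n meets a twisted sequence supported on m + N Z in exactly
    two sites, m and m + N, with values 1 and i. As P kills it, x + i y = 0, where x and y are the
    entries of P(T) from m and from m + N; both are real, so both vanish. The diagonal entry needs a
    separate argument. *)
Lemma floquet_dlt_mid k n : (`|k - n| < N%:Z)%R -> jpoly a b P (dlt k) n = 0.
Proof.
have real2 (x y : R[i]) : complex.Im x = 0 -> complex.Im y = 0 -> x + I * y = 0 ->
    x = 0 /\ y = 0.
  case: x => x1 x2; case: y => y1 y2 /= -> -> [].
  by rewrite !(mul0r, mul1r, mulr0, subr0, addr0, add0r) => -> ->.
have tr m l : complex.Im (jpoly a b P (dlt m) l) = 0.
  exact: jpoly_dlt_real.
have side m : n - N%:Z < m < n ->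
    jpoly a b P (dlt m) n = 0 /\ jpoly a b P (dlt (m + N%:Z)) n = 0.
  move=> mn; apply: real2 => //.
  have [u tu um] := dlt_bloch m; have Pu := Pkill tu.
  have := congr1 (fun f => f n) Pu; rewrite /= => {}Pu.
  change (jpoly a b P u n = 0) in Pu; rewrite -[RHS]Pu.
  rewrite [RHS](jpoly_band (v := dlt m + I *: dlt (m + N%:Z)) _ _ szP).
    by rewrite jpoly_addE jpoly_scaleE.
  move=> j jn; change (u j = dlt m j + I * dlt (m + N%:Z) j).
  have [h|h] := ltP `|j - m| N%:Z.
    by rewrite um// /dlt (_ : (j == m + N%:Z) = false) ?mulr0 ?addr0//; lia.
  rewrite {1}/dlt (_ : (j == m) = false) ?add0r; last by lia.
  rewrite -[j](subrK N%:Z) tu um; last by lia.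
  by rewrite /dlt (inj_eq (addIr _)).
move=> kn; have [h|h|->] := ltgtP k n.
- by have [|//] := side k; lia.
- have := side (k - N%:Z); rewrite subrK => -[|//]; lia.
have [u tu um] := dlt_bloch n; have Pu := Pkill tu.
have := congr1 (fun f => f n) Pu; rewrite /= => {}Pu.
change (jpoly a b P u n = 0) in Pu; rewrite -[RHS]Pu.
(* From the diagonal the window meets three teeth, with values -i, 1 and i. The outer two contribute
   i A - i A = 0, leaving the diagonal entry alone. *)
rewrite [RHS](jpoly_band (v := dlt n + I *: dlt (n + N%:Z) - I *: dlt (n - N%:Z)) _ _ szP).
  rewrite jpoly_subE jpoly_addE !jpoly_scaleE.
  have := floquet_dlt_right (n - N%:Z); rewrite subrK => ->.
  by have := floquet_dlt_left (n + N%:Z); rewrite addrK => ->; rewrite addrK.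
move=> j jn.
change (u j = dlt n j + I * dlt (n + N%:Z) j - I * dlt (n - N%:Z) j).
have [h|h] := ltP `|j - n| N%:Z.
  rewrite um// /dlt (_ : (j == n + N%:Z) = false); last by lia.
  by rewrite (_ : (j == n - N%:Z) = false) ?mulr0 ?addr0 ?subr0//; lia.
have un : u n = 1 by rewrite um ?subrr// /dlt eqxx.
have [->|->] : j = n + N%:Z \/ j = n - N%:Z by lia.
  rewrite tu un /dlt eqxx (_ : (_ == n) = false); last by lia.
  by rewrite (_ : (_ == n - N%:Z) = false) ?mulr0 ?mulr1 ?subr0 ?add0r//; lia.
rewrite twistedB// un /dlt eqxx (_ : (_ == n) = false); last by lia.
by rewrite (_ : (_ == n + N%:Z) = false) ?mulr0 ?mulr1 ?add0r//; lia.
Qed.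

(** The magic formula P(T) = A (S + S^-1): of the 2N + 1 diagonals of the band only the two extreme
    ones survive. *)
Lemma annihilator_magic u n :
  jpoly a b P u n = period_prod%:C * (u (n - N%:Z) + u (n + N%:Z)).
Proof.
rewrite (jpoly_window a b _ _ szP) (_ : (N + N).+1 = (p + N).+2)//.
rewrite big_ord_recl big_ord_recr big1 => [|j _]; last first.
  rewrite floquet_dlt_mid ?mulr0//= /bump leq0n add1n.
  by have := ltn_ord j; move: (nat_of_ord j) => j'; lia.
rewrite /= add0r addr0 /bump leq0n.
rewrite (_ : n - N%:Z + (1 + (p + N))%N%:Z = n + N%:Z); last by lia.
have := floquet_dlt_right (n - N%:Z); rewrite subrK => ->.
by have := floquet_dlt_left (n + N%:Z); rewrite addrK => ->; rewrite mulrDr !(mulrC period_prod%:C).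
Qed.

End annihilator.

(** By Cayley-Hamilton the characteristic polynomial kills every twisted sequence. *)
Lemma floquet_magic u n : jpoly a b (char_poly M) u n =
  period_prod%:C * (u (n - N%:Z) + u (n + N%:Z)).
Proof.
apply: annihilator_magic; first by rewrite size_char_poly.
- by have /monicP := char_poly_monic M; rewrite lead_coefE size_char_poly.
- exact: floquet_char_poly_real.
move=> v tv; pose x : 'cV[R[i]]_N := \col_j v j%:Z.
have -> : v = bloch x.
  apply: twisted_eq => // [|k k0]; first exact: bloch_twisted.
  have kN : (absz k < N)%N by lia.
  have -> : k = (Ordinal kN)%:Z by rewrite /=; lia.
  by rewrite blochE mxE.
by rewrite jpoly_bloch Cayley_Hamilton mul0mx linear0.
Qed.

End floquet.

(** * Norms of polynomials of isospectral matrices *)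

Section complex_cvg.
Context {R : realType}.
Implicit Types (z w : nat -> R[i]) (l m : R[i]).

Definition ccvg z l :=
  (complex.Re (z k) @[k --> \oo] --> complex.Re l) /\
  (complex.Im (z k) @[k --> \oo] --> complex.Im l).

Lemma ccvg_cst l : ccvg (fun=> l) l.
Proof. by split; exact: cvg_cst. Qed.

Lemma ccvgD z w l m : ccvg z l -> ccvg w m -> ccvg (fun k => z k + w k) (l + m).
Proof.
move=> [z1 z2] [w1 w2]; split.
  rewrite Re_addC (_ : (fun k => _) = (fun k => complex.Re (z k) + complex.Re (w k))).
    exact: cvgD.
  by apply/funext => k; rewrite Re_addC.
rewrite Im_addC (_ : (fun k => _) = (fun k => complex.Im (z k) + complex.Im (w k))).
  exact: cvgD.
by apply/funext => k; rewrite Im_addC.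
Qed.

Lemma ccvgM z w l m : ccvg z l -> ccvg w m -> ccvg (fun k => z k * w k) (l * m).
Proof.
move=> [z1 z2] [w1 w2]; split.
  rewrite (_ : complex.Re (l * m) =
      complex.Re l * complex.Re m - complex.Im l * complex.Im m); last first.
    by case: l {z1 z2}; case: m {w1 w2}.
  rewrite (_ : (fun k => _) = (fun k => complex.Re (z k) * complex.Re (w k) -
      complex.Im (z k) * complex.Im (w k))).
    by apply: cvgB; apply: cvgM.
  by apply/funext => k; case: (z k); case: (w k).
rewrite (_ : complex.Im (l * m) =
    complex.Re l * complex.Im m + complex.Im l * complex.Re m); last first.
  by case: l {z1 z2}; case: m {w1 w2}.
rewrite (_ : (fun k => _) = (fun k => complex.Re (z k) * complex.Im (w k) +
    complex.Im (z k) * complex.Re (w k))).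
  by apply: cvgD; apply: cvgM.
by apply/funext => k; case: (z k); case: (w k).
Qed.

Lemma ccvg_sum n (z : 'I_n -> nat -> R[i]) (l : 'I_n -> R[i]) :
  (forall i, ccvg (z i) (l i)) -> ccvg (fun k => \sum_(i < n) z i k) (\sum_(i < n) l i).
Proof.
elim: n z l => [|n ih] z l zl.
  rewrite big_ord0 (_ : (fun k => _) = fun=> 0); first exact: ccvg_cst.
  by apply/funext => k; rewrite big_ord0.
rewrite big_ord_recl (_ : (fun k => _) =
  (fun k => z ord0 k + \sum_(i < n) z (lift ord0 i) k)).
  by apply: ccvgD => //; apply: (ih (fun i => z (lift ord0 i)) (fun i => l (lift ord0 i))).
by apply/funext => k; rewrite big_ord_recl.
Qed.

Lemma ccvg_unique z l m : ccvg z l -> ccvg z m -> l = m.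
Proof.
move=> [z1 z2] [w1 w2]; apply: complexP.
  exact: (cvg_unique _ z1 w1).
exact: (cvg_unique _ z2 w2).
Qed.

Lemma ccvgS z l : ccvg z l -> ccvg (fun k => z k.+1) l.
Proof.
move=> [z1 z2]; split.
  by rewrite (cvg_shiftS (fun k => complex.Re (z k))).
by rewrite (cvg_shiftS (fun k => complex.Im (z k))).
Qed.

Lemma ccvg_nsq z l : ccvg z l -> nsq (z k) @[k --> \oo] --> nsq l.
Proof.
move=> [z1 z2]; apply: cvgD.
  by rewrite [in X in _ --> X]expr2; apply: cvg_trans (cvgM z1 z1).
by rewrite [in X in _ --> X]expr2; apply: cvg_trans (cvgM z2 z2).
Qed.

(** Fatou's lemma for sequences: the bound concerns finite windows, which pass to the pointwise
    limit. *)
Lemma l2b_ccvg (v : nat -> int -> R[i]) (l : int -> R[i]) D :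
  (forall n, ccvg (fun k => v k n) (l n)) -> (forall k, l2b (v k) D) -> l2b l D.
Proof.
move=> vl vD m n.
have h : isum m n (nsq \o v k) @[k --> \oo] --> isum m n (nsq \o l).
  apply: cvg_big => [|i _]; first exact: add_continuous.
  exact: ccvg_nsq (vl _).
by apply: (ler_cvg_to h (cvg_cst D)); near=> k; exact: vD.
Unshelve. all: by end_near. Qed.

(** A value of q(T) v depends on finitely many sites, so q(T) is continuous for pointwise
    convergence. *)
Lemma ccvg_jpoly (a b : int -> R) q (v : nat -> int -> R[i]) (l : int -> R[i]) n :
  (forall n, ccvg (fun k => v k n) (l n)) ->
  ccvg (fun k => jpoly a b q (v k) n) (jpoly a b q l n).
Proof.
move=> vl; rewrite (jpoly_window _ _ _ _ (leqnSn (size q))).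
rewrite (_ : (fun k => _) = (fun k => \sum_(j < (size q + size q).+1)
  v k (n - (size q)%:Z + j%:Z) *
  jpoly a b q (dlt (n - (size q)%:Z + j%:Z)) n)).
  by apply: ccvg_sum => i; apply: ccvgM => //; exact: ccvg_cst.
by apply/funext => k; rewrite (jpoly_window _ _ _ _ (leqnSn (size q))).
Qed.

End complex_cvg.

(** A small t brings the factor of D close to 1, so that a contraction applied to v stays a
    contraction; the factor 2 of [l2bD] would destroy this. *)
Lemma l2bD_weight (R : realType) (t : R) (u v : int -> R[i]) C D : 0 < t ->
  l2b u C -> l2b v D -> l2b (u + v) ((1 + t^-1) * C + (1 + t) * D).
Proof.
move=> t0 h h' m n.
apply: (@le_trans _ _ ((1 + t^-1) * isum m n (nsq \o u) + (1 + t) * isum m n (nsq \o v))).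
  rewrite -!isumZ -isumD; apply: le_isum => k _ /=.
  change ((u + v) k) with (u k + v k).
  case: (u k) => x y; case: (v k) => x' y'; rewrite /nsq/=.
  have s (p q : R) : (p + q) ^+ 2 <= (1 + t^-1) * p ^+ 2 + (1 + t) * q ^+ 2.
    rewrite -subr_ge0 (_ : _ - _ = t^-1 * (p - t * q) ^+ 2).
      by rewrite mulr_ge0 ?sqr_ge0// invr_ge0 ltW.
    by field; rewrite gt_eqF.
  by have := s x x'; have := s y y'; lra.
have t1 : 0 <= t^-1 by rewrite invr_ge0 ltW.
by rewrite lerD// ler_wpM2l// addr_ge0// ltW.
Qed.

Lemma linear_l2Z (R : realType) (B : (int -> R[i]) -> int -> R[i]) c u :
  linear_l2 B -> in_l2 u -> B (c *: u) = c *: B u.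
Proof.
move=> lB ul; have B0 : B 0 = 0.
  have := lB 1 0 0 in_l20 in_l20.
  by rewrite scaler0 addr0 scale1r -{1}[B 0]addr0 => /addrI.
by have := lB c u 0 ul in_l20; rewrite !addr0 B0 addr0.
Qed.

Lemma ri_sub_scale (R : realType) (m : R) (u v w : int -> R[i]) :
  in_l2 u -> in_l2 v -> in_l2 w -> ri w u = ri v v ->
  ri (w - m%:C *: u) (w - m%:C *: u) = ri w w - 2 * m * ri v v + m ^+ 2 * ri u u.
Proof.
move=> ul vl wl wu; have ml : in_l2 (m%:C *: u) by exact: in_l2Z.
rewrite (riBl wl ml (in_l2B wl ml)) (riBr wl wl ml) (riBr ml wl ml).
rewrite (riZr m wl ul) (riZr m ml ul) [ri (m%:C *: u) w]riC (riZr m wl ul).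
by rewrite [ri (m%:C *: u) u]riC (riZr m ul ul) wu; ring.
Qed.

(** * Neumann series *)

Section neumann.
Context {R : realType} (J : jacobi2 R) (q : {poly R[i]}) (kappa : R).
Hypothesis k01 : 0 <= kappa < 1.
Local Notation S := (jpoly (ja J) (jb J) q).
Hypothesis Sk : forall u C, l2b u C -> l2b (S u) (kappa * C).

Let v (K : nat) (u : int -> R[i]) : int -> R[i] := \sum_(k < K) iter k S u.

Let vS K u : v K.+1 u = u + S (v K u).
Proof.
rewrite /v big_ord_recl/= linear_sum; congr (_ + _).
Qed.

Let vSr K u : v K (S u) = S (v K u).
Proof.
rewrite /v linear_sum; apply: eq_bigr => i _.
by rewrite -iterSr.
Qed.

Let v_linear K : linear (v K).
Proof.
move=> c u w; elim: K => [|K ih]; first by rewrite /v !big_ord0 scaler0 addr0.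
by rewrite !vS ih linearP scalerDr !addrA; congr (_ + _); rewrite addrAC.
Qed.

Let vE K u n : v K u n = \sum_(k < K) iter k S u n.
Proof. by rewrite /v fct_sumE. Qed.

Let iterS_l2b u C k : l2b u C -> l2b (iter k S u) (kappa ^+ k * C).
Proof.
move=> uC; elim: k => [|k ih] /=; first by rewrite mul1r.
by rewrite exprS -mulrA; exact: Sk.
Qed.

Let B u : int -> R[i] := fun n =>
  lim (complex.Re (v K u n) @[K --> \oo]) +i* lim (complex.Im (v K u n) @[K --> \oo]).

Let series_part (f : R[i] -> R) u C n :
  (forall z, `|f z| <= Num.sqrt (nsq z)) -> l2b u C ->
  cvgn (series (fun k => f (iter k S u n))).
Proof.
move=> fz uC; apply: normed_cvg.
have /andP[k0 k1] := k01.
apply: (@series_le_cvg _ _ (geometric (Num.sqrt C) (Num.sqrt kappa))).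
- by move=> k /=.
- by move=> k; rewrite /geometric/= mulr_ge0// ?exprn_ge0 ?sqrtr_ge0.
- move=> k; rewrite /geometric/= (le_trans (fz _))// mulrC.
  have := l2b_term n (iterS_l2b k uC) => h.
  rewrite -ler_sqr ?nnegrE ?mulr_ge0 ?exprn_ge0 ?sqrtr_ge0//.
  rewrite sqr_sqrtr ?nsq_ge0// exprMn exprAC !sqr_sqrtr//.
  exact: l2b_ge0 uC.
- apply: is_cvg_geometric_series.
  rewrite ger0_norm ?sqrtr_ge0// -[ltRHS]sqrtr1 ltr_sqrt//.
Qed.

Let B_ccvg u C n : l2b u C -> ccvg (fun K => v K u n) (B u n).
Proof.
move=> uC; split => /=.
  have -> : (fun K => complex.Re (v K u n)) = series (fun k => complex.Re (iter k S u n)).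
    by apply/funext => K; rewrite vE Re_sumC /series/= big_mkord.
  apply: (series_part (f := @complex.Re R) _ uC) => -[x y].
  by rewrite -sqrtr_sqr ler_wsqrtr// lerDl sqr_ge0.
have -> : (fun K => complex.Im (v K u n)) = series (fun k => complex.Im (iter k S u n)).
  by apply/funext => K; rewrite vE Im_sumC /series/= big_mkord.
apply: (series_part (f := @complex.Im R) _ uC) => -[x y].
by rewrite -sqrtr_sqr ler_wsqrtr// lerDr sqr_ge0.
Qed.

Lemma neumann_inverse : exists B, bounded_op B /\
  forall u, in_l2 u -> B (u - S u) = u /\ B u - S (B u) = u.
Proof.
have /andP[k0 k1] := k01.
(* This t keeps (1 + t) kappa below 1. The D that follows solves D = (1 + t^-1) + (1 + t) kappa D,
   so the bound D * C reproduces itself under v_(K+1) u = u + S (v_K u). *)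
pose t : R := (1 - kappa) / 2; have t0 : 0 < t by rewrite divr_gt0// subr_gt0.
pose D := (1 + t^-1) / (1 - (1 + t) * kappa).
have tk : 0 < 1 - (1 + t) * kappa by rewrite /t; nra.
have D0 : 0 <= D by rewrite divr_ge0 ?(ltW tk)// addr_ge0// invr_ge0 ltW.
have vD K u C : l2b u C -> l2b (v K u) (D * C).
  move=> uC; have C0 := l2b_ge0 uC; elim: K => [|K ih].
    rewrite /v big_ord0; apply: le_l2b l2b0; exact: mulr_ge0.
  rewrite vS; apply: le_l2b (l2bD_weight t0 uC (Sk ih)).
  rewrite le_eqVlt; apply/orP; left; apply/eqP; rewrite /D.
  by field; rewrite (gt_eqF tk) (gt_eqF t0).
have Beq u C : l2b u C -> B u = u + S (B u).
  move=> uC; apply/funext => n.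
  apply: (ccvg_unique (ccvgS (B_ccvg n uC))).
  rewrite (_ : (fun k => _) = (fun k => u n + S (v k u) n)); last first.
    by apply/funext => k; rewrite vS.
  apply: ccvgD; first exact: ccvg_cst.
  by apply: ccvg_jpoly => m; exact: B_ccvg uC.
exists B; split.
  apply: (@l2b_bounded_op _ _ D) => [c u w|u C uC]; last first.
    by apply: (l2b_ccvg (v := fun K => v K u)) => [n|k]; [exact: B_ccvg uC|exact: vD].
  move=> /in_l2P[C uC] /in_l2P[C' wC']; apply/funext => n.
  have h := l2bD (l2bZ c uC) wC'.
  apply: (ccvg_unique (B_ccvg n h)).
  rewrite (_ : (fun k => _) = (fun k => c * v k u n + v k w n)); last first.
    by apply/funext => k; rewrite v_linear.
  apply: ccvgD; last exact: B_ccvg wC'.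
  by apply: ccvgM; [exact: ccvg_cst|exact: B_ccvg uC].
move=> u /in_l2P[C uC]; split; last by rewrite {1}(Beq _ _ uC) addrK.
rewrite -[RHS](addrK (S (B u))) -(Beq _ _ uC); apply/funext => n.
have SuC := l2bZ (-1) (Sk uC).
have h := l2bD uC SuC; rewrite scaleN1r in h.
apply: (ccvg_unique (B_ccvg n h)).
rewrite (_ : (fun k => _) = (fun k => v k u n + (- 1) * S (v k u) n)); last first.
  apply/funext => k; rewrite addrC -[- S u]scaleN1r v_linear vSr addrC.
  by [].
rewrite (_ : (B u - S (B u)) n = B u n + (- 1) * S (B u) n); last first.
  by rewrite mulN1r.
apply: ccvgD; first exact: B_ccvg uC.
apply: ccvgM; first exact: ccvg_cst.
by apply: ccvg_jpoly => m; exact: B_ccvg uC.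
Qed.

End neumann.

(** * Transfer of norm bounds between isospectral matrices *)

Section spectrum_transfer.
Context {R : realType} (J J' : jacobi2 R).
Hypothesis spJ : spectrum (jop J) = spectrum (jop J').
Local Notation Q := (jpoly (ja J) (jb J)).
Local Notation Q' := (jpoly (ja J') (jb J')).

(** If (X - z) g is invertible at J' with inverse B, then B g(J') inverts J' - z, because B commutes
    with polynomials of J'. So z lies outside the common spectrum, and J - z is bounded below. *)
Lemma bounded_below_root (B : (int -> R[i]) -> int -> R[i]) z g :
  bounded_op B ->
  (forall u, in_l2 u -> B (Q' (('X - z%:P) * g) u) = u /\
                        Q' (('X - z%:P) * g) (B u) = u) ->
  exists2 K : R, 0 <= K & forall u C, in_l2 u ->
    l2b (Q ('X - z%:P) u) C -> l2b u (K * C).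
Proof.
move=> bB BQ; have [lB Bl _] := bB.
have Q'l h u : in_l2 u -> in_l2 (Q' h u) by exact: in_l2_jpoly.
have Ql h u : in_l2 u -> in_l2 (Q h u) by exact: in_l2_jpoly.
have Bcomm h u : in_l2 u -> B (Q' h u) = Q' h (B u).
  move=> ul; have [_ {1}<-] := BQ _ ul.
  by rewrite -jpolyM mulrC jpolyM; have [-> _] := BQ _ (Q'l h _ (Bl _ ul)).
have zJ' : ~ spectrum (jop J') z.
  apply; exists (fun u => B (Q' g u)); split.
    have [K K0 BK] := bounded_op_l2b bB; have [L L0 gL] := jpoly_l2b J' g.
    apply: (@l2b_bounded_op _ _ (K * L)) => [c u w ul wl|u C uC].
      by rewrite linearP lB//; exact: Q'l.
    by rewrite -mulrA; apply: BK; exact: gL.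
  move=> u ul.
  have e w : jop J' w - z *: w = Q' ('X - z%:P) w by rewrite jpolyB jpolyX jpolyC.
  rewrite !e -jpolyM mulrC; have [-> _] := BQ _ ul; split => //.
  rewrite -Bcomm; last exact: Q'l.
  by rewrite -jpolyM; have [-> _] := BQ _ ul.
have : ~ spectrum (jop J) z by rewrite spJ.
move=> /contrapT[A [bA AJ]].
have [K K0 AK] := bounded_op_l2b bA; exists K => // u C ul.
have e w : jop J w - z *: w = Q ('X - z%:P) w by rewrite jpolyB jpolyX jpolyC.
by move=> h; have [eu _] := AJ _ ul; rewrite -eu e; exact: AK.
Qed.

Lemma bounded_below_poly (B : (int -> R[i]) -> int -> R[i]) f : f != 0 ->
  bounded_op B ->
  (forall u, in_l2 u -> B (Q' f u) = u /\ Q' f (B u) = u) ->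
  exists2 K : R, 0 <= K & forall u C, in_l2 u -> l2b (Q f u) C -> l2b u (K * C).
Proof.
move=> f0 bB BQ; have [rs ers] := closed_field_poly_normal f.
have lf0 : lead_coef f != 0 by rewrite lead_coef_eq0.
have : exists2 K : R, 0 <= K & forall u C, in_l2 u ->
    l2b (Q (\prod_(z <- rs) ('X - z%:P)) u) C -> l2b u (K * C).
  (* The induction runs over sublists of roots while f itself stays fixed: each root is excluded
     from the spectrum by the invertibility of the whole of f(J'). *)
  have : {subset rs <= rs} by [].
  elim: {1 3}rs => [|z s ih] srs.
    by exists 1 => // u C ul; rewrite big_nil -polyC1 jpolyC scale1r mul1r.
  have [K K0 sK] := ih (fun x xs => srs x (mem_behead (s := z :: s) xs)).
  have zrs : z \in rs by apply: srs; rewrite mem_head.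
  have [g fg] : exists g, f = ('X - z%:P) * g.
    exists (lead_coef f *: \prod_(x <- rem z rs) ('X - x%:P)).
    by rewrite -scalerAr [LHS]ers (big_rem z zrs).
  have BQz u : in_l2 u -> B (Q' (('X - z%:P) * g) u) = u /\
                        Q' (('X - z%:P) * g) (B u) = u.
    by rewrite -fg; exact: BQ.
  have [L L0 zL] := bounded_below_root bB BQz.
  exists (L * K) => [|u C ul]; first exact: mulr_ge0.
  rewrite big_cons mulrC jpolyM mulrAC -mulrA => h.
  rewrite mulrA mulrAC -mulrA; apply: (zL _ _ ul).
  by apply: (sK _ _ _ h); exact: in_l2_jpoly.
move=> [K K0 hK]; exists (K * nsq (lead_coef f)^-1) => [|u C ul].
  by rewrite mulr_ge0// nsq_ge0.
rewrite {1}ers jpolyZ => h; rewrite -mulrA; apply: (hK _ _ ul).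
by have := l2bZ (lead_coef f)^-1 h; rewrite scalerA mulVf// scale1r.
Qed.

(* The norm of the self-adjoint operator q(J) is its spectral radius: were it
   larger than c, then m := |q(J)|^2 would make q^2 - m invertible at J' (Neumann
   series) hence at J (its roots avoid the common spectrum), whereas vectors
   almost attaining the norm are approximate kernel vectors of q(J)^2 - m. *)
Lemma spectrum_norm_transfer (q : {poly R[i]}) (c : R) : (1 < size q)%N ->
  (forall i, complex.Im q`_i = 0) -> 0 <= c ->
  (forall u C, l2b u C -> l2b (Q' q u) (c * C)) ->
  forall u C, l2b u C -> l2b (Q q u) (c * C).
Proof.
move=> sq qr c0 Q'c u0 C0 u0C0; apply: contrapT => nb.
have u0l : in_l2 u0 := l2b_in_l2 u0C0.
have Ql u : in_l2 u -> in_l2 (Q q u) by exact: in_l2_jpoly.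
pose E := [set r | exists u, [/\ in_l2 u, ri u u <= 1 & r = ri (Q q u) (Q q u)]].
have [L L0 qL] := jpoly_l2b J q.
have E0 : E (ri (Q q 0) (Q q 0)).
  by exists 0; split => //; [exact: in_l20|rewrite (ri0r in_l20)].
have supE : has_sup E.
  split; first by eexists; exact: E0.
  exists L => _ [u [ul u1 ->]]; apply/ri_le; first exact: Ql.
  by rewrite -(mulr1 L); apply: qL; apply/ri_le.
set m := sup E.
have riZZ (r : R) u : in_l2 u -> ri (r%:C *: u) (r%:C *: u) = r ^+ 2 * ri u u.
  by move=> ul; rewrite riZr ?(riC _ u) ?riZr ?mulrA//; exact: in_l2Z.
have mle u : in_l2 u -> ri (Q q u) (Q q u) <= m * ri u u.
  move=> ul; have := ri_ge0 ul; rewrite le_eqVlt => /predU1P[u00|u0'].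
    rewrite -u00 mulr0; have := l2b_ri ul; rewrite -u00 => /l2b_eq0 ->.
    by rewrite linear0 ri0r//; exact: in_l20.
  pose r := (Num.sqrt (ri u u))^-1.
  have r2 : r ^+ 2 = (ri u u)^-1 by rewrite exprVn sqr_sqrtr// ltW.
  have : E (ri (Q q (r%:C *: u)) (Q q (r%:C *: u))).
    exists (r%:C *: u); split => //; first exact: in_l2Z.
    by rewrite riZZ// r2 mulVf// gt_eqF.
  move=> /(sup_upper_bound supE); rewrite linearZ riZZ; last exact: Ql.
  by rewrite r2 mulrC ler_pdivrMr.
have mc : c < m.
  rewrite ltNge; apply/negP => mc; apply: nb.
  apply/ri_le; first exact: Ql.
  apply: (le_trans (mle _ u0l)); apply: ler_pM => //; last exact/ri_le.
    exact: le_trans (ri_ge0 (Ql _ in_l20)) (sup_upper_bound supE E0).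
  exact: ri_ge0.
have m0 : 0 < m by exact: le_lt_trans mc.
pose f := q * q - m%:C%:P.
have mC0 : m%:C != 0 :> R[i] by rewrite (inj_eq (@complexI R)) gt_eqF.
have f0 : f != 0.
  apply/eqP => /(congr1 (fun p : {poly R[i]} => size (p + m%:C%:P))).
  rewrite subrK add0r size_polyC mC0/= size_mul; last 2 first.
  - by rewrite -size_poly_gt0 ltnW.
  - by rewrite -size_poly_gt0 ltnW.
  by case: (size q) sq => [|[|s]]//= _; rewrite !addnS.
(* At J' the operator q^2 / m has squared norm at most c^2 / m^2, which is below 1 since c < m. *)
pose kappa := (c / m) ^+ 2.
have k01 : 0 <= kappa < 1.
  rewrite sqr_ge0 expr_lt1// ?divr_ge0 ?(ltW m0)// ltr_pdivrMr// mul1r//.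
have Sk u C : l2b u C -> l2b (Q' (m^-1%:C *: (q * q)) u) (kappa * C).
  move=> uC; rewrite jpolyZ jpolyM.
  have := l2bZ m^-1%:C (Q'c _ _ (Q'c _ _ uC)).
  rewrite nsq_real; apply: le_l2b; rewrite /kappa exprMn exprVn.
  by rewrite le_eqVlt; apply/orP; left; apply/eqP; ring.
have [B [bB BS]] := neumann_inverse k01 Sk.
have [lB Bl _] := bB.
have fS u : Q' f u = - m%:C *: (u - Q' (m^-1%:C *: (q * q)) u).
  rewrite jpolyB jpolyC jpolyZ scalerBr !scaleNr opprK scalerA.
  by rewrite -rmorphM/= mulfV ?gt_eqF// scale1r addrC.
have eS w : Q' f ((- m%:C)^-1 *: w) = w - Q' (m^-1%:C *: (q * q)) w.
  by rewrite linearZ /= fS scalerA mulVf ?oppr_eq0// scale1r.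
have Bf : forall u, in_l2 u -> B (Q' f ((- m%:C)^-1 *: u)) = u /\
                              Q' f ((- m%:C)^-1 *: B u) = u.
  by move=> u ul; rewrite !eS; exact: BS.
have : exists2 K : R, 0 <= K & forall u C, in_l2 u -> l2b (Q f u) C -> l2b u (K * C).
  apply: (@bounded_below_poly (fun u => (- m%:C)^-1 *: B u) f f0).
    have [K K0 BK] := bounded_op_l2b bB.
    apply: (@l2b_bounded_op _ _ (nsq (- m%:C)^-1 * K)) => [a u w ul wl|u C uC].
      by rewrite lB// scalerDr !scalerA mulrC.
    by rewrite -mulrA; apply: l2bZ; exact: BK.
  move=> u ul; have [_ ->] := Bf u ul; split => //.
  have wl : in_l2 (u - Q' (m^-1%:C *: (q * q)) u).
    by apply: in_l2B => //; exact: in_l2_jpoly.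
  have [e _] := BS _ ul.
  by rewrite fS (linear_l2Z _ lB wl) scalerA mulVf ?oppr_eq0// scale1r.
move=> [K K0 fK].
(* A u with |q(J) u|^2 > m - eta has |f(J) u|^2 <= m eta, hence |u|^2 <= K m eta and m - eta < m^2 K
   eta. The choice of eta turns this into m < m / 2. *)
pose eta := m / (2 * (1 + m ^+ 2 * K)).
have d0 : 0 < 1 + m ^+ 2 * K by rewrite ltr_pwDl// mulr_ge0// sqr_ge0.
have eta0 : 0 < eta by rewrite divr_gt0// mulr_gt0.
have [_ [u [ul u1 ->]] um] := sup_adherent eta0 supE.
have Qul := Ql _ ul; have QQul := Ql _ Qul.
have e1 : Q f u = Q q (Q q u) - m%:C *: u by rewrite jpolyB jpolyC jpolyM.
have mul_ : in_l2 (m%:C *: u) by exact: in_l2Z.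
have n1 : ri (Q f u) (Q f u) <= m * eta.
  have num x y w : y <= m * x -> 0 <= w -> w <= 1 -> m - eta < x ->
      y - 2 * m * x + m ^+ 2 * w <= m * eta.
    move=> h1 w0 w1 h2; have : m ^+ 2 * w <= m ^+ 2 by rewrite ler_piMr// sqr_ge0.
    by nra.
  have h := ri_sub_scale m ul Qul QQul (ri_jpoly J qr Qul ul).
  rewrite e1 h; exact: num (mle _ Qul) (ri_ge0 ul) u1 um.
have n2 : ri u u <= K * (m * eta).
  apply/ri_le => //; apply: (fK _ _ ul); apply/ri_le => //.
  by rewrite e1; exact: in_l2B.
have := mle _ ul => n3.
have n4 : m - eta < m * (K * (m * eta)).
  by apply: (lt_le_trans um); apply: (le_trans n3); rewrite ler_pM2l.
have : eta * (1 + m ^+ 2 * K) = m / 2 by rewrite /eta; field; rewrite gt_eqF.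
by nra.
Qed.

End spectrum_transfer.

(** * Isospectral periodic matrices *)

Lemma isum_periodic (R : realType) (f : int -> R) (N K : nat) m :
  (forall n, f (n + N%:Z) = f n) -> isum m (K * N) f = K%:R * isum m N f.
Proof.
move=> fN; have e k : isum (m + (k * N)%N%:Z) N f = isum m N f.
  elim: k => [|k ih]; first by rewrite mul0n addr0.
  rewrite -ih (_ : m + (k.+1 * N)%N%:Z = m + (k * N)%N%:Z + N%:Z); last by lia.
  by rewrite -isum_shift; apply: eq_isum => n _; rewrite fN.
elim: K => [|K ih]; first by rewrite mul0n mul0r /isum big_ord0.
by rewrite mulSn addnC isum_cat ih e -natr1 mulrDl mul1r.
Qed.

Lemma ler_isum_pair (R : realType) (f : int -> R) (m : int) (n : nat) (k : int) :
  (forall k, 0 <= f k) -> m < k < m + n%:Z -> f m + f k <= isum m n f.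
Proof.
move=> f0 mk.
have -> : n = (absz (k - m)%R + (1 + absz (m + n%:Z - k - 1)%R))%N by lia.
rewrite !isum_cat isum1 (_ : m + (absz (k - m)%R)%:Z = k); last by lia.
rewrite lerD//; last by rewrite lerDl isum_ge0.
by apply: ler_isum_term => //; lia.
Qed.

Lemma archi_le (R : realType) (x y d : R) :
  (forall K : nat, K%:R * x <= K%:R * y + d) -> x <= y.
Proof.
move=> h; rewrite leNgt; apply/negP => yx.
have xy : 0 < x - y by rewrite subr_gt0.
have := h (Num.truncn (d / (x - y))).+1; set K := _.+1 => hK.
have : d / (x - y) < K%:R by exact: truncnS_gt.
by rewrite ltr_pdivrMr//; nra.
Qed.

Lemma size_monic_sub (R : nzRingType) (p q : {poly R}) (n : nat) :
  p \is monic -> q \is monic -> size p = n.+1 -> size q = n.+1 ->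
  (size (p - q)%R <= n)%N.
Proof.
move=> /monicP mp /monicP mq sp sq; apply/leq_sizeP => i ni; rewrite coefB.
move: ni; rewrite leq_eqVlt => /predU1P[<-|ni].
  by move: mp mq; rewrite !lead_coefE sp sq => -> ->; rewrite subrr.
by rewrite !nth_default ?subrr// ?sp ?sq.
Qed.

Lemma coef_sub_real (R : realType) (p q : {poly R[i]}) :
  (forall i, complex.Im p`_i = 0) -> (forall i, complex.Im q`_i = 0) ->
  forall i, complex.Im (p - q)`_i = 0.
Proof.
move=> pr qr i; rewrite coefB; move: (pr i) (qr i).
by case: (p`_i) => x y; case: (q`_i) => x' y' /= -> ->; rewrite subrr.
Qed.

Section periodic.
Context {R : realType} (a b : int -> R) (p : nat).
Local Notation N := p.+1.
Hypothesis aN : forall n, a (n + N%:Z) = a n.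
Hypothesis bN : forall n, b (n + N%:Z) = b n.
Local Notation T := (jacobi_op a b).
Local Notation Q := (jpoly a b).

Definition quasiperiodic (s : R[i]) (u : int -> R[i]) :=
  forall n, u (n + N%:Z) = s * u n.

Lemma jacobi_quasiperiodic s u : quasiperiodic s u -> quasiperiodic s (T u).
Proof.
move=> tu n; rewrite /jacobi_op aN bN.
rewrite (_ : a (n + N%:Z - 1) = a (n - 1)); last by rewrite -[RHS]aN; congr a; lia.
rewrite (_ : n + N%:Z + 1 = n + 1 + N%:Z); last by lia.
rewrite (_ : n + N%:Z - 1 = n - 1 + N%:Z); last by lia.
by rewrite !tu; ring.
Qed.

Lemma jpoly_quasiperiodic s q u : quasiperiodic s u -> quasiperiodic s (Q q u).
Proof.
move=> tu n; rewrite !(jpoly_coef _ _ _ _ (leqnn _)) mulr_sumr.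
apply: eq_bigr => i _; rewrite mulrCA; congr (_ * _).
elim: (i : nat) n => [|k ih] n; first exact: tu.
exact: (jacobi_quasiperiodic ih).
Qed.

(* Truncating a quasiperiodic sequence to many periods costs only boundary terms. *)
Lemma quasiperiodic_norm (s : R[i]) (q : {poly R[i]}) (u : int -> R[i]) c m : nsq s = 1 ->
  (size q <= N.+1)%N -> quasiperiodic s u ->
  (forall u C, l2b u C -> l2b (Q q u) (c * C)) ->
  isum m N (nsq \o Q q u) <= c * isum m N (nsq \o u).
Proof.
move=> s1 qN tu Qc.
have per v : quasiperiodic s v -> forall n, (nsq \o v) (n + N%:Z) = (nsq \o v) n.
  by move=> tv n; rewrite /= tv nsqM s1 mul1r.
have tQu : quasiperiodic s (Q q u) by exact: jpoly_quasiperiodic.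
(* Cutting u off to K + 2 periods leaves q(T) u unchanged on the K inner ones; the two outer periods
   give the error term, constant in K. *)
apply: (@archi_le _ _ _ (2 * (c * isum m N (nsq \o u)))) => K.
have e1 : isum (m + N%:Z) (K * N) (nsq \o Q q (cutoff m ((K + 2) * N) u)) =
    isum (m + N%:Z) (K * N) (nsq \o Q q u).
  apply: eq_isum => k mk; rewrite /comp.
  suff -> : Q q (cutoff m ((K + 2) * N) u) k = Q q u k by [].
  by apply: (jpoly_band a b qN) => j jk; rewrite /cutoff ifT//; lia.
have e2 : isum (m + N%:Z) (K * N) (nsq \o Q q u) = K%:R * isum m N (nsq \o Q q u).
  rewrite -(isum_periodic K m (per _ tQu)) -isum_shift.
  by apply: eq_isum => k _; exact: (per _ tQu).
rewrite -e2 -e1.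
apply: (le_trans (Qc _ _ (l2b_cutoff m ((K + 2) * N) u) _ _)).
rewrite (isum_periodic _ _ (per _ tu)) natrD.
by rewrite le_eqVlt; apply/orP; left; apply/eqP; ring.
Qed.

Definition comb (s : R[i]) (j n : int) : R[i] :=
  if ((n - j) %% N%:Z == 0)%Z then s ^ ((n - j) %/ N%:Z)%Z else 0.

Lemma comb_quasiperiodic s j : s != 0 -> quasiperiodic s (comb s j).
Proof.
move=> s0 n; rewrite /comb (_ : n + N%:Z - j = n - j + N%:Z); last by lia.
rewrite modzDr divzDr ?dvdzz// divzz/= expfzDr// expr1z.
by case: ifP => _; rewrite ?mulr0// mulrC.
Qed.

Lemma comb_near s j n : (`|n - j| < N%:Z)%R -> comb s j n = dlt j n.
Proof.
move=> nj; rewrite /comb /dlt; have [->|nj'] := eqVneq n j.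
  by rewrite subrr mod0z div0z eqxx expr0z.
case: ifP => // /eqP h; have := divz_eq (n - j) N%:Z; rewrite h addr0.
set d := (_ %/ _)%Z => e; exfalso.
have : d = 0 by nia.
by move/eqP: nj'; lia.
Qed.

Lemma isum_comb s j : isum j N (nsq \o comb s j) = 1.
Proof.
rewrite /isum big_ord_recl big1 => [|i _]; rewrite /= comb_near /dlt.
- by rewrite !addr0 eqxx nsq1.
- by lia.
- by rewrite (_ : (_ == j) = false) ?nsq0// /bump/=; lia.
- by have := ltn_ord i; rewrite /bump/=; lia.
Qed.

End periodic.

(** * Comparison of two isospectral periodic matrices *)

Section same_spectrum.
Context {R : realType} (p : nat).
Local Notation N := p.+1.
Implicit Types J : jacobi2 R.

Definition jperiodic J := (forall n, ja J (n + N%:Z) = ja J n) /\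
                          (forall n, jb J (n + N%:Z) = jb J n).

Local Notation M J := (floquet_mx (ja J) (jb J) p).
Local Notation P J := (char_poly (M J)).
Local Notation A J := (period_prod (ja J) p).

Lemma size_floquet J : size (P J) = N.+1.
Proof. by rewrite size_char_poly. Qed.

(** By the magic formula P(J) = A (S + S^-1) has norm at most 2 A, with square 4 A^2. *)
Lemma magic_l2b J : jperiodic J -> forall u C,
  l2b u C -> l2b (jpoly (ja J) (jb J) (P J) u) (4 * A J ^+ 2 * C).
Proof.
move=> [aN bN] u C uC.
have -> : jpoly (ja J) (jb J) (P J) u =
   (A J)%:C *: ((fun n => u (n - N%:Z)) + (fun n => u (n + N%:Z))).
  by apply/funext => n; rewrite (floquet_magic aN bN).
apply: le_l2b (l2bZ _ (l2bD (l2b_shift (- N%:Z) uC) (l2b_shift N%:Z uC))).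
by rewrite nsq_real le_eqVlt; apply/orP; left; apply/eqP; ring.
Qed.

Section pair.
Variables J J' : jacobi2 R.
Hypothesis spJ : spectrum (jop J) = spectrum (jop J').
Hypothesis pJ : jperiodic J.
Hypothesis pJ' : jperiodic J'.
Local Notation Q := (jpoly (ja J) (jb J)).
Local Notation D := (P J' - P J).

Lemma size_magic_sub : (size D <= N)%N.
Proof. by apply: size_monic_sub; rewrite ?char_poly_monic ?size_char_poly. Qed.

Lemma magic_sub_real i : complex.Im D`_i = 0.
Proof.
have [aN _] := pJ; have [aN' _] := pJ'; apply: coef_sub_real.
  exact: (floquet_char_poly_real (jb J') aN').
exact: (floquet_char_poly_real (jb J) aN).
Qed.

Let magicE u n : Q (P J') u n =
  (A J)%:C * (u (n - N%:Z) + u (n + N%:Z)) + Q D u n.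
Proof.
have [aN bN] := pJ; rewrite -(floquet_magic aN bN).
change (Q (P J') u n = (Q (P J) u + Q D u) n).
by rewrite -jpolyD addrC subrK.
Qed.

(** The polynomial of J' is evaluated at J: its norm 2 A(J') is the same there, and the comb has
    norm 1 per period. *)
Lemma comb_bound (s : R) j : s ^+ 2 = 1 ->
  isum j N (nsq \o Q (P J') (comb p s%:C j)) <= 4 * A J' ^+ 2.
Proof.
have [aN bN] := pJ; have [aN' bN'] := pJ' => s1.
have s0 : s%:C != 0 :> R[i].
  rewrite (inj_eq (@complexI R)); apply/eqP => s0.
  by move: s1; rewrite s0 expr0n => /eqP; rewrite eq_sym oner_eq0.
rewrite [leRHS](_ : _ = 4 * A J' ^+ 2 * isum j N (nsq \o comb p s%:C j)); last first.
  by rewrite isum_comb mulr1.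
apply: (quasiperiodic_norm aN bN (s := s%:C)).
- by rewrite nsq_real.
- by rewrite size_floquet.
- exact: comb_quasiperiodic.
apply: (spectrum_norm_transfer spJ).
- by rewrite size_floquet.
- exact: (floquet_char_poly_real (jb J') aN').
- by apply: mulr_ge0 => //; exact: sqr_ge0.
- exact: (magic_l2b pJ').
Qed.

(** Both neighbouring teeth have value s, as s^-1 = s, so the magic part gives 2 s A; D has degree
    less than N and sees only the tooth at j. *)
Let comb_at (s : R) j : s ^+ 2 = 1 -> Q (P J') (comb p s%:C j) j =
  (2 * s * A J + complex.Re (Q D (dlt j) j))%:C.
Proof.
move=> s1.
have s0 : s%:C != 0 :> R[i].
  rewrite (inj_eq (@complexI R)); apply/eqP => s0.
  by move: s1; rewrite s0 expr0n => /eqP; rewrite eq_sym oner_eq0.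
rewrite magicE.
have sj := comb_quasiperiodic p j s0.
have cj : comb p s%:C j j = 1 by rewrite comb_near ?subrr// /dlt eqxx.
have c1 : comb p s%:C j (j + N%:Z) = s%:C by rewrite sj cj mulr1.
have c2 : comb p s%:C j (j - N%:Z) = s%:C.
  have := sj (j - N%:Z); rewrite subrK cj => /(congr1 (fun x => s%:C * x)).
  by rewrite mulr1 mulrA -rmorphM/= -expr2 s1 mul1r.
have -> : Q D (comb p s%:C j) j = Q D (dlt j) j.
  by apply: (jpoly_band _ _ size_magic_sub) => k kj; rewrite comb_near//; lia.
rewrite c1 c2; have := jpoly_dlt_real (ja J) (jb J) j j magic_sub_real.
case: (Q D (dlt j) j) => x y /= ->.
by apply: complexP => /=; ring.
Qed.

(** The two signs of s give |2A + r| and |-2A + r|, the larger of which is 2A + |r|. *)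
Lemma magic_diag_bound j : 0 <= A J -> 0 <= A J' ->
  2 * A J + `|complex.Re (Q D (dlt j) j)| <= 2 * A J'.
Proof.
move=> A0 A0'; set r := complex.Re _.
have h (s : R) : s ^+ 2 = 1 -> (2 * s * A J + r) ^+ 2 <= 4 * A J' ^+ 2.
  move=> s1; apply: le_trans (comb_bound j s1).
  rewrite -nsq_real -comb_at//.
  by apply: (ler_isum_term (f := nsq \o Q (P J') (comb p s%:C j))) => [k|];
    [exact: nsq_ge0|lia].
have := h 1; have := h (-1); rewrite sqrrN expr1n => /(_ erefl) h1 /(_ erefl) h2.
have l (x : R) : x ^+ 2 <= 4 * A J' ^+ 2 -> `|x| <= 2 * A J'.
  rewrite -[`|x| <= _]ler_sqr ?nnegrE ?mulr_ge0// real_normK ?num_real//.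
  by move=> hx; apply: (le_trans hx); rewrite le_eqVlt; apply/orP; left; apply/eqP; ring.
have := l _ h1; have := l _ h2; rewrite !ler_norml => /andP[_ g1] /andP[g2 _].
by rewrite -lerBrDl ler_norml; apply/andP; split; lra.
Qed.

Lemma period_prod_le : 0 <= A J -> 0 <= A J' -> A J <= A J'.
Proof.
move=> A0 A0'; rewrite -(@ler_pM2l _ 2)//.
by apply: le_trans (magic_diag_bound 0 A0 A0'); rewrite lerDl.
Qed.

(** When the products agree, the value at j alone exhausts [comb_bound], so the image of the comb
    vanishes at the other sites of the period. Such a site m is reached from the two teeth j and j +
    N, and s = 1 together with s = -1 separates their contributions. *)
Lemma magic_offdiag (j m : int) : A J = A J' -> 0 <= A J -> j <= m < j + N%:Z ->
  Q D (dlt j) m = 0.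
Proof.
move=> AA A0 mj; have A0' : 0 <= A J' by rewrite -AA.
have r0 : complex.Re (Q D (dlt j) j) = 0.
  have := magic_diag_bound j A0 A0'; rewrite AA => h.
  by apply/eqP; rewrite -normr_le0; lra.
have := jpoly_dlt_real (ja J) (jb J) j j magic_sub_real => i0.
have [->|mj'] := eqVneq m j; first exact: complexP.
have s0 (s : R) : s ^+ 2 = 1 -> Q D (dlt j) m + s%:C * Q D (dlt (j + N%:Z)) m = 0.
  move=> s1; have := comb_bound j s1.
  have sn0 : s%:C != 0 :> R[i].
    rewrite (inj_eq (@complexI R)); apply/eqP => sn0.
    by move: s1; rewrite sn0 expr0n => /eqP; rewrite eq_sym oner_eq0.
  have sj := comb_quasiperiodic p j sn0.
  have cm : comb p s%:C j m = 0.
    by rewrite comb_near /dlt ?(negbTE mj')//; lia.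
  have cm1 : comb p s%:C j (m + N%:Z) = 0 by rewrite sj cm mulr0.
  have cm2 : comb p s%:C j (m - N%:Z) = 0.
    by rewrite comb_near /dlt; [rewrite (_ : (_ == j) = false)//; lia|lia].
  have Dm : Q D (comb p s%:C j) m = Q D (dlt j) m + s%:C * Q D (dlt (j + N%:Z)) m.
    rewrite -jpoly_scaleE -jpoly_addE; apply: (jpoly_band _ _ size_magic_sub) => k km.
    change (comb p s%:C j k = dlt j k + s%:C * dlt (j + N%:Z) k).
    have [h|h] := ltP `|k - j| N%:Z.
      by rewrite comb_near// /dlt (_ : (k == j + N%:Z) = false) ?mulr0 ?addr0//; lia.
    rewrite {1}/dlt (_ : (k == j) = false) ?add0r; last by lia.
    rewrite -{1}[k](subrK N%:Z) sj comb_near; last by lia.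
    by rewrite /dlt -(inj_eq (addIr N%:Z) (k - N%:Z)) subrK.
  rewrite -Dm => h; apply: nsq_eq0; apply/eqP; rewrite eq_le nsq_ge0 andbT.
  have : nsq (Q (P J') (comb p s%:C j) j) + nsq (Q (P J') (comb p s%:C j) m) <= 4 * A J' ^+ 2.
    apply: le_trans h.
    apply: (ler_isum_pair (f := nsq \o Q (P J') (comb p s%:C j))) => [k|].
      exact: nsq_ge0.
    by move/eqP: mj'; lia.
  rewrite comb_at// r0 addr0 nsq_real magicE cm1 cm2 addr0 mulr0 add0r.
  by rewrite AA !exprMn s1; lra.
have h1 := s0 1 (expr1n _ _); have h2 := s0 (-1) _.
move: (h2 (etrans (sqrrN _) (expr1n _ _))) h1.
rewrite rmorphN rmorph1 mulN1r mul1r.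
by case: (Q _ _ _) => x y; case: (Q _ _ _) => x' y' [? ?] [? ?]; apply: complexP => /=; lra.
Qed.

(** If D had degree d, its entry at distance d would be the leading coefficient times a product of
    positive a, yet [magic_offdiag] makes it zero. *)
Lemma magic_eq : A J = A J' -> (forall n, 0 < ja J n) -> P J = P J'.
Proof.
move=> AA a0.
have A0 : 0 <= A J by apply: prodr_ge0 => i _; exact: ltW.
apply/esym/eqP; rewrite -subr_eq0 -size_poly_eq0; apply/negPn/negP => sD.
pose d := (size D).-1.
have sDd : size D = d.+1 by rewrite prednK// lt0n.
have dN : (d < N)%N by rewrite -sDd size_magic_sub.
have := @magic_offdiag 0 (0 + d%:Z) AA A0.
have sD' : (size D <= d.+1)%N by rewrite sDd.
rewrite (jpoly_dlt_far _ _ sD'); last by lia.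
rewrite iter_dlt_right => h.
have : D`_d * (\prod_(j < d) ja J (0 + j%:Z))%:C = 0 by apply: h; lia.
move=> /eqP; rewrite mulf_eq0 => /orP[|].
  by rewrite -[D`_d]/(lead_coef D) lead_coef_eq0 -size_poly_eq0 (negbTE sD).
rewrite (inj_eq (@complexI R)) => /eqP h0.
by have := @prodr_gt0 R _ (index_enum 'I_d) xpredT (fun j => ja J (0 + j%:Z)) (fun j _ => a0 _);
  rewrite h0 ltxx.
Qed.

End pair.

Lemma period_prod_eq J J' : spectrum (jop J) = spectrum (jop J') ->
  jperiodic J -> jperiodic J' -> A J = A J'.
Proof.
move=> sp pJ pJ'.
have A0 J0 : 0 <= A J0 by apply: prodr_ge0 => i _; exact: ja_ge0.
apply/eqP; rewrite eq_le; apply/andP; split.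
  exact: period_prod_le sp pJ pJ' (A0 J) (A0 J').
exact: period_prod_le (esym sp) pJ' pJ (A0 J') (A0 J).
Qed.

Lemma period_trace_eq J J' (q : {poly R[i]}) : spectrum (jop J) = spectrum (jop J') ->
  jperiodic J -> jperiodic J' -> (forall n, 0 < ja J n) -> (size q <= N)%N ->
  \sum_(j < N) jpoly (ja J) (jb J) q (dlt j%:Z) j%:Z =
  \sum_(j < N) jpoly (ja J') (jb J') q (dlt j%:Z) j%:Z.
Proof.
move=> sp pJ pJ' a0 qN; have PP := magic_eq sp pJ pJ' (period_prod_eq sp pJ pJ') a0.
have [aN bN] := pJ; have [aN' bN'] := pJ'.
refine (etrans (esym (trace_floquet aN bN qN)) (etrans _ (trace_floquet aN' bN' qN))).
by apply: trace_char_poly PP; [exact: floquet_mx_normal aN|exact: floquet_mx_normal aN'].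
Qed.

End same_spectrum.

(** * Compactness *)

Lemma opnorm_le2 (R : realType) (T : (int -> R[i]) -> int -> R[i]) :
  (forall u C, l2b u C -> l2b (T u) (4 * C)) -> (opnorm T <= 2%:E)%E.
Proof.
move=> h; apply: ge_ereal_sup => _ [u /= /(l2normP u (@ler01 R)) u1 <-].
apply/l2normP => //; rewrite (_ : 2 ^+ 2 = 4 * 1 ^+ 2 :> R); last by ring.
by apply: h.
Qed.

Lemma ultra_cvg_bounded (R : realType) (T : Type) (F : set_system T) (f : T -> R)
    (c d : R) :
  UltraFilter F -> (forall x, c <= f x <= d) -> exists l : R, f @ F --> l.
Proof.
move=> UF fcd; have PF : ProperFilter (f @ F) by exact: fmap_proper_filter.
have [|l [_ lcl]] := @segment_compact R c d _ PF.
  by apply: (@filterE _ F) => x; rewrite /= in_itv/=.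
exists l => U Ul; have [//|FU] := in_ultra_setVsetC (f @^-1` U) UF.
by have [y [nUy Uy]] := lcl (~` U) U FU Ul.
Qed.

Section coordinates.
Context {R : realType}.
Implicit Types J : jacobi2 R.

Lemma l2b_dlt (k : int) : l2b (dlt k : int -> R[i]) 1.
Proof.
move=> m n; apply: (@le_trans _ _ (isum k 1 (nsq \o dlt k))); last first.
  by rewrite isum1 /= /dlt eqxx nsq1.
apply: le_trans (l2b_cutoff k 1 (dlt k) m n).
apply: le_isum => j _; rewrite /= /cutoff /dlt; case: eqVneq => [->|jk].
  by rewrite ifT// lexx/= ltrDl.
by rewrite nsq0; exact: nsq_ge0.
Qed.

Lemma ja_le2 J n : ja J n <= 2.
Proof.
have := l2b_term n (jop_l2b J (l2b_dlt (n + 1))).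
rewrite /jacobi_op /dlt eqxx (_ : (n - 1 == n + 1) = false); last by lia.
rewrite (_ : (n == n + 1) = false); last by lia.
rewrite /= ?mulr0n ?mulr1n !mulr0 !addr0 mulr1 nsq_real (_ : 4 * 1 = 2 ^+ 2); last by ring.
by rewrite ler_sqr ?nnegrE// ja_ge0.
Qed.

Lemma jb_le2 J n : `|jb J n| <= 2.
Proof.
have := l2b_term n (jop_l2b J (l2b_dlt n)).
rewrite /jacobi_op /dlt eqxx (_ : (n - 1 == n) = false); last by lia.
rewrite (_ : (n + 1 == n) = false); last by lia.
rewrite /= ?mulr0n ?mulr1n !mulr0 !add0r mulr1 nsq_real (_ : 4 * 1 = 2 ^+ 2); last by ring.
by rewrite -[jb J n ^+ 2]real_normK ?num_real// ler_sqr ?nnegrE.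
Qed.

Definition jclose (K : nat) (d : R) J J' := forall n : int, (`|n| <= K%:Z)%R ->
  `|ja J n - ja J' n| <= d /\ `|jb J n - jb J' n| <= d.

Lemma jdist_coord J J' n :
  `|ja J n - ja J' n| <= 2 ^+ `|n|%N * jdist J J' /\
  `|jb J n - jb J' n| <= 2 ^+ `|n|%N * jdist J J'.
Proof.
have t : jdist_term J J' n <= jdist J J'.
  rewrite -lee_fin /jdist fineK ?jdist_fin//.
  apply: esum_ge; exists [set n]; first by split => //; exact: finite_set1.
  by rewrite fsbig_set1.
have : `|ja J n - ja J' n| + `|jb J n - jb J' n| <= 2 ^+ `|n|%N * jdist J J'.
  by move: t; rewrite /jdist_term ler_pdivrMl// exprn_gt0.
by move=> h; split; apply: le_trans h; rewrite ?lerDl ?lerDr.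
Qed.

(** The weights 2^-|n| sum to 3 in all and to 2 / 2^K beyond K; their factors are at most 2 d inside
    the window and 2 + 4 = 6 outside. *)
Lemma jdist_close K d J J' : 0 <= d -> jclose K d J J' ->
  jdist J J' <= 6 * d + 12 / 2 ^+ K.
Proof.
move=> d0 JJ; set f := jdist_term J J'.
have f0 n : 0 <= f n by exact: jdist_term_ge0.
have f1 n : (`|n| <= K)%N -> f n <= 2 ^- `|n|%N * (2 * d).
  move=> nK; rewrite /f /jdist_term ler_wpM2l ?invr_ge0 ?exprn_ge0//.
  by have [|h1 h2] := JJ n; [lia|lra].
have f2 n : f n <= 2 ^- `|n|%N * 6.
  rewrite /f /jdist_term ler_wpM2l ?invr_ge0 ?exprn_ge0//.
  have h1 : `|ja J n - ja J' n| <= 2.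
    have := ja_ge0 J n; have := ja_ge0 J' n; have := ja_le2 J n; have := ja_le2 J' n.
    by move=> *; rewrite ler_norml; apply/andP; split; lra.
  have h2 := ler_normB (jb J n) (jb J' n).
  have := jb_le2 J n; have := jb_le2 J' n; lra.
have w M : isum (- M%:Z) (M + M).+1 f <=
    2 * d * (3 - 2 / 2 ^+ M) + 6 * (2 / 2 ^+ K - 2 / 2 ^+ maxn M K).
  elim: M => [|M ih].
    rewrite oppr0 isum1 max0n subrr mulr0 addr0 expr0 divr1.
    by have := f1 0 (leq0n _); rewrite expr0 invr1 mul1r; lra.
  rewrite (_ : (M.+1 + M.+1).+1 = (1 + ((M + M).+1 + 1))%N); last by lia.
  rewrite !isum_cat !isum1.
  rewrite (_ : - M.+1%:Z + 1 = - M%:Z); last by lia.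
  rewrite (_ : - M%:Z + (M + M).+1%:Z = M.+1%:Z); last by lia.
  have e1 : (2 / 2 ^+ M : R) = 4 / 2 ^+ M.+1.
    by rewrite exprS; field; rewrite expf_neq0.
  have p0 : 0 < (2 ^+ M.+1 : R)^-1 by rewrite invr_gt0 exprn_gt0.
  have [MK|MK] := leqP M.+1 K.
    rewrite (maxn_idPr (ltnW MK)) e1 in ih.
    have := f1 (- M.+1%:Z); have := f1 M.+1%:Z; rewrite abszN absz_nat => /(_ MK) g1 /(_ MK) g2.
    by nra.
  rewrite (maxn_idPl _) ?e1// in ih.
  have := f2 (- M.+1%:Z); have := f2 M.+1%:Z; rewrite abszN absz_nat => g1 g2.
  by nra.
rewrite -lee_fin /jdist fineK ?jdist_fin//.
apply/esum_isum => // m n.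
pose M := (`|m| + n)%N; apply: (@le_trans _ _ (isum (- M%:Z) (M + M).+1 f)).
  by apply: le_isum_sub => //; rewrite /M; lia.
apply: (le_trans (w M)).
have p0 k : 0 <= (2 ^+ k : R)^-1 by rewrite invr_ge0 exprn_ge0.
have := p0 M; have := p0 K; have := p0 (maxn M K).
by nra.
Qed.

Lemma jclose_near J K d : 0 < d -> \forall J' \near J, jclose K d J J'.
Proof.
move=> d0; have e0 : 0 < d / 2 ^+ K by rewrite divr_gt0// exprn_gt0.
apply: filterS (nbhsx_ballx J _ e0) => J'; rewrite ballEmdist /= => JJ n nK.
have h : 2 ^+ `|n|%N * jdist J J' <= d.
  apply: (@le_trans _ _ (2 ^+ K * (d / 2 ^+ K))).
    apply: ler_pM.
    - by rewrite exprn_ge0.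
    - by rewrite fine_ge0// esum_ge0// => k _; rewrite lee_fin jdist_term_ge0.
    - by rewrite ler_eXn2l// ?ltr1n//; lia.
    - exact: ltW.
  by rewrite mulrC divfK// expf_neq0.
by have [h1 h2] := jdist_coord J J' n; split; [exact: le_trans h1 h|exact: le_trans h2 h].
Qed.

Lemma continuous_ja n : continuous (fun J => ja J n).
Proof.
move=> J; apply: (iffRL (@cvgrPdist_le _ _ _ (nbhs J) _ _ _)) => e e0.
by apply: (@filterS _ (nbhs J) _ _ _ _ (jclose_near J `|n|%N e0)) => J' /(_ n) [].
Qed.

Lemma continuous_jb n : continuous (fun J => jb J n).
Proof.
move=> J; apply: (iffRL (@cvgrPdist_le _ _ _ (nbhs J) _ _ _)) => e e0.
by apply: (@filterS _ (nbhs J) _ _ _ _ (jclose_near J `|n|%N e0)) => J' /(_ n) [].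
Qed.

Lemma jclose_jdist (e : R) : 0 < e -> exists K d, 0 < d /\
  forall J J', jclose K d J J' -> jdist J J' < e.
Proof.
move=> e0; have [K Ke] : exists K : nat, 12 / 2 ^+ K < e / 2 :> R.
  have c : (fun K : nat => 12 / 2 ^+ K : R) @ \oo --> 0.
    rewrite (_ : (fun _ => _) = geometric 12 2^-1).
      by apply: cvg_geometric; rewrite ger0_norm ?invf_lt1 ?invr_ge0// ltr1n.
    by apply/funext => k; rewrite /geometric/= exprVn.
  have e2 : 0 < e / 2 by rewrite divr_gt0.
  have /cvgr_lt/(_ _ e2)[K _ KP] := c.
  by exists K; apply: KP => /=.
exists K, (e / 24); split => [|J J' JJ]; first by rewrite divr_gt0.
have d0 : 0 <= e / 24 by rewrite divr_ge0// ltW.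
by apply: (le_lt_trans (jdist_close d0 JJ)); lra.
Qed.

Lemma cvg_jacobi (F : set_system (jacobi2 R)) J : Filter F ->
  (forall n, ja x n @[x --> F] --> ja J n) -> (forall n, jb x n @[x --> F] --> jb J n) ->
  F --> J.
Proof.
move=> FF Fa Fb; apply/cvg_ballP => e e0.
have [K [d [d0 KdE]]] := jclose_jdist e0.
suff : \forall J' \near F, jclose K d J J'.
  by apply: filterS => J' /KdE; rewrite ballEmdist.
rewrite /jclose.
have ab n : \forall J' \near F, `|ja J n - ja J' n| <= d /\ `|jb J n - jb J' n| <= d.
  by apply: filterI; [exact: (iffLR (cvgrPdist_le _ _) (Fa n))|
                     exact: (iffLR (cvgrPdist_le _ _) (Fb n))].
elim: K {KdE} => [|K ih].
  by apply: filterS (ab 0) => J' h n n0; have -> : n = 0 by lia.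
apply: filterS3 ih (ab K.+1%:Z) (ab (- K.+1%:Z)) => J' h1 h2 h3 n nK.
have [h|[->|->]//] : (`|n| <= K%:Z)%R \/ n = K.+1%:Z \/ n = - K.+1%:Z by lia.
exact: h1.
Qed.

(** Along an ultrafilter every bounded coordinate converges. The norm bound passes to the limit
    because it constrains finite windows of T u, each depending on finitely many coordinates. *)
Lemma jacobi2_compact : compact [set: jacobi2 R].
Proof.
rewrite compact_ultra => F UF _.
have [a aP] : exists a : int -> R, forall n, ja x n @[x --> F] --> a n.
  have /choice[a aP] n : exists l : R, ja x n @[x --> F] --> l.
    by apply: (ultra_cvg_bounded (c := 0) (d := 2)) => x; rewrite ja_ge0 ja_le2.
  by exists a.
have [b bP] : exists b : int -> R, forall n, jb x n @[x --> F] --> b n.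
  have /choice[b bP] n : exists l : R, jb x n @[x --> F] --> l.
    apply: (ultra_cvg_bounded (c := -2) (d := 2)) => x.
    by rewrite -ler_norml jb_le2.
  by exists b.
have a0 n : 0 <= a n.
  by apply: (ler_cvg_to (cvg_cst 0) (aP n)); apply: filterE => x; exact: ja_ge0.
have a2 n : a n <= 2.
  by apply: (ler_cvg_to (aP n) (cvg_cst (2 : R))); apply: filterE => x; exact: ja_le2.
have b2 n : `|b n| <= 2.
  apply: (ler_cvg_to (cvg_norm (bP n)) (cvg_cst (2 : R))); apply: filterE => x.
  exact: jb_le2.
have ab : exists M, forall n, `|a n| <= M /\ `|b n| <= M.
  by exists 2 => n; rewrite ger0_norm.
have nab : (opnorm (jacobi_op a b) <= 2%:E)%E.
  apply: opnorm_le2 => u C uC m n.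
  have c : isum m n (nsq \o jacobi_op (ja x) (jb x) u) @[x --> F] -->
           isum m n (nsq \o jacobi_op a b u).
    apply: cvg_big => [|i _]; first exact: add_continuous.
    set k := m + _; rewrite /= /nsq /jacobi_op.
    have reE (x y z : R) (w1 w2 w3 : R[i]) :
      complex.Re (x%:C * w1 + y%:C * w2 + z%:C * w3) =
      x * complex.Re w1 + y * complex.Re w2 + z * complex.Re w3.
      by case: w1; case: w2; case: w3 => * /=; ring.
    have imE (x y z : R) (w1 w2 w3 : R[i]) :
      complex.Im (x%:C * w1 + y%:C * w2 + z%:C * w3) =
      x * complex.Im w1 + y * complex.Im w2 + z * complex.Im w3.
      by case: w1; case: w2; case: w3 => * /=; ring.
    rewrite reE imE.
    under eq_cvg do rewrite reE imE.
    by apply: cvgD; apply: cvgM; apply: cvgD; try apply: cvgD; apply: cvgMl => //; exact.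
  apply: (ler_cvg_to c (cvg_cst (4 * C))); apply: filterE => x.
  exact: (jop_l2b x uC).
exists (Jacobi2 a0 ab nab); split => //.
exact: cvg_jacobi.
Qed.

Lemma continuous_bounded (f : jacobi2 R -> R) : continuous f ->
  exists2 B, 0 <= B & forall J, `|f J| <= B.
Proof.
move=> cf; have : compact (f @` [set: jacobi2 R]).
  by apply: continuous_compact; [exact: continuous_subspaceT|exact: jacobi2_compact].
move=> /compact_bounded[M [_ hM]].
have fM J : `|f J| <= M + 1 by apply: (hM (M + 1)); [rewrite ltrDl|exists J].
by exists (M + 1) => //; exact: le_trans (normr_ge0 _) (fM point).
Qed.

Lemma continuous_uniform (f : jacobi2 R -> R) (e : R) : continuous f -> 0 < e ->
  exists K d, 0 < d /\ forall J J', jclose K d J J' -> `|f J - f J'| <= e.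
Proof.
move=> cf e0.
have e2 : 0 < e / 2 by rewrite divr_gt0.
have h : \forall d \near (0 : R)^'+, [set: jacobi2 R] `<=`
    (fun J => forall J', jdist J J' < d -> `|f J - f J'| <= e).
  have := iffLR (compact_near_coveringP _) jacobi2_compact.
  apply => J _.
  have /cvgrPdist_le/(_ _ e2) := cf J.
  move=> /nbhs_ballP[r /= r0 rP].
  have r2 : 0 < r / 2 by rewrite divr_gt0.
  exists (ball J (r / 2), [set d | d < r / 2]) => /=.
    by split; [exact: nbhsx_ballx|exact: nbhs_right_lt].
  move=> [J1 d] [] /=; rewrite ballEmdist /= => JJ1 dr J2 J12.
  change (is_true (jdist J J1 < r / 2)) in JJ1.
  have h1 : `|f J - f J1| <= e / 2.
    by apply: rP; rewrite ballEmdist; change (is_true (jdist J J1 < r)); lra.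
  have h2 : `|f J - f J2| <= e / 2.
    apply: rP; rewrite ballEmdist; change (is_true (jdist J J2 < r)).
    by have := jdist_triangle J1 J J2; lra.
  rewrite (_ : f J1 - f J2 = (f J - f J2) - (f J - f J1)); last by ring.
  by apply: (le_trans (ler_normB _ _)); lra.
have [d [d0 dP]] : exists d : R, 0 < d /\ forall J J', jdist J J' < d -> `|f J - f J'| <= e.
  have h0 := @nbhs_right_gt R 0.
  have [d [d0 dP]] := filter_ex (filterI h0 h).
  by exists d; split => // J J'; exact: dP.
have [K [d' [d'0 KP]]] := jclose_jdist d0.
by exists K, d'; split => // J J' /KP; exact: dP.
Qed.

Lemma bijective_inverse_continuous (phi psi : jacobi2 R -> jacobi2 R) :
  continuous phi -> cancel phi psi -> cancel psi phi -> continuous psi.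
Proof.
move=> cphi phiK psiK; apply/continuous_closedP => A cA.
have -> : psi @^-1` A = phi @` A.
  apply/seteqP; split => [x Ax|_ [y Ay <-]]; last by rewrite /= phiK.
  by exists (psi x).
apply: compact_closed; first exact: metric_hausdorff.
apply: continuous_compact; first exact: continuous_subspaceT.
exact: subclosed_compact cA jacobi2_compact _.
Qed.

End coordinates.

(** * Periodic approximation *)

Section periodization.
Context {R : realType} (p : nat).
Local Notation N := p.+1.
Implicit Types J : jacobi2 R.

Let rem (n : int) : int := (n %% N%:Z)%Z.

(* Cutting the edges between consecutive blocks leaves a direct sum of translates
   of one compression of J, so the norm stays at most 2. *)
Definition block_a J n : R := if rem n == p%:Z then 0 else ja J (rem n).
Definition block_b J n : R := jb J (rem n).

Let rem_small (q k : int) : 0 <= k < N%:Z -> rem (q * N%:Z + k) = k.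
Proof. by move=> kN; rewrite /rem modzMDl modz_small. Qed.

Let block_op J u (q k : int) : 0 <= k < N%:Z ->
  jacobi_op (block_a J) (block_b J) u (k + q * N%:Z) =
  jacobi_op (ja J) (jb J) (cutoff 0 N (fun j => u (j + q * N%:Z))) k.
Proof.
move=> kN; rewrite /jacobi_op /block_b [k + _]addrC rem_small//.
congr (_ + _ + _).
- rewrite /block_a rem_small// /cutoff add0r; have [->|kp] := eqVneq k p%:Z.
    by rewrite ifF ?mulr0 ?mul0r//; lia.
  by rewrite ifT; [congr (_ * u _); lia|lia].
- have [->|k0] := eqVneq k 0.
    rewrite /block_a (_ : _ + _ - _ = (q - 1) * N%:Z + p%:Z); last by rewrite mulrBl; lia.
    by rewrite rem_small ?eqxx ?mul0r /cutoff ?ifF ?mulr0//; lia.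
  rewrite /block_a (_ : _ + _ - _ = q * N%:Z + (k - 1)); last by lia.
  rewrite rem_small; last by lia.
  rewrite ifF; last by lia.
  by rewrite /cutoff ifT; [congr (_ * u _); lia|lia].
by rewrite /cutoff add0r kN addrC.
Qed.

Let block_l2b J u C : l2b u C -> l2b (jacobi_op (block_a J) (block_b J) u) (4 * C).
Proof.
move=> uC.
have one q : isum (q * N%:Z) N (nsq \o jacobi_op (block_a J) (block_b J) u) <=
             4 * isum (q * N%:Z) N (nsq \o u).
  have h := jop_l2b J (l2b_cutoff 0 N (fun j => u (j + q * N%:Z))).
  have e1 := isum_shift 0 N (q * N%:Z) (nsq \o u); rewrite add0r in e1.
  have e2 := isum_shift 0 N (q * N%:Z)
    (nsq \o jacobi_op (block_a J) (block_b J) u); rewrite add0r in e2.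
  rewrite -e1 -e2; apply: le_trans (h 0 N).
  by apply: le_isum => k; rewrite add0r => kN; rewrite /= block_op.
have many K q : isum (q * N%:Z) (K * N) (nsq \o jacobi_op (block_a J) (block_b J) u) <=
             4 * isum (q * N%:Z) (K * N) (nsq \o u).
  elim: K => [|K ih]; first by rewrite mul0n /isum !big_ord0 mulr0.
  rewrite mulSn addnC !isum_cat mulrDr lerD//.
  rewrite (_ : q * N%:Z + (K * N)%N%:Z = (q + K%:Z) * N%:Z) ?one//.
  by rewrite mulrDl; lia.
(* An arbitrary window is enlarged to a union of whole blocks. *)
move=> m n; pose q := - (`|m| + n)%N%:Z; pose K := ((`|m| + n) + (`|m| + n))%N.
have h := many K q.
apply: (@le_trans _ _ (isum (q * N%:Z) (K * N) (nsq \o jacobi_op (block_a J) (block_b J) u))).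
  by apply: le_isum_sub => [k||]; [exact: nsq_ge0|rewrite /q; nia|rewrite /q /K; nia].
by apply: (le_trans h); rewrite ler_wpM2l.
Qed.

Definition per_eps : R := N%:R^-1.

Lemma per_eps_gt0 : 0 < per_eps. Proof. by rewrite invr_gt0. Qed.
Lemma per_eps_le1 : per_eps <= 1. Proof. by rewrite invf_le1// ler1n. Qed.

(* A convex combination with the free matrix a = 1, b = 0, of norm 2: every
   off-diagonal entry becomes at least per_eps. *)
Definition per_a J n : R := (1 - per_eps) * block_a J n + per_eps.
Definition per_b J n : R := (1 - per_eps) * block_b J n.

Lemma per_a_gt0 J n : 0 < per_a J n.
Proof.
have := per_eps_gt0; have := per_eps_le1 => h1 h2.
rewrite /per_a /block_a; case: ifP => _; first by rewrite mulr0 add0r.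
by rewrite ltr_wpDl// mulr_ge0// ?subr_ge0// ja_ge0.
Qed.

Let per_bounded J : exists M, forall n, `|per_a J n| <= M /\ `|per_b J n| <= M.
Proof.
have := per_eps_gt0; have := per_eps_le1 => h1 h2.
exists 3 => n; split.
  rewrite gtr0_norm ?per_a_gt0// /per_a /block_a; case: ifP => _; first by lra.
  have := ja_le2 J (rem n); have := ja_ge0 J (rem n); nra.
rewrite /per_b /block_b normrM ger0_norm ?subr_ge0//.
have := jb_le2 J (rem n); have := normr_ge0 (jb J (rem n)); nra.
Qed.

Let per_norm J : (opnorm (jacobi_op (per_a J) (per_b J)) <= 2%:E)%E.
Proof.
have h2 := per_eps_gt0; have h1 := per_eps_le1.
apply: opnorm_le2 => u C uC.
pose v := jacobi_op (block_a J) (block_b J) u.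
pose w : int -> R[i] := (fun n => u (n + 1)) + (fun n => u (n - 1)).
have vC : l2b v (4 * C) by exact: block_l2b.
have wC : l2b w (4 * C).
  apply: le_l2b (l2bD (l2b_shift 1 uC) (l2b_shift (-1) uC)).
  by rewrite le_eqVlt; apply/orP; left; apply/eqP; ring.
move=> m n.
apply: (@le_trans _ _ ((1 - per_eps) * isum m n (nsq \o v) + per_eps * isum m n (nsq \o w))).
  rewrite -!isumZ -isumD; apply: le_isum => k _ /=.
  have -> : jacobi_op (per_a J) (per_b J) u k =
      (1 - per_eps)%:C * v k + per_eps%:C * w k.
    rewrite /v /w /jacobi_op /per_a /per_b.
    change (((fun n => u (n + 1)) + (fun n => u (n - 1))) k) with (u (k + 1) + u (k - 1)).
    by rewrite !rmorphD !rmorphM/=; ring.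
  move: (v k) (w k) => [x y] [x' y']; rewrite /nsq/=.
  have s (t r : R) : ((1 - per_eps) * t + per_eps * r) ^+ 2 <=
     (1 - per_eps) * t ^+ 2 + per_eps * r ^+ 2.
    rewrite -subr_ge0 (_ : _ - _ = per_eps * (1 - per_eps) * (t - r) ^+ 2); last by ring.
    by rewrite mulr_ge0 ?sqr_ge0// mulr_ge0 ?subr_ge0// ltW.
  rewrite !mul0r !subr0 !addr0; have := s x x'; have := s y y'; lra.
have := vC m n; have := wC m n; nra.
Qed.

Definition perJ J : jacobi2 R :=
  Jacobi2 (fun n => ltW (per_a_gt0 J n)) (per_bounded J) (per_norm J).

Lemma perJ_periodic J : jperiodic p (perJ J).
Proof.
have r n : rem (n + N%:Z) = rem n by rewrite /rem modzDr.
by split => n /=; rewrite /per_a /per_b /block_a /block_b r.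
Qed.

Lemma perJ_near J n : 0 <= n < p%:Z ->
  ja (perJ J) n = (1 - per_eps) * ja J n + per_eps /\
  jb (perJ J) n = (1 - per_eps) * jb J n.
Proof.
move=> np; have rn : rem n = n by rewrite /rem modz_small//; lia.
by rewrite /= /per_a /per_b /block_a /block_b rn ifF//; lia.
Qed.

Lemma perJ_last J : ja (perJ J) p%:Z = per_eps.
Proof.
have rn : rem p%:Z = p%:Z by rewrite /rem modz_small//; lia.
by rewrite /= /per_a /block_a rn eqxx mulr0 add0r.
Qed.

Definition avg (g : jacobi2 R -> R) J : R :=
  N%:R^-1 * \sum_(j < N) g (iter j jshift J).

End periodization.

(** * Averages over translates *)

Section averages.
Context {R : realType}.
Implicit Types J : jacobi2 R.

Lemma ja_iter_shift J j n : ja (iter j jshift J) n = ja J (n + j%:Z).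
Proof.
elim: j n => [|j ih] n; first by rewrite addr0.
by rewrite /= ih; congr ja; lia.
Qed.

Lemma jb_iter_shift J j n : jb (iter j jshift J) n = jb J (n + j%:Z).
Proof.
elim: j n => [|j ih] n; first by rewrite addr0.
by rewrite /= ih; congr jb; lia.
Qed.

Lemma sum_lt_le (N K : nat) : \sum_(j < N) ((j < K)%N : nat) = minn N K.
Proof.
elim: N => [|N ih]; first by rewrite big_ord0 min0n.
by rewrite big_ord_recr /= ih; case: ltnP => h; lia.
Qed.

(** The sites within K of j avoid the cut, so only the convex combination moves the entries: by
    [per_eps] |1 - a| and [per_eps] |b|, where 0 <= a <= 2 and |b| <= 2. *)
Lemma perJ_jclose p K (d : R) J (j : nat) : 2 * per_eps p <= d ->
  (K <= j)%N -> (j + K < p)%N ->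
  jclose K d (iter j jshift (perJ p J)) (iter j jshift J).
Proof.
move=> ed Kj jK n nK; rewrite !ja_iter_shift !jb_iter_shift.
have [|-> ->] := @perJ_near R p J (n + j%:Z); first by lia.
have e0 := @per_eps_gt0 R p; have e1 := @per_eps_le1 R p.
have := ja_le2 J (n + j%:Z); have := ja_ge0 J (n + j%:Z) => a0 a2.
have := jb_le2 J (n + j%:Z); rewrite ler_norml => /andP[b1 b2].
by rewrite !ler_norml; split; apply/andP; split; nra.
Qed.

Lemma approx_avg (g : jacobi2 R -> R) (e : R) : continuous g -> 0 < e ->
  exists P, forall p J, (P <= p)%N -> `|avg p g (perJ p J) - avg p g J| <= e.
Proof.
move=> cg e0; have [B B0 gB] := continuous_bounded cg.
have e2 : 0 < e / 2 by rewrite divr_gt0.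
have [K [d [d0 KP]]] := continuous_uniform cg e2.
have [P1 P1d] : exists P1 : nat, 2 / d < P1%:R.
  by exists (Num.truncn (2 / d)).+1; exact: truncnS_gt.
have [P2 P2d] : exists P2 : nat, (4 * B * (K + K.+1)%:R) / e < P2%:R.
  by exists (Num.truncn ((4 * B * (K + K.+1)%:R) / e)).+1; exact: truncnS_gt.
exists (P1 + P2)%N => p J Pp.
have N0 : 0 < p.+1%:R :> R by rewrite ltr0n.
have ed : 2 * per_eps p <= d.
  rewrite /per_eps ler_pdivrMr//.
  have : (P1%:R <= p.+1%:R :> R) by rewrite ler_nat; lia.
  by move: P1d; rewrite ltr_pdivrMr// => h1 h2; nra.
rewrite /avg -mulrBr -sumrB normrM gtr0_norm ?invr_gt0// ler_pdivrMl//.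
apply: (le_trans (ler_norm_sum _ _ _)).
(* The first K and the last K + 1 translates come too close to the cut and cost 2 B each; the others
   cost e / 2. [P2] makes the total cost of the bad ones at most N e / 2. *)
apply: (@le_trans _ _ (\sum_(j < p.+1) (e / 2 + 2 * B * (j < K)%N%:R +
    2 * B * (rev_ord j < K.+1)%N%:R))).
  apply: ler_sum => j _.
  have g2 : `|g (iter j jshift (perJ p J)) - g (iter j jshift J)| <= 2 * B.
    by apply: (le_trans (ler_normB _ _)); rewrite mulr_natl mulr2n lerD.
  have [jK|Kj] := ltnP j K.
    apply: (le_trans g2); rewrite mulr1 -addrA addrCA lerDl addr_ge0 ?(ltW e2)//.
    by rewrite !mulr_ge0.
  have [jK|Kj'] := ltnP (rev_ord j) K.+1.
    by apply: (le_trans g2); rewrite mulr1 mulr0 addr0 lerDr ltW.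
  rewrite !mulr0 !addr0; apply: KP; apply: perJ_jclose => //.
  by move: Kj' => /=; have := ltn_ord j; lia.
rewrite !big_split/= sumr_const card_ord -!mulr_sumr -!natr_sum.
rewrite (sum_lt_le p.+1 K) (reindex_inj rev_ord_inj)/=.
under [X in (_ + _ * X%:R)]eq_bigr => j _ do rewrite subSS subKn ?leq_ord//.
rewrite (sum_lt_le p.+1 K.+1).
have m1 : (minn p.+1 K)%:R <= K%:R :> R by rewrite ler_nat geq_minr.
have m2 : (minn p.+1 K.+1)%:R <= K.+1%:R :> R by rewrite ler_nat geq_minr.
have : (P2%:R <= p.+1%:R :> R) by rewrite ler_nat; lia.
move: P2d; rewrite ltr_pdivrMr// natrD => h1 h2.
rewrite -[(e / 2) *+ _]mulr_natr; nra.
Qed.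

Lemma jcontinuousD (f g : jacobi2 R -> R) : continuous f -> continuous g ->
  continuous (fun J => f J + g J).
Proof. by move=> cf cg J; exact: (cvgD (cf J) (cg J)). Qed.

Lemma jcontinuousM (f g : jacobi2 R -> R) : continuous f -> continuous g ->
  continuous (fun J => f J * g J).
Proof. by move=> cf cg J; exact: (cvgM (cf J) (cg J)). Qed.

Lemma jcontinuous_sum n (f : 'I_n -> jacobi2 R -> R) :
  (forall i, continuous (f i)) -> continuous (fun J => \sum_(i < n) f i J).
Proof.
elim: n f => [|n ih] f cf.
  rewrite (_ : (fun _ => _) = fun=> 0); first exact: cst_continuous.
  by apply/funext => J; rewrite big_ord0.
rewrite (_ : (fun _ => _) = (fun J => f ord0 J + \sum_(i < n) f (lift ord0 i) J)).
  by apply: jcontinuousD => //; exact: ih.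
by apply/funext => J; rewrite big_ord_recl.
Qed.

Lemma jopE J u n : jop J u n =
  (ja J n)%:C * u (n + 1) + (ja J (n - 1))%:C * u (n - 1) + (jb J n)%:C * u n.
Proof. by []. Qed.

Section moments.
Variable q : {poly R[i]}.

Definition mom J : R := complex.Re (jpoly (ja J) (jb J) q (dlt 0) 0).

Lemma iter_jshift J j i k n :
  iter i (jop (iter j jshift J)) (dlt k) n = iter i (jop J) (dlt (k + j%:Z)) (n + j%:Z).
Proof.
elim: i n => [|i ih] n /=; first by rewrite /dlt (inj_eq (addIr _)).
rewrite [LHS]jopE [RHS]jopE !ih !ja_iter_shift !jb_iter_shift.
by rewrite (addrAC n 1) (addrAC n (-1)).
Qed.

Lemma mom_shift J j : mom (iter j jshift J) =
  complex.Re (jpoly (ja J) (jb J) q (dlt j%:Z) j%:Z).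
Proof.
rewrite /mom !(jpoly_coef _ _ _ _ (leqnn _)); congr complex.Re.
by apply: eq_bigr => i _; rewrite [iter _ _ _ _](iter_jshift J j i 0 0) add0r.
Qed.

Lemma continuous_mom : (forall i, complex.Im q`_i = 0) -> continuous mom.
Proof.
move=> qr.
have c i n : continuous (fun J => complex.Re (iter i (jop J) (dlt 0) n)).
  elim: i n => [|i ih] n /=; first exact: cst_continuous.
  have -> : (fun J => complex.Re (jop J (iter i (jop J) (dlt 0)) n)) =
     (fun J => ja J n * complex.Re (iter i (jop J) (dlt 0) (n + 1)) +
               ja J (n - 1) * complex.Re (iter i (jop J) (dlt 0) (n - 1)) +
               jb J n * complex.Re (iter i (jop J) (dlt 0) n)).
    apply/funext => J; rewrite jopE.
    by case: (iter _ _ _ _) => ? ?; case: (iter _ _ _ _) => ? ?; case: (iter _ _ _ _) => ? ? /=; ring.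
  apply: jcontinuousD; first apply: jcontinuousD.
  - exact: jcontinuousM (@continuous_ja R n) (ih _).
  - exact: jcontinuousM (@continuous_ja R (n - 1)) (ih _).
  - exact: jcontinuousM (@continuous_jb R n) (ih _).
have -> : mom = (fun J => \sum_(i < size q) complex.Re q`_i *
    complex.Re (iter i (jop J) (dlt 0) 0)).
  apply/funext => J; rewrite /mom (jpoly_coef _ _ _ _ (leqnn _)) Re_sumC.
  apply: eq_bigr => i _; rewrite /jop.
  have := qr i; have := iter_dlt_real (ja J) (jb J) i 0 0.
  by case: (iter _ _ _ _) => x y; case: (q`_i) => x' y' /= -> ->; rewrite mulr0 subr0.
by apply: jcontinuous_sum => i; exact: (jcontinuousM (@cst_continuous _ _ (complex.Re q`_i)) (c i 0)).
Qed.

End moments.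

End averages.

(** * Averages along a spectrum-preserving conjugacy *)

Section conjugacy.
Context {R : realType}.
Implicit Types J : jacobi2 R.

(** In this form periodicity passes through any map that commutes with the shift. *)
Lemma jperiodicP p J : jperiodic p J <-> iter p.+1 jshift J = J.
Proof.
split=> [[aN bN]|h].
  by apply: jacobi2_eq; apply/funext => n; rewrite ?ja_iter_shift ?jb_iter_shift.
by split => n; rewrite -[in RHS]h ?ja_iter_shift ?jb_iter_shift.
Qed.

(** A continuous truncation of ln a_0 from below; ln a_0 itself is unbounded on the compact
    space. *)
Definition gln (d : R) J : R := ln (Num.max (ja J 0) d).

Lemma continuous_gln d : 0 < d -> continuous (gln d).
Proof.
move=> d0 J; have m0 : 0 < Num.max (ja J 0) d by rewrite lt_max d0 orbT.
have c : Num.max (ja J' 0) d @[J' --> J] --> Num.max (ja J 0) d.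
  apply: (iffRL (@cvgrPdist_le _ _ _ (nbhs J) _ _ _)) => e e0.
  apply: (@filterS _ (nbhs J) _ _ _ _ (jclose_near J 0%N e0)) => J' /(_ 0)[]// h _.
  apply: le_trans h; rewrite /Num.max.
  have := ler_norm (ja J 0 - ja J' 0); have := ler_norm (- (ja J 0 - ja J' 0)).
  rewrite normrN; have := normr_ge0 (ja J 0 - ja J' 0).
  by do 2 case: ltP => ?; rewrite ler_norml => *; apply/andP; split; lra.
exact: (cvg_comp _ _ c (continuous_ln m0)).
Qed.

Lemma sum_ln_prod n (f : 'I_n -> R) : (forall i, 0 < f i) ->
  \sum_(i < n) ln (f i) = ln (\prod_(i < n) f i).
Proof.
elim: n f => [|n ih] f f0; first by rewrite !big_ord0 ln1.
by rewrite !big_ord_recl ih// lnM ?posrE// prodr_gt0.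
Qed.

Variable phi : jacobi2 R -> jacobi2 R.
Hypothesis cphi : continuous phi.
Hypothesis phi_shift : forall J, jshift (phi J) = phi (jshift J).
Hypothesis phi_spectrum : forall J, spectrum (jop (phi J)) = spectrum (jop J).

Lemma phi_iter_shift j J : phi (iter j jshift J) = iter j jshift (phi J).
Proof. by elim: j => //= j ih; rewrite -phi_shift ih. Qed.

Lemma avg_phi p (g : jacobi2 R -> R) J : avg p (g \o phi) J = avg p g (phi J).
Proof.
by rewrite /avg; congr (_ * _); apply: eq_bigr => j _; rewrite /= phi_iter_shift.
Qed.

Lemma phi_periodic p J : jperiodic p J -> jperiodic p (phi J).
Proof. by move=> /jperiodicP h; apply/jperiodicP; rewrite -phi_iter_shift h. Qed.

Lemma continuous_comp_phi (g : jacobi2 R -> R) : continuous g -> continuous (g \o phi).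
Proof. by move=> cg J; apply: continuous_comp; [exact: cphi|exact: cg]. Qed.

Lemma mom_avg_periodic p (q : {poly R[i]}) J : jperiodic p J -> (forall n, 0 < ja J n) ->
  (size q <= p.+1)%N -> avg p (mom q) (phi J) = avg p (mom q) J.
Proof.
move=> pJ a0 qp.
have e J' : \sum_(j < p.+1) mom q (iter j jshift J') =
    complex.Re (\sum_(j < p.+1) jpoly (ja J') (jb J') q (dlt j%:Z) j%:Z).
  by rewrite Re_sumC; apply: eq_bigr => j _; exact: mom_shift.
have h := period_trace_eq (esym (phi_spectrum J)) pJ (phi_periodic pJ) a0 qp.
have {}h := etrans (e (phi J)) (etrans (congr1 _ (esym h)) (esym (e J))).
exact: (congr1 (fun x => p.+1%:R^-1 * x) h).
Qed.

Lemma mom_close (q : {poly R[i]}) (e : R) : (forall i, complex.Im q`_i = 0) -> 0 < e ->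
  exists p, forall J, `|avg p (mom q \o phi) J - avg p (mom q) J| <= e.
Proof.
move=> qr e0; have e2 : 0 < e / 2 by rewrite divr_gt0.
have cm := continuous_mom qr.
have [P1 h1] := approx_avg (continuous_comp_phi cm) e2.
have [P2 h2] := approx_avg cm e2.
(* Adding [size q] keeps the degree of q below the period, as the trace formula requires. *)
pose p := (P1 + P2 + size q)%N; exists p => J.
have num (x y z w : R) : x = y -> `|x - z| <= e / 2 -> `|y - w| <= e / 2 -> `|z - w| <= e.
  move=> -> g1 g2; rewrite (_ : z - w = (y - w) - (y - z)); last by ring.
  by apply: (le_trans (ler_normB _ _)); lra.
apply: (num _ _ _ _ _ (h1 p J _) (h2 p J _)); [|by rewrite /p; lia..].
apply: (etrans (avg_phi p (mom q) (perJ p J))).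
apply: mom_avg_periodic; [exact: perJ_periodic|by move=> n; exact: per_a_gt0|].
by rewrite /p; lia.
Qed.

(** J and phi J have equal products over a period, hence equal sums of logarithms, and truncation
    only raises the side of phi J. A zero entry of phi J would make the common product vanish. *)
Lemma log_avg_periodic p J d : 0 < d -> jperiodic p J -> (forall n, 0 < ja J n) ->
  p.+1%:R^-1 * \sum_(j < p.+1) ln (ja J j%:Z) <= avg p (gln d) (phi J).
Proof.
move=> d0 pJ a0; rewrite /avg ler_wpM2l ?invr_ge0//.
have P0 : 0 < period_prod (ja (phi J)) p.
  rewrite -(period_prod_eq (esym (phi_spectrum J)) pJ (phi_periodic pJ)).
  by apply: prodr_gt0 => i _; exact: a0.
have a0' (j : 'I_p.+1) : 0 < ja (phi J) j%:Z.
  rewrite lt_neqAle ja_ge0 andbT; apply/eqP => a00.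
  by move: P0; rewrite /period_prod (bigD1 j)//= -a00 mul0r ltxx.
rewrite sum_ln_prod// -[X in ln X]/(period_prod (ja J) p).
rewrite (period_prod_eq (esym (phi_spectrum J)) pJ (phi_periodic pJ)).
rewrite /period_prod -sum_ln_prod//.
apply: ler_sum => j _; rewrite /gln ja_iter_shift add0r.
by rewrite ler_ln ?posrE ?lt_max ?a0'// le_max lexx.
Qed.

(** On the side of phi the level d is fixed before p, since the uniform continuity of [gln d \o phi]
    may degrade as d tends to 0. On the side of J the level may follow p, the entries of [perJ p J]
    being explicit. This asymmetry leaves a one-sided bound. *)
Lemma log_close (d e : R) (P : nat) : 0 < d -> 0 < e -> exists2 p, (P <= p)%N &
  forall J, avg p (gln (per_eps p)) J - e <= avg p (gln d \o phi) J.
Proof.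
move=> d0 e0; have e2 : 0 < e / 2 by rewrite divr_gt0.
have [P1 h1] := approx_avg (continuous_comp_phi (continuous_gln d0)) e2.
have [k0 k0e] : exists k0 : nat, 5 / e < k0%:R.
  by exists (Num.truncn (5 / e)).+1; exact: truncnS_gt.
pose k := (P + P1 + k0).+1.
have k0k : (k0 <= k)%N by rewrite /k; lia.
(* With N = 2 k^2, ln N = 2 ln (2k) - ln 2 and ln (2k) <= 2k, so ln N is of order at most the square
   root of N by elementary means. A total loss of 5k is then at most N e / 2 = k^2 e once 5 / e <=
   k. *)
pose p := (2 * k ^ 2).-1.
have pk : p.+1 = (2 * k ^ 2)%N by rewrite /p prednK// muln_gt0 expn_gt0.
have kp : (k <= p)%N by rewrite /p; nia.
have p0 : (0 < p)%N := leq_trans (ltn0Sn _) kp.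
have N0 : 0 < p.+1%:R :> R by rewrite ltr0n.
exists p => [|J]; first by lia.
have hJ := h1 p J (_ : (P1 <= p)%N).
have {}hJ : `|avg p (gln d \o phi) (perJ p J) - avg p (gln d \o phi) J| <= e / 2.
  by apply: hJ; lia.
have aP n : 0 < ja (perJ p J) n by exact: per_a_gt0.
have := log_avg_periodic d0 (perJ_periodic p J) aP; rewrite -avg_phi => hlog.
pose E : R := per_eps p.
have E0 : 0 < E := @per_eps_gt0 R p.
have E1 : E < 1 by rewrite /E /per_eps invf_lt1// ltr1n.
(* At the p sites before the cut (1 - E) x + E >= (1 - E) max(x, E), and ln (1 - E) >= -1/p costs 1
   in total. At the cut the entry is E = 1/N while the truncated logarithm is at most ln 2, which
   costs at most 4k. *)
have main : avg p (gln E) J - e / 2 <= p.+1%:R^-1 * \sum_(j < p.+1) ln (ja (perJ p J) j%:Z).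
  have hj (j : 'I_p) : gln E (iter (widen_ord (leqnSn p) j) jshift J) - p%:R^-1 <=
      ln (ja (perJ p J) j%:Z).
    rewrite /gln ja_iter_shift add0r.
    have [|-> _] := @perJ_near R p J j%:Z; first by have := ltn_ord j; lia.
    rewrite -/E /=; set x := ja J j%:Z; have x0 : 0 <= x by exact: ja_ge0.
    have m0 : 0 < Num.max x E by rewrite lt_max E0 orbT.
    have hE : - p%:R^-1 <= ln (1 - E).
      rewrite lerNl -lnV ?posrE ?subr_gt0//.
      have -> : (1 - E)^-1 = 1 + p%:R^-1.
        rewrite /E /per_eps -natr1; field.
        by rewrite natr1 !pnatr_eq0 andbT -lt0n.
      by apply: le_ln1Dx; rewrite (lt_le_trans (ltrN10 _))// invr_ge0.
    apply: (@le_trans _ _ (ln (1 - E) + ln (Num.max x E))); first by lra.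
    rewrite -lnM ?posrE ?subr_gt0// ler_ln ?posrE ?mulr_gt0 ?subr_gt0//.
      by rewrite /Num.max; case: ltP => ?; nra.
    by rewrite ltr_wpDl// mulr_ge0// subr_ge0 ltW.
  have hp : gln E (iter p jshift J) - 4 * k%:R <= ln (ja (perJ p J) p%:Z).
    rewrite perJ_last -/E /gln ja_iter_shift add0r.
    have l2 : ln (Num.max (ja J p%:Z) E) <= ln 2.
      rewrite ler_ln ?posrE ?lt_max ?E0 ?orbT//.
      by rewrite ge_max ja_le2/=; lra.
    have l4 : ln (2 * k%:R) <= 2 * k%:R :> R.
      have k2 : 0 < 2 * k%:R :> R by rewrite mulr_gt0// ltr0n.
      have h := @le_ln1Dx R (2 * k%:R - 1).
      by rewrite (_ : 1 + (2 * k%:R - 1) = 2 * k%:R) in h; [apply: (le_trans (h _)); lra|ring].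
    have e4 : ln E = - (2 * ln (2 * k%:R) - ln 2).
      rewrite /E /per_eps pk natrM natrX lnV ?posrE ?mulr_gt0 ?exprn_gt0 ?ltr0n//.
      rewrite expr2 !lnM ?posrE ?mulr_gt0 ?ltr0n//; ring.
    by rewrite e4; lra.
  rewrite -(@ler_pM2l _ p.+1%:R)// mulrBr /avg !mulrA mulfV ?gt_eqF// !mul1r.
  rewrite !big_ord_recr/=.
  have hs : \sum_(i < p) gln E (iter i jshift J) - 1 <= \sum_(i < p) ln (ja (perJ p J) i%:Z).
    apply: (@le_trans _ _ (\sum_(i < p) (gln E (iter i jshift J) - p%:R^-1))).
      rewrite sumrB sumr_const card_ord lerD2l lerN2 -[leLHS]mulr_natr mulVf//.
      by rewrite pnatr_eq0 -lt0n.
    by apply: ler_sum => i _; exact: hj.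
  have hk : 5 * k%:R <= p.+1%:R * (e / 2).
    rewrite pk natrM natrX.
    have ke : 5 <= e * k%:R.
      by rewrite mulrC -ler_pdivrMr// (le_trans (ltW k0e))// ler_nat.
    have kk : 0 < k%:R :> R by rewrite ltr0n.
    rewrite (_ : 2%:R * k%:R ^+ 2 * (e / 2) = (e * k%:R) * k%:R); last by field.
    by rewrite ler_pM2r.
  have k1 : 1 <= k%:R :> R by rewrite ler1n.
  lra.
have num (x y z : R) : x - e / 2 <= y -> `|y - z| <= e / 2 -> x - e <= z.
  by rewrite ler_norml => ? /andP[_ ?]; lra.
exact: num (le_trans main hlog) hJ.
Qed.

End conjugacy.

(** * Integrals against invariant measures *)

Section invariant_integrals.
Context {R : realType}.
Implicit Types (mu : probability (borelJ2 R) R) (g : jacobi2 R -> R).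

Lemma continuous_borel g : continuous g ->
  measurable_fun setT (g : borelJ2 R -> measurableTypeR R).
Proof.
move=> /continuousP cg.
apply: (measurability _ (RGenOpens.measurableE R)) => _ [_ [a [b ->]] <-].
by rewrite setTI; apply: sub_sigma_algebra; apply: cg; exact: interval_open.
Qed.

Lemma continuous_integrable mu g : continuous g -> mu.-integrable setT (EFin \o g).
Proof.
move=> cg; apply: measurable_bounded_integrable => //.
- by rewrite (le_lt_trans (probability_le1 mu measurableT))// ltry.
- exact: continuous_borel.
have [B B0 gB] := continuous_bounded cg.
exists B; split; first exact: num_real.
by move=> M BM J _; exact: le_trans (gB J) (ltW BM).
Qed.

Definition jint mu g : R := \int[mu]_J g J.

Lemma jint_le mu f g : continuous f -> continuous g -> (forall J, f J <= g J) ->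
  jint mu f <= jint mu g.
Proof. by move=> cf cg fg; apply: le_Rintegral => //; exact: continuous_integrable. Qed.

Lemma jint_cst mu (c : R) : jint mu (fun=> c) = c.
Proof.
rewrite /jint (Rintegral_cst mu measurableT) /=.
by rewrite probability_setT mulr1.
Qed.

Lemma jintD mu f g : continuous f -> continuous g ->
  jint mu (fun J => f J + g J) = jint mu f + jint mu g.
Proof. by move=> cf cg; apply: RintegralD => //; exact: continuous_integrable. Qed.

Lemma jintZ mu (c : R) g : continuous g -> jint mu (fun J => c * g J) = c * jint mu g.
Proof. by move=> cg; apply: RintegralZl => //; exact: continuous_integrable. Qed.

Lemma jint_sum mu n (f : 'I_n -> jacobi2 R -> R) : (forall i, continuous (f i)) ->
  jint mu (fun J => \sum_(i < n) f i J) = \sum_(i < n) jint mu (f i).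
Proof.
elim: n f => [|n ih] f cf.
  rewrite big_ord0 -[RHS](jint_cst mu 0); congr (jint mu _).
  by apply/funext => J; rewrite big_ord0.
rewrite big_ord_recl -ih; last by move=> i; exact: cf.
rewrite -jintD//; last by apply: jcontinuous_sum => i; exact: cf.
by congr (jint mu _); apply/funext => J; rewrite big_ord_recl.
Qed.

Lemma jint_EFin mu g : continuous g -> (\int[mu]_J (g J)%:E = (jint mu g)%:E)%E.
Proof.
move=> cg; rewrite /jint /Rintegral fineK//.
by apply: integrable_fin_num => //; exact: continuous_integrable.
Qed.

Lemma jint_image mu (phi : jacobi2 R -> jacobi2 R) (cphi : continuous phi) g :
  continuous g -> jint (image_measure cphi mu) g = jint mu (g \o phi).
Proof. by move=> cg; rewrite /jint /Rintegral image_measureE. Qed.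

Lemma continuous_jshift : continuous (@jshift R).
Proof.
move=> J; apply: (@cvg_jacobi R _ (jshift J) (fmap_filter jshift (nbhs_filter J))) => n.
  exact: (@continuous_ja R (n + 1) J).
exact: (@continuous_jb R (n + 1) J).
Qed.

Lemma continuous_iter_jshift j : continuous (fun J => iter j (@jshift R) J).
Proof.
elim: j => [|j ih] J; first exact: cvg_id.
by apply: (@continuous_comp _ _ _ (fun J => iter j jshift J) jshift);
  [exact: ih|exact: continuous_jshift].
Qed.

Lemma jcontinuous_comp (h : jacobi2 R -> jacobi2 R) g :
  continuous h -> continuous g -> continuous (g \o h).
Proof. by move=> ch cg J; apply: continuous_comp; [exact: ch|exact: cg]. Qed.

Lemma continuous_avg p g : continuous g -> continuous (avg p g).
Proof.
move=> cg; apply: jcontinuousM; first exact: cst_continuous.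
by apply: jcontinuous_sum => j; exact: (jcontinuous_comp (@continuous_iter_jshift j) cg).
Qed.

Definition jinvariant mu :=
  forall A : set (borelJ2 R), measurable A -> mu (jshift @^-1` A) = mu A.

Lemma jint_shift mu g : jinvariant mu -> continuous g ->
  jint mu (g \o jshift) = jint mu g.
Proof.
move=> inv cg; rewrite -(jint_image mu continuous_jshift cg).
rewrite /jint /Rintegral; congr fine; apply: eq_measure_integral => A mA _.
exact: inv.
Qed.

Lemma jint_avg mu p g : jinvariant mu -> continuous g -> jint mu (avg p g) = jint mu g.
Proof.
move=> inv cg.
have cgj j : continuous (fun J => g (iter j jshift J)).
  exact: (jcontinuous_comp (@continuous_iter_jshift j) cg).
have h j : jint mu (fun J => g (iter j jshift J)) = jint mu g.
  elim: j => // j ih; rewrite -[RHS]ih -(jint_shift inv (cgj j)).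
  by congr (jint mu _); apply/funext => J /=; rewrite -iterS iterSr.
rewrite /avg jintZ; last by apply: jcontinuous_sum => j; exact: cgj.
rewrite jint_sum; last by move=> j; exact: cgj.
under eq_bigr do rewrite h.
rewrite sumr_const card_ord -[jint mu g *+ _]mulr_natl mulKf//.
Qed.

Lemma jint_close mu f g (e : R) : continuous f -> continuous g ->
  (forall J, `|f J - g J| <= e) -> `|jint mu f - jint mu g| <= e.
Proof.
move=> cf cg fg.
have h f1 g1 : continuous f1 -> continuous g1 -> (forall J, f1 J <= e + g1 J) ->
    jint mu f1 <= e + jint mu g1.
  move=> c1 c2 le; rewrite -[X in X + _](jint_cst mu e) -jintD//; last exact: cst_continuous.
  by apply: jint_le => //; apply: jcontinuousD => //; exact: cst_continuous.
have h1 : jint mu f <= e + jint mu g.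
  by apply: h => // J; have := fg J; rewrite ler_norml => /andP[_]; lra.
have h2 : jint mu g <= e + jint mu f.
  by apply: h => // J; have := fg J; rewrite ler_norml => /andP[+ _]; lra.
by rewrite ler_norml; apply/andP; split; lra.
Qed.

Lemma jint_eq_avg mu f g : jinvariant mu -> continuous f -> continuous g ->
  (forall e, 0 < e -> exists p, forall J, `|avg p f J - avg p g J| <= e) ->
  jint mu f = jint mu g.
Proof.
move=> inv cf cg h.
apply/eqP; rewrite -subr_eq0 -normr_le0; apply/ler_addgt0Pl => e e0; rewrite addr0.
have [p hp] := h e e0; rewrite -(jint_avg p inv cf) -(jint_avg p inv cg).
by apply: jint_close => //; exact: continuous_avg.
Qed.

Lemma jint_le_avg mu f g p (e : R) : jinvariant mu -> continuous f -> continuous g ->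
  (forall J, avg p f J - e <= avg p g J) -> jint mu f <= jint mu g + e.
Proof.
move=> inv cf cg h.
rewrite -(jint_avg p inv cf) -(jint_avg p inv cg) -[X in _ + X](jint_cst mu e) -jintD.
- apply: jint_le; first exact: continuous_avg.
    by apply: jcontinuousD; [exact: continuous_avg|exact: cst_continuous].
  by move=> J; have := h J; lra.
- exact: continuous_avg.
- exact: cst_continuous.
Qed.

Lemma jcontinuousB (f g : jacobi2 R -> R) : continuous f -> continuous g ->
  continuous (fun J => f J - g J).
Proof. by move=> cf cg J; exact: (cvgB (cf J) (cg J)). Qed.

Section log_integral.
Variable mu : probability (borelJ2 R) R.

(** Nonnegative because a_0 <= 2, and the increasing limit of the continuous [Ln], so that monotone
    convergence applies even when the integral is infinite. *)
Let L (J : borelJ2 R) : \bar R := ((ln 2)%:E - lne (ja J 0)%:E)%E.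
Let Ln (n : nat) (J : borelJ2 R) : \bar R := (ln 2 - gln n.+1%:R^-1 J)%:E.

Let gln_le2 (d : R) J : 0 < d <= 2 -> gln d J <= ln 2.
Proof.
move=> /andP[d0 d2]; rewrite /gln ler_ln ?posrE ?lt_max ?d0 ?orbT//.
by rewrite ge_max ja_le2.
Qed.

Let eps_gt0 n : 0 < n.+1%:R^-1 :> R. Proof. by rewrite invr_gt0. Qed.
Let eps_le n : 0 < (n.+1%:R^-1 : R) <= 2.
Proof. by rewrite eps_gt0/= (@le_trans _ _ 1)// ?invf_le1// ?ler1n. Qed.

Let cLn n : continuous (fun J => ln 2 - gln n.+1%:R^-1 J : R).
Proof.
by apply: jcontinuousB; [exact: cst_continuous|exact: continuous_gln].
Qed.

Let mLn n : measurable_fun setT (Ln n).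
Proof. by apply/measurable_EFinP; exact: continuous_borel (@cLn n). Qed.

Let Ln_ge0 n J : (0 <= Ln n J)%E.
Proof. by rewrite /Ln lee_fin subr_ge0 gln_le2. Qed.

Let Ln_nd J : nondecreasing_seq (Ln ^~ J).
Proof.
move=> m n mn; rewrite /Ln lee_fin lerD2l lerN2 /gln.
rewrite ler_ln ?posrE ?lt_max ?eps_gt0 ?orbT//.
rewrite ge_max !le_max lexx/=; apply/orP; right.
by rewrite lef_pV2 ?posrE// ler_nat.
Qed.

Let Ln_lim J : Ln n J @[n --> \oo] --> L J.
Proof.
have := ja_ge0 J 0; rewrite le_eqVlt => /predU1P[a0|a0].
  rewrite /L le0_lneNy -?a0//= /Ln.
  have -> : (fun n => (ln 2 - gln n.+1%:R^-1 J)%:E) =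
            (fun n => (ln 2 + ln n.+1%:R)%:E).
    apply/funext => n; rewrite /gln -a0 max_r ?invr_ge0// lnV ?posrE ?ltr0n//.
    by rewrite opprK.
  apply/cvgeryP/cvgryPge => M.
  exists (Num.truncn (expR M)) => // n /= Mn.
  have e : expR M <= n.+1%:R.
    by apply: (le_trans (ltW (truncnS_gt _))); rewrite ler_nat.
  have : M <= ln n.+1%:R by rewrite -[M]expRK ler_ln ?posrE ?expR_gt0 ?ltr0n.
  have : 0 <= ln 2 :> R by rewrite ln_ge0// ler1n.
  lra.
rewrite /L lne_EFin// -EFinB.
apply: cvg_near_cst; exists (Num.truncn (ja J 0)^-1) => // n /= an.
rewrite /Ln /gln max_l//.
rewrite -[leRHS]invrK lef_pV2 ?posrE ?invr_gt0 ?ltr0n//.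
by apply: (le_trans (ltW (truncnS_gt _))); rewrite ler_nat.
Qed.

Let mL : measurable_fun setT L.
Proof. by apply: (emeasurable_fun_cvg Ln) => // J _; exact: Ln_lim. Qed.

Let L_ge0 J : (0 <= L J)%E.
Proof.
have h := @Ln_lim J; rewrite -(cvg_lim _ h)//.
by apply: lime_ge; [apply/cvg_ex; eexists; exact: h|apply: nearW => n; exact: Ln_ge0].
Qed.

Let jint_Ln n : (\int[mu]_J Ln n J = (ln 2 - jint mu (gln n.+1%:R^-1))%:E)%E.
Proof.
rewrite (jint_EFin mu (@cLn n)); congr EFin.
rewrite -[X in X - _](jint_cst mu (ln 2)) /jint -RintegralB//.
  by apply: continuous_integrable; exact: cst_continuous.
by apply: continuous_integrable; exact: continuous_gln.
Qed.

Let int_L_cvg : (\int[mu]_J Ln n J)%E @[n --> \oo] --> (\int[mu]_J L J)%E.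
Proof.
have -> : (\int[mu]_J L J = \int[mu]_J limn (Ln ^~ J))%E.
  by apply: eq_integral => J _; rewrite (cvg_lim _ (@Ln_lim J)).
by apply: cvg_monotone_convergence => // J _; exact: Ln_nd.
Qed.

(** ln a_0 may fail to be integrable, so linearity is not at hand. Its positive part is bounded by
    ln 2 and thus integrable; the negative part is split off as a nonnegative summand of L. *)
Let int_lna0E : int_lna0 mu = ((ln 2)%:E - \int[mu]_J L J)%E.
Proof.
pose f (J : borelJ2 R) := lne (ja J 0)%:E.
have fL J : f J = ((ln 2)%:E - L J)%E.
  rewrite /f /L; case: (lne _) => [r| |]//=.
  by rewrite -!EFinB; congr EFin; ring.
have mf : measurable_fun setT f.
  rewrite (_ : f = fun J => (ln 2)%:E - L J)%E; last exact/funext.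
  exact: emeasurable_funB.
have ln2 : 0 <= ln 2 :> R by rewrite ln_ge0// ler1n.
have fp J : (f^\+ J <= (ln 2)%:E)%E.
  rewrite funeposE ge_max lee_fin ln2 andbT fL.
  by rewrite -[leRHS]sube0; apply: leeB => //; exact: L_ge0.
have ifp : mu.-integrable setT (f^\+)%E.
  apply: (@le_integrable _ _ _ mu setT measurableT (f^\+)%E (fun=> (ln 2)%:E)).
  - exact: measurable_funepos.
  - by move=> J _; rewrite gee0_abs// gee0_abs ?lee_fin.
  - by apply: (continuous_integrable mu (@cst_continuous _ _ (ln 2 : R))).
have ipf : (\int[mu]_J f^\+ J)%E \is a fin_num by exact: integrable_fin_num.
have e : (\int[mu]_J L J = (ln 2)%:E - \int[mu]_J f^\+ J + \int[mu]_J f^\- J)%E.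
  have -> : (\int[mu]_J L J = \int[mu]_J (((ln 2)%:E - f^\+ J) + f^\- J))%E.
    apply: eq_integral => J _; rewrite /L -/(f J) {1}(funeposneg f) /=.
    rewrite oppeB; first by rewrite addeA.
    rewrite fin_num_adde_defr//.
    by rewrite ge0_fin_numE// (le_lt_trans (fp J))// ltry.
  rewrite ge0_integralD//.
  - congr (_ + _)%E; rewrite integralB//; last first.
      by apply: (continuous_integrable mu (@cst_continuous _ _ (ln 2 : R))).
    congr (_ - _)%E.
    have := jint_EFin mu (@cst_continuous _ _ (ln 2 : R)) => ->.
    by rewrite jint_cst.
  - by move=> J _; rewrite sube_ge0 ?orbT ?fp.
  - apply: emeasurable_funB => //; exact: measurable_funepos.
  - exact: measurable_funeneg.
rewrite e /int_lna0 integralE -/f; move: ipf.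
case: (\int[mu]_J f^\+ J)%E => [r| |]// _.
case: (\int[mu]_J f^\- J)%E => [s| |]//=.
by rewrite -?EFinB -?EFinD -?EFinB; congr EFin; ring.
Qed.

Lemma int_lna0_le d : 0 < d <= 2 -> (int_lna0 mu <= (jint mu (gln d))%:E)%E.
Proof.
move=> d02; have /andP[d0 d2] := d02.
have cd : continuous (fun J => ln 2 - gln d J : R).
  by apply: jcontinuousB; [exact: cst_continuous|exact: continuous_gln].
have : ((ln 2 - jint mu (gln d))%:E <= \int[mu]_J L J)%E.
  have <- : (\int[mu]_J (ln 2 - gln d J)%:E = (ln 2 - jint mu (gln d))%:E)%E.
    rewrite (jint_EFin mu cd); congr EFin.
    rewrite -[X in X - _](jint_cst mu (ln 2)) /jint -RintegralB//.
      by apply: continuous_integrable; exact: cst_continuous.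
    by apply: continuous_integrable; exact: continuous_gln.
  apply: ge0_le_integral => //.
  - by move=> J _; rewrite lee_fin subr_ge0 gln_le2.
  - by apply/measurable_EFinP; exact: continuous_borel.
  move=> J _; rewrite /L EFinB; apply: leeB => //.
  have := ja_ge0 J 0; rewrite le_eqVlt => /predU1P[a0|a0].
    by rewrite le0_lneNy -?a0 ?leNye.
  rewrite lne_EFin// lee_fin /gln ler_ln ?posrE//; first by rewrite le_max lexx.
  by rewrite lt_max a0.
rewrite int_lna0E; case: (\int[mu]_J L J)%E => [r| |]//=; last by rewrite leNye.
by rewrite -EFinB !lee_fin; lra.
Qed.

(** With [int_lna0_le], the integral of ln a_0 is the infimum of its truncations, so an estimate at
    each fixed d suffices. *)
Lemma int_lna0_ge (x : \bar R) :
  (forall d, 0 < d <= 2 -> (x <= (jint mu (gln d))%:E)%E) -> (x <= int_lna0 mu)%E.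
Proof.
move=> h; rewrite int_lna0E.
have hx n : (\int[mu]_J Ln n J <= (ln 2)%:E - x)%E.
  rewrite jint_Ln; have := h _ (eps_le n).
  by case: x {h} => [x| |]//=; rewrite ?leey// -EFinB !lee_fin; lra.
have : (\int[mu]_J L J <= (ln 2)%:E - x)%E.
  rewrite -(cvg_lim _ int_L_cvg)//; apply: lime_le.
    by apply/cvg_ex; eexists; exact: int_L_cvg.
  exact: nearW.
(* Rules out x = +oo before ln 2 - x is rearranged. *)
have : (x <= (jint mu (gln 1))%:E)%E by apply: h; rewrite ltr01 ler1n.
case: x {h hx} => [x| |]//=; rewrite ?leNye//.
move=> _; case: (\int[mu]_J L J)%E => [r| |]//=.
- by rewrite -!EFinB !lee_fin; lra.
- by rewrite leey.
Qed.

End log_integral.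

End invariant_integrals.

(** * Image of an invariant measure under the conjugacy *)

Section conjugate_measure.
Context {R : realType} (phi : jacobi2 R -> jacobi2 R).
Hypothesis cphi : continuous phi.
Hypothesis phi_shift : forall J, jshift (phi J) = phi (jshift J).
Hypothesis phi_spectrum : forall J, spectrum (jop (phi J)) = spectrum (jop J).
Implicit Types mu : probability (borelJ2 R) R.

Lemma jint_mom_phi mu (q : {poly R[i]}) : (forall i, complex.Im q`_i = 0) ->
  jinvariant mu -> jint mu (mom q \o phi) = jint mu (mom q).
Proof.
move=> qr inv; have cm := continuous_mom qr; have cm' := jcontinuous_comp cphi cm.
apply: jint_eq_avg => // e e0.
have h := mom_close cphi phi_shift phi_spectrum qr e0; exact: h.
Qed.

(** On the side of mu, replacing ln a_0 by a truncation depending on p enlarges the integral, which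
    is the allowed direction. On the image side d stays fixed until [int_lna0_ge] lets it go to
    0. *)
Lemma int_lna0_image_ge mu : jinvariant mu ->
  (int_lna0 mu <= int_lna0 (image_measure cphi mu))%E.
Proof.
move=> inv; apply: int_lna0_ge => d /andP[d0 d2].
have cd := continuous_gln d0; have cd' := jcontinuous_comp cphi cd.
rewrite (jint_image mu cphi cd); apply/lee_addgt0Pr => e e0.
have [p _ h] := log_close cphi phi_shift phi_spectrum 0 d0 e0.
have pe : 0 < (per_eps p : R) <= 2.
  by rewrite per_eps_gt0 (le_trans (per_eps_le1 p))// ler1n.
have pe0 : 0 < per_eps p :> R by exact: per_eps_gt0.
have cp := continuous_gln pe0.
apply: (le_trans (int_lna0_le mu pe)); rewrite -EFinD lee_fin.
exact: (jint_le_avg inv cp cd' h).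
Qed.

Lemma jinvariant_image mu : jinvariant mu -> jinvariant (image_measure cphi mu).
Proof.
move=> inv A mA.
have mphiA : measurable (phi @^-1` A : set (borelJ2 R)).
  by rewrite -[X in measurable X]setTI; exact: continuous_borel_measurable.
change (mu (phi @^-1` (jshift @^-1` A)) = mu (phi @^-1` A)).
rewrite -(inv _ mphiA).
have -> // : phi @^-1` (jshift @^-1` A) = jshift @^-1` (phi @^-1` A).
by apply/seteqP; split => J /=; rewrite phi_shift.
Qed.

End conjugate_measure.

(** * Spectral measures *)

Section density.
Context d (T : measurableType d) (R : realType).
Local Open Scope ereal_scope.

(** The measure g dm. With [mg] and [g0] as arguments, the measure structure can be inferred from
    the term alone and the construction iterated. *)
Definition mdens (g : T -> R) (mg : measurable_fun setT g) (g0 : forall x, (0 <= g x)%R)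
  (m : {measure set T -> \bar R}) (A : set T) : \bar R := \int[m]_(x in A) (g x)%:E.

Variables (g : T -> R) (mg : measurable_fun setT g) (g0 : forall x, (0 <= g x)%R).
Variable m : {measure set T -> \bar R}.

Let mg' : measurable_fun setT (EFin \o g).
Proof. exact/measurable_EFinP. Qed.

Let mdens0 : mdens mg g0 m set0 = 0. Proof. exact: integral_set0. Qed.

Let mdens_ge0 A : 0 <= mdens mg g0 m A.
Proof. by apply: integral_ge0 => x _; rewrite lee_fin. Qed.

Let mdens_sigma : semi_sigma_additive (mdens mg g0 m).
Proof. by apply: semi_sigma_additive_nng_induced => // x; rewrite lee_fin. Qed.

HB.instance Definition _ := isMeasure.Build _ _ _ (mdens mg g0 m)
  mdens0 mdens_ge0 mdens_sigma.

Import HBNNSimple.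

Lemma integral_mdens_nnsfun (h : {nnsfun T >-> R}) :
  \int[mdens mg g0 m]_x (h x)%:E = \int[m]_x ((h x)%:E * (g x)%:E).
Proof.
under [LHS]eq_integral do rewrite fimfunE -fsumEFin//.
rewrite [LHS]ge0_integral_fsum//; last 2 first.
  - by move=> r; exact/measurable_EFinP/measurableT_comp.
  - by move=> n x _; rewrite EFinM nnfun_muleindic_ge0.
under [RHS]eq_integral.
  move=> x xD; rewrite fimfunE -fsumEFin// ge0_mule_fsuml; last first.
    by move=> r; rewrite EFinM nnfun_muleindic_ge0.
  over.
rewrite [RHS]ge0_integral_fsum//; last 2 first.
  - by move=> r; apply: emeasurable_funM => //; apply/measurable_EFinP; exact: measurableT_comp.
  - by move=> n x _; rewrite mule_ge0// ?EFinM ?nnfun_muleindic_ge0// lee_fin.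
apply: eq_fsbigr => r rh.
have r0 : (0 <= r)%R by move: rh; rewrite inE => -[t _ <-].
under eq_integral do rewrite EFinM.
under [in RHS]eq_integral do rewrite EFinM -muleA.
rewrite !ge0_integralZl//; last 3 first.
- by apply: emeasurable_funM => //; apply/measurable_EFinP.
- by move=> t _; rewrite mule_ge0// lee_fin.
- exact/measurable_EFinP.
rewrite integral_indic// setIT /= /mdens integral_mkcond.
by congr (_ * _); apply: eq_integral => x _; rewrite epatch_indic muleC.
Qed.

Lemma ge0_integral_mdens (h : T -> \bar R) : measurable_fun setT h -> (forall x, 0 <= h x) ->
  \int[mdens mg g0 m]_x h x = \int[m]_x (h x * (g x)%:E).
Proof.
move=> mh h0; pose f_ := nnsfun_approx measurableT mh.
transitivity (limn (fun n => \int[mdens mg g0 m]_x (f_ n x)%:E)).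
  rewrite -monotone_convergence//=.
  - by apply: eq_integral => x _; apply/esym/cvg_lim => //=; exact: cvg_nnsfun_approx.
  - by move=> n; exact/measurable_EFinP.
  - by move=> n x _; rewrite lee_fin.
  - by move=> x _ a b ab; rewrite lee_fin//; exact/lefP/nd_nnsfun_approx.
rewrite (_ : (fun n => _) = fun n => \int[m]_x ((f_ n x)%:E * (g x)%:E)); last first.
  by apply/funext => n; exact: integral_mdens_nnsfun.
rewrite -monotone_convergence//=.
- apply: eq_integral => x _; apply/cvg_lim => //.
  by apply: cvgeZr => //; exact: cvg_nnsfun_approx.
- by move=> n; apply: emeasurable_funM => //; apply/measurable_EFinP.
- by move=> n x _; rewrite mule_ge0// lee_fin.
- move=> x _ a b ab; rewrite lee_wpmul2r ?lee_fin//; exact/lefP/nd_nnsfun_approx.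
Qed.

Lemma mdens_indic A : measurable A -> mdens mg g0 m A = \int[m]_x ((\1_A x)%:E * (g x)%:E).
Proof.
move=> mA; rewrite /mdens integral_mkcond.
by apply: eq_integral => x _; rewrite epatch_indic muleC.
Qed.

End density.

Section halflines.
Context {R : realType}.
Implicit Types m : {measure set (measurableTypeR R) -> \bar R}.
Local Open Scope ereal_scope.

Lemma halfline_unique m1 m2 : (forall t, m1 `]-oo, t]%classic = m2 `]-oo, t]%classic) ->
  (forall t, m1 `]-oo, t]%classic < +oo) -> forall A, measurable A -> m1 A = m2 A.
Proof.
move=> m12 fin A mA.
pose G : set (set (measurableTypeR R)) := [set A | exists t, A = `]-oo, t]%classic].
apply: (@g_sigma_algebra_measure_unique _ _ _ G _ (fun n => `]-oo, n%:R]%classic)) => //.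
- by move=> _ [t ->].
- by move=> n; exists n%:R.
- apply/seteqP; split => // x _; exists (Num.truncn `|x|).+1 => //=.
  by rewrite in_itv/= (le_trans (ler_norm _))// ltW// truncnS_gt.
- move=> _ _ [s ->] [t ->]; exists (Num.min s t).
  by apply/seteqP; split => x /=; rewrite !in_itv/= le_min => /andP.
- by move=> _ [t ->].
- have : (@RGenOInfty.G R).-sigma.-measurable A by rewrite -RGenOInfty.measurableE.
  apply: smallest_sub; first exact: smallest_sigma_algebra.
  move=> _ [x ->]; rewrite -setCitvl -setTD.
  by apply: sigma_algebraCD; apply: sub_sigma_algebra; exists x.
Qed.

End halflines.

Section mean_bounds.
Context d (T : measurableType d) {R : realType}.
Variables (m : {measure set T -> \bar R}) (f : T -> R) (N : set T) (c M : R).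
Hypothesis (mN : measurable N) (N0 : m N = 0%E) (mM : m setT = M%:E).
Hypothesis intf : m.-integrable setT (EFin \o f).

Let setTDE : m (setT `\` N) = M%:E.
Proof. by rewrite measureD//= ?setTI ?N0 ?sube0 ?mM ?ltry. Qed.

Let integrable_cstE : m.-integrable (setT `\` N) (cst c%:E).
Proof.
apply/integrableP; split => //.
rewrite (_ : (fun x => _) = cst `|c%:E|%E)// integral_cst ?setTDE ?ltry//.
exact: measurableD.
Qed.

Lemma mean_ge : (forall t, ~ N t -> c <= f t) -> ((c * M)%:E <= \int[m]_t (f t)%:E)%E.
Proof.
move=> ct; rewrite (negligible_integral mN _ intf N0)//.
have mT : measurable (setT `\` N) by exact: measurableD.
rewrite EFinM -setTDE -integral_cst//; apply: le_integral => //.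
- exact: integrableS intf.
- by move=> t; rewrite inE => -[_ /ct]; rewrite lee_fin.
Qed.

Lemma mean_le : (forall t, ~ N t -> f t <= c) -> (\int[m]_t (f t)%:E <= (c * M)%:E)%E.
Proof.
move=> ct; rewrite (negligible_integral mN _ intf N0)//.
have mT : measurable (setT `\` N) by exact: measurableD.
rewrite EFinM -setTDE -integral_cst//; apply: le_integral => //.
- exact: integrableS intf.
- by move=> t; rewrite inE => -[_ /ct]; rewrite lee_fin.
Qed.

End mean_bounds.

(** * Spectral families of a Jacobi matrix *)

Section spectral.
Context {R : realType}.
Variables (J : jacobi2 R) (E : R -> (int -> R[i]) -> int -> R[i]).
Hypothesis hE : spectral_family (jop J) E.
Implicit Types (u v w : int -> R[i]) (m : {measure set (measurableTypeR R) -> \bar R}).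
Local Notation T := (jacobi_op (ja J) (jb J)).

Lemma in_l2_E t u : in_l2 u -> in_l2 (E t u).
Proof. by move=> ul; case: hE => /(_ t)[[_ h _] _ _] _ _ _ _; exact: h. Qed.

Lemma E_add t u v : in_l2 u -> in_l2 v -> E t (u + v) = E t u + E t v.
Proof.
move=> ul vl; case: hE => /(_ t)[[h _ _] _ _] _ _ _ _.
by have := h 1 u v ul vl; rewrite !scale1r.
Qed.

Lemma E_sub t u v : in_l2 u -> in_l2 v -> E t (u - v) = E t u - E t v.
Proof.
move=> ul vl; case: hE => /(_ t)[[h _ _] _ _] _ _ _ _.
by have := h (-1) v u vl ul; rewrite !scaleN1r addrC => ->; rewrite addrC.
Qed.

Lemma ri_E t u v : in_l2 u -> in_l2 v -> ri (E t u) v = ri u (E t v).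
Proof.
by move=> ul vl; case: hE => /(_ t)[_ _ h] _ _ _ _; exact: (congr1 (@complex.Re R) (h _ _ ul vl)).
Qed.

Lemma E_idem t u : in_l2 u -> E t (E t u) = E t u.
Proof. by move=> ul; case: hE => /(_ t)[_ h _] _ _ _ _; exact: h. Qed.

Lemma E_le s t u : s <= t -> in_l2 u -> E s (E t u) = E s u.
Proof. by case: hE => _ h _ _ _; exact: h. Qed.

Lemma ri_eq0 u : in_l2 u -> ri u u = 0 -> u = 0.
Proof. by move=> ul u0; apply: l2b_eq0; apply/ri_le => //; rewrite u0. Qed.

(** The adjoint of [E_le], obtained by moving both projections across in the squared norm of the
    difference. *)
Lemma E_ge s t u : s <= t -> in_l2 u -> E t (E s u) = E s u.
Proof.
move=> st ul; apply/eqP; rewrite -subr_eq0; apply/eqP.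
have l1 := in_l2_E s ul; have l2 := in_l2_E t l1.
have dl := in_l2B l2 l1; apply: ri_eq0 => //.
rewrite riBr// -(ri_E t dl l1) -(ri_E s (in_l2_E t dl) ul) E_le//.
by rewrite (ri_E s dl ul) subrr.
Qed.

Lemma E_min s t u : in_l2 u -> E t (E s u) = E (Num.min t s) u.
Proof. by move=> ul; case: (leP t s) => ts; [exact: E_le|exact/E_ge/ul/ltW]. Qed.

Definition specm u m := forall t, m `]-oo, t]%classic = (ri u (E t u))%:E.

Lemma specm_ex u : in_l2 u -> exists m, [/\ specm u m,
  m.-integrable setT (EFin : measurableTypeR R -> \bar R) &
  \int[m]_t t%:E = (ri u (T u))%:E]%E.
Proof.
move=> ul; case: hE => _ _ _ _ /(_ _ ul)[m [mE intm Tm]].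
exists m; split => //.
  by move=> t; rewrite mE l2norm_ri ?(ri_E _ ul) ?E_idem//; exact: in_l2_E.
rewrite (congr1 (@complex.Re R) Tm : ri u (T u) = _) /= fineK//.
exact: integrable_fin_num.
Qed.

Lemma ri_Bessel t u : in_l2 u -> ri u (E t u) <= ri u u.
Proof.
move=> ul; have el := in_l2_E t ul; have := ri_ge0 (in_l2B ul el).
rewrite riBr ?riBl//; [|exact: in_l2B..].
by rewrite (ri_E t ul el) E_idem// (ri_E t ul ul) subrr subr0 subr_ge0.
Qed.

Lemma ri_E_sub t u : in_l2 u -> ri (E t u - u) (E t u - u) = ri u u - ri u (E t u).
Proof.
move=> ul; have el := in_l2_E t ul.
rewrite riBr ?riBl//; [|exact: in_l2B..].
by rewrite (ri_E t ul el) E_idem// (ri_E t ul ul) subrr sub0r opprB.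
Qed.

(** Bessel's inequality on exhausting half-lines bounds the mass from above; the strong convergence
    of E_t to the identity at +oo bounds it from below. *)
Lemma specm_total u m : in_l2 u -> specm u m -> m setT = (ri u u)%:E.
Proof.
move=> ul um; apply/eqP; rewrite eq_le; apply/andP; split.
  have := @nondecreasing_cvg_mu _ _ R m (fun n => `]-oo, n%:R]%classic).
  have -> : (\bigcup_n `]-oo, n%:R] = [set: R])%classic.
    apply/seteqP; split => // x _; exists (Num.truncn `|x|).+1 => //=.
    by rewrite in_itv/= (le_trans (ler_norm _))// ltW// truncnS_gt.
  move=> /(_ (fun=> measurable_itv _) measurableT) c.
  have c' := c _; apply: (@cvge_to_le _ _ eventually_filter _ _ _ _ (c' _)); last first.
    by apply: nearW => n; rewrite /= um lee_fin ri_Bessel.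
  move=> p q pq; apply/subsetPset => x /=; rewrite !in_itv/= => /le_trans; apply.
  by rewrite ler_nat.
apply/lee_addgt0Pr => e e0.
case: hE => _ _ _ /(_ _ ul)[_ h] _.
have : \forall t \near +oo%R, (l2norm (E t u - u)%R < (Num.sqrt e)%:E)%E.
  apply: (h [set x | (x < (Num.sqrt e)%:E)%E]); apply: open_nbhs_nbhs.
  by split; [exact: open_ereal_lt_ereal|rewrite /= lte_fin sqrtr_gt0].
move=> [t [_ /(_ (t + 1))]]; rewrite ltrDl => /(_ ltr01)/= /ltW h0.
have := (l2normP (E (t + 1) u - u) (sqrtr_ge0 e)).1 h0; rewrite (sqr_sqrtr (ltW e0)) => h1.
have := (ri_le e (in_l2B (in_l2_E (t + 1) ul) ul)).2 h1.
rewrite ri_E_sub// => h2.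
have h3 : ((ri u u)%:E <= m `]-oo, (t + 1)%R]%classic + e%:E)%E.
  by rewrite um -EFinD lee_fin; lra.
by apply: (le_trans h3); rewrite leeD2r// le_measure ?inE.
Qed.

Lemma specm_unique u m1 m2 : specm u m1 -> specm u m2 -> forall A, measurable A -> m1 A = m2 A.
Proof.
move=> u1 u2; apply: halfline_unique => t; rewrite u1 ?u2//; exact: ltry.
Qed.

Lemma specm_mean u m : in_l2 u -> specm u m ->
  m.-integrable setT (EFin : measurableTypeR R -> \bar R) /\
  (\int[m]_t t%:E = (ri u (T u))%:E)%E.
Proof.
move=> ul um; have [m' [um' intm' Tm']] := specm_ex ul.
have mm' := specm_unique um um'; split.
  case/integrableP: intm' => mf fi; apply/integrableP; split => //.
  by rewrite (eq_measure_integral m')// => A mA _; exact: mm'.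
by rewrite -Tm' (eq_measure_integral m')// => A mA _; exact: mm'.
Qed.

Lemma ri_jop_le u : in_l2 u -> `|ri u (T u)| <= 2 * ri u u.
Proof.
move=> ul; have Tl := in_l2_jop J ul; have u2 := in_l2Z 2%:C ul.
have T4 : ri (T u) (T u) <= 4 * ri u u by apply/ri_le => //; apply: jop_l2b; exact: l2b_ri.
have r2 : ri (2%:C *: u) (2%:C *: u) = 4 * ri u u.
  by rewrite riZr// riC riZr//; ring.
have rT : ri (T u) (2%:C *: u) = 2 * ri u (T u) by rewrite riZr// (riC (T u)).
have h1 := ri_ge0 (in_l2B Tl u2); have h2 := ri_ge0 (in_l2D Tl u2).
rewrite (riBr (in_l2B Tl u2) Tl u2) (riBl Tl u2 Tl) (riBl Tl u2 u2) in h1.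
rewrite (riDr (in_l2D Tl u2) Tl u2) (riDl Tl u2 Tl) (riDl Tl u2 u2) in h2.
rewrite (riC (2%:C *: u) (T u)) r2 rT in h1.
rewrite (riC (2%:C *: u) (T u)) r2 rT in h2.
by rewrite ler_norml; apply/andP; split; lra.
Qed.

(* The vector w = u - E s u has a spectral measure carried by ]s, +oo[, so that
   s <w, w> <= <w, T w> <= 2 <w, w>. *)
Lemma E_above s u : 2 < s -> in_l2 u -> E s u = u.
Proof.
move=> s2 ul; have el := in_l2_E s ul; have wl := in_l2B ul el.
have [m [wm intm Tm]] := specm_ex wl.
have m0 : m `]-oo, s]%classic = 0%E.
  by rewrite wm E_sub// E_idem// subrr ri0r.
have : ((s * ri (u - E s u) (u - E s u))%:E <= \int[m]_t t%:E)%E.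
  apply: mean_ge m0 _ intm _ => //; first exact: specm_total.
  by move=> t; rewrite /= in_itv/= => /negP; rewrite -ltNge => /ltW.
rewrite Tm lee_fin => h1; have := ri_jop_le wl; rewrite ler_norml => /andP[_ h2].
have w0 := ri_ge0 wl; have : ri (u - E s u) (u - E s u) = 0 by nra.
by move=> /(ri_eq0 wl)/eqP; rewrite subr_eq0 => /eqP.
Qed.

Lemma E_below s u : s < -2 -> in_l2 u -> E s u = 0.
Proof.
move=> s2 ul; have wl := in_l2_E s ul.
have [m [wm intm Tm]] := specm_ex wl.
have mT := specm_total wl wm.
have m0 : m `]s, +oo[%classic = 0%E.
  rewrite -setCitvl -setTD measureD//= ?setTI; last by rewrite [m _]mT ltry.
  by rewrite [m _]mT [in X in (_ - X)%E](wm s) E_idem// subee.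
have : (\int[m]_t t%:E <= (s * ri (E s u) (E s u))%:E)%E.
  apply: mean_le m0 _ intm _ => //.
  by move=> t; rewrite /= in_itv/= andbT => /negP; rewrite -leNgt.
rewrite Tm lee_fin => h1; have := ri_jop_le wl; rewrite ler_norml => /andP[h2 _].
by have w0 := ri_ge0 wl; apply: ri_eq0 => //; nra.
Qed.

Lemma specm_support u m : in_l2 u -> specm u m -> m (~` `[-2, 2]) = 0%E.
Proof.
move=> ul um; have mT := specm_total ul um.
have below s : s < -2 -> m `]-oo, s]%classic = 0%E.
  by move=> s2; rewrite um E_below// ri0r.
have above s : 2 < s -> m `]s, +oo[%classic = 0%E.
  move=> s2; rewrite -setCitvl -setTD measureD//= ?setTI; last by rewrite [m _]mT ltry.
  by rewrite [m _]mT [in X in (_ - X)%E](um s) E_above// subee.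
pose F n : set R := `]-oo, -2 - n.+1%:R^-1] `|` `]2 + n.+1%:R^-1, +oo[.
have n0 (n : nat) : (0 : R) < n.+1%:R^-1 by rewrite invr_gt0.
have F0 n : m.-negligible (F n).
  apply: negligibleU.
    by apply/negligibleP => //; apply: below; rewrite ltrBlDr ltrDl n0.
  by apply/negligibleP => //; apply: above; rewrite ltrDl n0.
have mI : measurable (~` `[-2, 2] : set (measurableTypeR R)) by exact: measurableC.
apply/negligibleP => //; apply: negligibleS (negligible_bigcup F0).
move=> x /= /negP; rewrite in_itv/= negb_and -!ltNge => /orP[x2|x2].
  have [k kx] := @ltr_add_invr R x (-2) x2.
  by exists k => //; left; rewrite /= in_itv/= lerBrDr ltW.
have [k kx] := @ltr_add_invr R 2 x x2.
by exists k => //; right; rewrite /= in_itv/= andbT.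
Qed.

End spectral.

(** * Moments of spectral measures *)

Section spectral_moments.
Context {R : realType}.
Variables (J : jacobi2 R) (E : R -> (int -> R[i]) -> int -> R[i]).
Hypothesis hE : spectral_family (jop J) E.
Implicit Types (u v w : int -> R[i]) (m : {measure set (measurableTypeR R) -> \bar R}).
Local Notation T := (jacobi_op (ja J) (jb J)).

(* T + 2 is nonnegative, so that multiplying a spectral measure by t + 2 gives a
   positive measure. *)
Definition X2 : {poly R[i]} := 'X + (2%:C)%:P.
Local Notation T2 := (jpoly (ja J) (jb J) X2).

Lemma X2_real i : complex.Im X2`_i = 0.
Proof. by rewrite /X2 coefD coefX coefC; case: i => [|[|i]] //=; rewrite addr0. Qed.

Lemma T2E u : T2 u = T u + 2%:C *: u.
Proof. by rewrite /X2 jpolyD jpolyX jpolyC. Qed.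

Lemma in_l2_T2 u : in_l2 u -> in_l2 (T2 u).
Proof. exact: in_l2_jpoly. Qed.

Lemma ri_T2 u v : in_l2 u -> in_l2 v -> ri (T2 u) v = ri u (T2 v).
Proof. by apply: ri_jpoly => i; exact: X2_real. Qed.

Lemma T2_add u v : T2 (u + v) = T2 u + T2 v. Proof. exact: linearD. Qed.

Lemma T2_sub u v : T2 (u - v) = T2 u - T2 v. Proof. exact: linearB. Qed.

(** Equal to t + 2 on [-2, 2], which carries the spectral measures, and nonnegative on the whole
    line, so that it can serve as a density. *)
Definition gp (t : measurableTypeR R) : R := Num.max 0 (t + 2).

Lemma gp_ge0 t : 0 <= gp t. Proof. by rewrite le_max lexx. Qed.

Lemma gpE t : -2 <= t -> gp t = t + 2.
Proof. by move=> t2; apply/max_idPr; rewrite -lerBlDr sub0r. Qed.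

Lemma measurable_gp : measurable_fun setT gp.
Proof. by apply: measurable_maxr => //; apply: measurable_funD. Qed.

Local Notation I2 := (`[-2, 2]%classic : set (measurableTypeR R)).
Let mI2 : measurable (~` I2). Proof. exact: measurableC. Qed.
Let DI2 : setT `\` ~` I2 = I2. Proof. by rewrite setTD setCK. Qed.

Lemma specm_gp u m : in_l2 u -> specm E u m ->
  (\int[m]_t (gp t)%:E = (ri u (T2 u))%:E)%E.
Proof.
move=> ul um; have [intm Tm] := specm_mean hE ul um.
have m0 := specm_support hE ul um; have mT := specm_total hE ul um.
have int2 : m.-integrable setT (cst 2%:E).
  apply/integrableP; split => //.
  by rewrite (_ : (fun x => _) = cst `|2%:E|%E)// integral_cst// mT ltry.
rewrite (ge0_negligible_integral mI2)//; last 2 first.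
- by apply/measurable_EFinP; exact: measurable_gp.
- by move=> t _; rewrite lee_fin gp_ge0.
rewrite DI2.
have -> : (\int[m]_(t in I2) (gp t)%:E = \int[m]_(t in I2) (t%:E + cst 2%:E t))%E.
  by apply: eq_integral => t; rewrite inE /= in_itv/= => /andP[t2 _]; rewrite gpE.
have := negligible_integral mI2 measurableT (integrableD measurableT intm int2) m0.
rewrite DI2 => <-; rewrite integralD// Tm integral_cst// [m _]mT -EFinM -EFinD T2E.
by rewrite riDr ?riZr//; [exact: in_l2_jop|exact: in_l2Z].
Qed.

Lemma ri_polar u v w z : in_l2 u -> in_l2 v -> in_l2 w -> in_l2 z ->
  ri (u + v) (w + z) = ri (u - v) (w - z) + 2 * (ri u z + ri v w).
Proof.
move=> ul vl wl zl.
rewrite (riDl ul vl (in_l2D wl zl)) (riBl ul vl (in_l2B wl zl)).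
rewrite (riDr ul wl zl) (riDr vl wl zl) (riBr ul wl zl) (riBr vl wl zl); ring.
Qed.

(* Polarization: the spectral measure of u + v is that of u - v plus 4 m. *)
Lemma gpol u v m : in_l2 u -> in_l2 v ->
  (forall t, m `]-oo, t]%classic = (ri u (E t v))%:E) ->
  (\int[m]_t (gp t)%:E = (ri u (T2 v))%:E)%E.
Proof.
move=> ul vl mE; have al := in_l2D ul vl; have bl := in_l2B ul vl.
have [m1 [am _ _]] := specm_ex hE al; have [m2 [bm _ _]] := specm_ex hE bl.
(* Written as a sum of positive measures, the polarization identity involves no signed measure. *)
pose m3 := measure_add m2 (mscale (NngNum (ler0n R 4)) m).
have m13 : forall A, measurable A -> m1 A = m3 A.
  apply: halfline_unique => t; last by rewrite am ltry.
  transitivity (m2 `]-oo, t]%classic + 4%:E * m `]-oo, t]%classic)%E; last first.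
    by symmetry; exact: measure_addE.
  rewrite am bm mE -EFinM -EFinD; congr EFin.
  have eu := in_l2_E hE t ul; have ev := in_l2_E hE t vl.
  rewrite (E_add hE _ ul vl) (E_sub hE _ ul vl) (ri_polar ul vl eu ev).
  have <- : ri u (E t v) = ri v (E t u) by rewrite -(ri_E hE)// riC.
  by ring.
have mg : measurable_fun setT (EFin \o gp) by apply/measurable_EFinP; exact: measurable_gp.
have g0 t : (0 <= (EFin \o gp) t)%E by rewrite lee_fin gp_ge0.
have e1 : (\int[m1]_t (gp t)%:E = \int[m3]_t (gp t)%:E)%E.
  by apply: eq_measure_integral => A mA _; exact: m13.
have e2 : (\int[m3]_t (gp t)%:E = \int[m2]_t (gp t)%:E + 4%:E * \int[m]_t (gp t)%:E)%E.
  rewrite -(ge0_integral_mscale m measurableT (NngNum (ler0n R 4)) mg (fun t _ => g0 t)).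
  exact: (ge0_integral_measure_add _ _ measurableT (fun t _ => g0 t) mg).
move: e1; rewrite e2 (specm_gp al am) (specm_gp bl bm) => {e2}.
have tu := in_l2_T2 ul; have tv := in_l2_T2 vl.
rewrite T2_add T2_sub (ri_polar ul vl tu tv).
have <- : ri u (T2 v) = ri v (T2 u) by rewrite -ri_T2// riC.
have : (0 <= \int[m]_t (gp t)%:E)%E by apply: integral_ge0 => t _; exact: g0.
case: (\int[m]_t (gp t)%:E)%E => [x|//|//] _; last first.
  by rewrite mulry gtr0_sg// mul1e.
rewrite -EFinM -EFinD => -[h]; congr EFin; lra.
Qed.

Definition hind (s : R) (t : measurableTypeR R) : R := \1_(`]-oo, s]%classic) t.

Lemma hind_ge0 s t : 0 <= hind s t. Proof. by rewrite /hind indicE. Qed.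

Lemma measurable_hind s : measurable_fun setT (hind s).
Proof. exact: measurable_indic. Qed.

Local Notation mdh s := (mdens (measurable_hind s) (hind_ge0 s)).
Local Notation mdg := (mdens measurable_gp gp_ge0).

Lemma mdh_halfline s m t : mdh s m `]-oo, t]%classic = m `]-oo, Num.min t s]%classic.
Proof.
rewrite /mdens /hind integral_indic//; congr (m _).
by apply/seteqP; split => x; rewrite /= !in_itv/= le_min;
  [case=> -> ->|case/andP=> -> ->].
Qed.

Lemma mdh_gp s m : (\int[mdh s m]_t (gp t)%:E = mdg m `]-oo, s]%classic)%E.
Proof.
rewrite ge0_integral_mdens; last 2 first.
- by apply/measurable_EFinP; exact: measurable_gp.
- by move=> t; rewrite lee_fin gp_ge0.
by rewrite mdens_indic//; apply: eq_integral => t _; rewrite muleC.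
Qed.

(** The restriction of m to the half-line up to s has distribution function <u, E_t E_s u>, so
    [gpol] applies to the pair u, E_s u. *)
Lemma mdg_halfline u m s : in_l2 u -> specm E u m ->
  mdg m `]-oo, s]%classic = (ri u (T2 (E s u)))%:E.
Proof.
move=> ul um; rewrite -mdh_gp; apply: gpol => //; first exact: (in_l2_E hE).
by move=> t; rewrite [LHS]mdh_halfline um (E_min hE).
Qed.

(** The spectral measure of (T + 2) u is (t + 2)^2 dm. Cut at s, the measure (t + 2) dm belongs to
    the pair u, E_s (T + 2) u; integrating [gp] against it by [gpol] yields <(T + 2) u, E_s (T + 2)
    u>. *)
Lemma specm_T2 u m : in_l2 u -> specm E u m -> specm E (T2 u) (mdg (mdg m)).
Proof.
move=> ul um s; have tl := in_l2_T2 ul; have el := in_l2_E hE s tl.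
transitivity (\int[mdh s (mdg m)]_t (gp t)%:E)%E; first by symmetry; exact: mdh_gp.
rewrite (ri_T2 ul el); apply: gpol => // t.
have el' := in_l2_E hE (Num.min t s) ul.
rewrite [LHS]mdh_halfline [LHS](mdg_halfline _ ul um) (E_min hE _ _ tl) -(ri_T2 ul el').
by rewrite -(ri_E hE _ tl ul) riC.
Qed.

(** Induction in steps of two: the moment n + 2 of u is the moment n of (T + 2) u, whose spectral
    measure is known. *)
Lemma specm_gpX n u m : in_l2 u -> specm E u m ->
  (\int[m]_t (gp t ^+ n)%:E = (ri u (jpoly (ja J) (jb J) (X2 ^+ n) u))%:E)%E.
Proof.
have mgX k : measurable_fun setT (fun t => (gp t ^+ k)%:E).
  by apply/measurable_EFinP; apply: measurable_funX; exact: measurable_gp.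
have gX0 k t : (0 <= (gp t ^+ k)%:E)%E by rewrite lee_fin exprn_ge0// gp_ge0.
elim/ltn_ind: n u m => -[|[|n]] ih u m ul um.
- rewrite expr0 -[1]/(1%:P) jpolyC scale1r.
  under eq_integral do rewrite expr0.
  by rewrite integral_cst// mul1e; exact: (specm_total hE).
- by rewrite expr1; exact: specm_gp.
have := ih n _ _ _ (in_l2_T2 ul) (specm_T2 ul um).
rewrite ge0_integral_mdens// ge0_integral_mdens//; last 2 first.
- by apply: emeasurable_funM => //; exact: (mgX 1%N).
- by move=> t; rewrite mule_ge0//; exact: (gX0 1%N).
rewrite (ri_T2 ul (in_l2_jpoly _ _ (in_l2_T2 ul))) => h.
have eq : X2 ^+ n.+2 = X2 * (X2 ^+ n * X2) by rewrite exprS exprSr.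
rewrite eq jpolyM jpolyM -h//; apply: eq_integral => t _.
by rewrite -!EFinM -!exprSr.
Qed.

End spectral_moments.

Section spectral_measure_moments.
Context {R : realType}.
Variable J : jacobi2 R.

Lemma ri_dlt (v : int -> R[i]) : in_l2 v -> ri (dlt 0) v = complex.Re (v 0).
Proof.
move=> vl; have dl : in_l2 (dlt 0 : int -> R[i]) by apply/in_l2P; exists 1; exact: l2b_dlt.
pose e (n : int) : R := (n == 0)%:R.
rewrite /ri (_ : (fun n => _) = (fun n => complex.Re (v 0) * e n)%R); last first.
  apply/funext => n; rewrite /dlt /e; case: eqVneq => [->|_].
    by rewrite rmorph_nat mulr1 mul1r.
  by rewrite rmorph_nat mulr0 mul0r.
have e0 k : (0 <= e k)%R by [].
have se : summableZ e.
  apply: le_summableZ (summable_nsq dl) => k; rewrite /e /= /dlt.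
  by case: eqVneq => _; rewrite /nsq /= ?expr1n ?expr0n ?addr0.
rewrite sumZZ//; suff -> : sumZ e = 1 by rewrite mulr1.
suff : (sumZ e)%:E = 1%E by case.
rewrite -sumZ_esum// -[RHS](@esum_set1 R _ (0 : int) (EFin \o e)) ?lee_fin//.
rewrite [RHS]esum_mkcond; apply: eq_esum => n _.
rewrite /e; case: eqVneq => [->|n0]; first by rewrite mem_set.
by rewrite memNset//= => /eqP; rewrite (negPf n0).
Qed.

Lemma spectral_measure_moment (rho : {measure set (measurableTypeR R) -> \bar R}) n :
  is_spectral_measure J rho ->
  (\int[rho]_(t in `[(-2)%R, 2%R]) ((t + 2) ^+ n)%:E = (mom (X2 ^+ n) J)%:E)%E.
Proof.
move=> [E [hE rE]].
have dl : in_l2 (dlt 0 : int -> R[i]) by apply/in_l2P; exists 1; exact: l2b_dlt.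
have sm : specm E (dlt 0) rho.
  move=> t; rewrite rE l2norm_ri; last exact: (in_l2_E hE).
  by rewrite (ri_E hE) ?(E_idem hE)//; exact: (in_l2_E hE).
rewrite /mom -ri_dlt ?in_l2_jpoly// -(specm_gpX hE n dl sm).
have mgX : measurable_fun setT (fun t => (@gp R t ^+ n)%:E).
  by apply/measurable_EFinP; apply: measurable_funX; exact: measurable_gp.
have mI2 : measurable (~` `[(-2)%R, 2%R] : set (measurableTypeR R)) by exact: measurableC.
rewrite (ge0_negligible_integral mI2 measurableT mgX)//; last 2 first.
- by move=> t _; rewrite lee_fin exprn_ge0// gp_ge0.
- exact: (specm_support hE dl sm).
rewrite setTD setCK; apply: eq_integral => t; rewrite inE /= in_itv/= => /andP[t2 _].
by rewrite gpE.
Qed.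

End spectral_measure_moments.

(** * Measures with equal moments *)

Section weierstrass.
Context {R : realType}.
Implicit Types (f : R -> R).

(* The sum over k of C(n, k) g(k) X^k (1 - X)^(n - k), through Pascal's rule. *)
Fixpoint bernstein (n : nat) (g : nat -> R) : {poly R} :=
  if n is n'.+1 then (1 - 'X) * bernstein n' g + 'X * bernstein n' (g \o succn) else (g 0%N)%:P.

Lemma bernstein_le n g h x : 0 <= x <= 1 -> (forall k, g k <= h k) ->
  (bernstein n g).[x] <= (bernstein n h).[x].
Proof.
move=> /andP[x0 x1]; elim: n g h => [|n ih] g h gh /=; first by rewrite !hornerC.
rewrite !hornerE lerD// ler_wpM2l ?subr_ge0//; first exact: ih.
by apply: ih => k; exact: gh.
Qed.

(** The coefficients are general because replacing k by k + 1 changes them in the induction. The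
    term n x (1 - x) is the binomial variance. *)
Lemma bernstein_quadratic n (a b c x : R) :
  (bernstein n (fun k => a + b * k%:R + c * k%:R ^+ 2)).[x] =
  a + b * (n%:R * x) + c * (n%:R * x * (1 - x) + n%:R ^+ 2 * x ^+ 2).
Proof.
elim: n a b c => [|n ih] a b c; first by rewrite /= hornerC; ring.
rewrite /= hornerD !hornerM hornerD hornerN hornerX hornerC ih.
have -> : (fun k => a + b * k%:R + c * k%:R ^+ 2) \o succn =
    fun k => (a + b + c) + (b + 2 * c) * k%:R + c * k%:R ^+ 2.
  by apply/funext => k /=; rewrite -natr1; ring.
rewrite ih -(natr1 n); ring.
Qed.

(** A modulus of continuity quadratic in y - x can be integrated exactly by [bernstein_quadratic];
    this plays the part of Chebyshev's inequality. *)
Lemma quadratic_modulus f (e : R) : continuous f -> 0 < e ->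
  exists2 C, 0 <= C & forall x y, 0 <= x <= 1 -> 0 <= y <= 1 ->
    `|f y - f x| <= e + C * (y - x) ^+ 2.
Proof.
move=> cf e0.
have [B B0 fB] : exists2 B, 0 <= B & forall x, 0 <= x <= 1 -> `|f x| <= B.
  have cK : {within `[0, 1], continuous f} by exact: continuous_subspaceT.
  have [M [_ HM]] := compact_bounded (continuous_compact cK (@segment_compact R 0 1)).
  exists (`|M| + 1) => [|x x01]; first by rewrite addr_ge0.
  apply: (HM (`|M| + 1)); first by rewrite ltr_pwDr// ler_norm.
  by exists x => //=; rewrite in_itv.
have e2 : 0 < e / 2 by rewrite divr_gt0.
have h : \forall C \near +oo, `[0, 1] `<=`
    (fun x => forall y, 0 <= x <= 1 -> 0 <= y <= 1 -> `|f y - f x| <= e + C * (y - x) ^+ 2).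
  have := iffLR (compact_near_coveringP _) (@segment_compact R 0 1).
  apply => x x01.
  have /cvgrPdist_le/(_ _ e2)/nbhs_ballP[r /= r0 rP] := cf x.
  have r2 : 0 < r / 2 by rewrite divr_gt0.
  (* Points at distance at least r / 2 then satisfy C (y - x)^2 >= 2 B, the trivial bound on the
     oscillation of f. *)
  exists (ball x (r / 2), [set C | 8 * B / r ^+ 2 <= C]) => /=.
    by split; [exact: nbhsx_ballx|exact: (nbhs_pinfty_ge (num_real _))].
  move=> [x1 C] [] /= xx1 CB y x01' y01.
  have B8 : 8 * B <= C * r ^+ 2 by rewrite -ler_pdivrMr ?exprn_gt0.
  have C0 : 0 <= C by apply: le_trans CB; apply: divr_ge0; [exact: mulr_ge0|exact/exprn_ge0/ltW].
  have xx1' : `|x - x1| < r / 2 by exact: xx1.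
  have [yx|yx] := ltP `|y - x1| (r / 2).
    have h1 : `|f x - f x1| <= e / 2 by apply: rP; rewrite /ball/=; lra.
    have h2 : `|f x - f y| <= e / 2.
      apply: rP; rewrite /ball/= -(subrKA x1) (le_lt_trans (ler_normD _ _))//.
      by rewrite (distrC x1); lra.
    have h3 : 0 <= C * (y - x1) ^+ 2 by rewrite mulr_ge0// sqr_ge0.
    rewrite (_ : f y - f x1 = (f x - f x1) - (f x - f y)); last by ring.
    by apply: (le_trans (ler_normB _ _)); lra.
  have r4 : r ^+ 2 <= 4 * (y - x1) ^+ 2.
    rewrite -(real_normK (num_real (y - x1))).
    move: yx r0; move: `|y - x1| => s; nra.
  have h1 : 2 * B <= C * (y - x1) ^+ 2 by nra.
  have := fB _ y01; have := fB _ x01' => b1 b2.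
  by apply: (le_trans (ler_normB _ _)); lra.
have [C [C0 CP]] := filter_ex (filterI (nbhs_pinfty_ge (num_real (0 : R))) h).
exists C => // x y x01 y01; apply: (CP x) => //.
Qed.

Lemma bernstein_approx f (e : R) : continuous f -> 0 < e ->
  exists p : {poly R}, forall x, 0 <= x <= 1 -> `|f x - p.[x]| <= e.
Proof.
move=> cf e0; have e2 : 0 < e / 2 by rewrite divr_gt0.
have [C C0 CP] := quadratic_modulus cf e2.
(* [bernstein_le] compares values at all natural k, so k / n is clamped to [0, 1]; clamping does not
   increase the distance to x. *)
pose cl (y : R) := Num.max 0 (Num.min y 1).
have cl01 y : 0 <= cl y <= 1.
  by rewrite /cl le_max lexx/= ge_max ler01/= ge_min lexx orbT.
have clx x y : 0 <= x <= 1 -> `|f (cl y) - f x| <= e / 2 + C * (y - x) ^+ 2.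
  move=> x01; apply: (le_trans (CP _ _ x01 (cl01 y))).
  rewrite lerD2l ler_wpM2l//; case/andP: x01 => x0 x1; rewrite /cl.
  by case: (leP y 1) => h1; [case: (leP 0 y) => h2|rewrite (max_idPr ler01)]; nra.
pose n := (Num.truncn (2 * C / e)).+1.
have n0 : (0 : R) < n%:R by rewrite ltr0n.
have nC : C / n%:R <= e / 2.
  rewrite ler_pdivrMr//.
  have : 2 * C / e < n%:R by exact: truncnS_gt.
  by rewrite ltr_pdivrMr// => h; lra.
exists (bernstein n (fun k => f (cl (k%:R / n%:R)))) => x x01.
(* [h 1] and [h (-1)] are the quadratic majorant and minorant of f at k / n, expanded in powers of
   k. *)
pose h (s : R) (k : nat) := (f x + s * (e / 2 + C * x ^+ 2)) + (- s * (2 * C * x / n%:R)) * k%:R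
  + (s * (C / n%:R ^+ 2)) * k%:R ^+ 2.
have hE s k : h s k = f x + s * (e / 2 + C * (k%:R / n%:R - x) ^+ 2).
  by rewrite /h; field; rewrite gt_eqF.
have hb s : (bernstein n (h s)).[x] = f x + s * (e / 2 + C / n%:R * (x * (1 - x))).
  by rewrite bernstein_quadratic; field; rewrite gt_eqF.
have b1 : (bernstein n (fun k => f (cl (k%:R / n%:R)))).[x] <= (bernstein n (h 1)).[x].
  by apply: bernstein_le => // k; rewrite hE mul1r -lerBlDl; move: (clx x (k%:R / n%:R) x01);
    rewrite ler_norml => /andP[].
have b2 : (bernstein n (h (-1))).[x] <= (bernstein n (fun k => f (cl (k%:R / n%:R)))).[x].
  apply: bernstein_le => // k; rewrite hE mulN1r; move: (clx x (k%:R / n%:R) x01).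
  by rewrite ler_norml => /andP[h1 h2]; lra.
move: b1 b2; rewrite !hb => b1 b2.
have [x0 x1] : 0 <= x /\ x <= 1 by apply/andP.
have xx : x * (1 - x) <= 1 by nra.
have Cn0 : 0 <= C / n%:R by rewrite divr_ge0// ltW.
have : C / n%:R * (x * (1 - x)) <= C / n%:R * 1 by rewrite ler_wpM2l.
move=> h3; rewrite ler_norml; apply/andP; split; lra.
Qed.

End weierstrass.

(** * Determinacy of the moment problem on [-2, 2] *)

Section moment_problem.
Context {R : realType}.
Implicit Types (f : R -> R) (k : probability (measurableTypeR R) R).
Local Notation I2 := (`[-2, 2]%classic : set (measurableTypeR R)).

Lemma continuous_integrable_segment k f : continuous f -> k.-integrable I2 (EFin \o f).
Proof.
move=> cf; apply: measurable_bounded_integrable => //.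
- by rewrite (le_lt_trans (probability_le1 k _))// ltry.
- by apply: measurable_funTS; exact: continuous_measurable_fun.
have cK : {within `[-2, 2], continuous f} by exact: continuous_subspaceT.
have [M [Mr HM]] := compact_bounded (continuous_compact cK (@segment_compact R (-2) 2)).
by exists M; split => // M' MM' x x2; apply: (HM M') => //; exists x.
Qed.

Lemma same_moments k k' f :
  (forall n, \int[k]_(t in I2) (t + 2) ^+ n = \int[k']_(t in I2) (t + 2) ^+ n) ->
  continuous f -> \int[k]_(t in I2) f t = \int[k']_(t in I2) f t.
Proof.
move=> kk' cf.
have cX n : continuous (fun t : R => (t + 2) ^+ n).
  elim: n => [|n ih]; first by under eq_fun do rewrite expr0; exact: cst_continuous.
  under eq_fun do rewrite exprS.
  by move=> t; apply: cvgM; [apply: cvgD; [exact: cvg_id|exact: cvg_cst]|exact: ih].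
have cS n (a : nat -> R) : continuous (fun t : R => \sum_(i < n) a i * (t + 2) ^+ i).
  elim: n => [|n ih]; first by under eq_fun do rewrite big_ord0; exact: cst_continuous.
  under eq_fun do rewrite big_ord_recr.
  by move=> t; apply: cvgD; [exact: ih|apply: cvgM; [exact: cvg_cst|exact: cX]].
have S_eq n (a : nat -> R) :
  \int[k]_(t in I2) (\sum_(i < n) a i * (t + 2) ^+ i) =
  \int[k']_(t in I2) (\sum_(i < n) a i * (t + 2) ^+ i).
  elim: n => [|n ih].
    under eq_Rintegral do rewrite big_ord0.
    under [RHS]eq_Rintegral do rewrite big_ord0.
    by rewrite !Rintegral_cst// !mul0r.
  have i1 m := continuous_integrable_segment m (cS n a).
  have i2 m := continuous_integrable_segment m (cX n).
  have cXa : continuous (fun t : R => a n * (t + 2) ^+ n).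
    by move=> t; apply: cvgM; [exact: cvg_cst|exact: cX].
  have i3 m := continuous_integrable_segment m cXa.
  have st (m : probability (measurableTypeR R) R) : \int[m]_(t in I2) (\sum_(i < n.+1) a i * (t + 2) ^+ i) =
    \int[m]_(t in I2) (\sum_(i < n) a i * (t + 2) ^+ i) + a n * \int[m]_(t in I2) (t + 2) ^+ n.
    under eq_Rintegral do rewrite big_ord_recr/=.
    by rewrite -(RintegralZl _ _ (i2 m))//; exact: (RintegralD _ (i1 m) (i3 m)).
  by rewrite !st ih kk'.
apply/eqP; rewrite -subr_eq0 -normr_le0; apply/ler_addgt0Pr => e e0; rewrite add0r.
have e2 : 0 < e / 2 by rewrite divr_gt0.
have cf' : continuous (fun x : R => f (4 * x - 2)).
  have ca : continuous (fun x : R => 4 * x - 2).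
    by move=> x; apply: cvgB; [apply: cvgM; [exact: cvg_cst|exact: cvg_id]|exact: cvg_cst].
  by move=> x; exact: (continuous_comp (ca x) (cf _)).
have [p pP] := bernstein_approx cf' e2.
(* The interval [0, 1] is carried to [-2, 2] by t = 4 x - 2, so p(x) becomes a polynomial in t +
   2. *)
pose a i := p`_i * 4^-1 ^+ i.
pose P (t : R) := \sum_(i < size p) a i * (t + 2) ^+ i.
have PE t : P t = p.[(t + 2) / 4].
  by rewrite horner_coef; apply: eq_bigr => i _; rewrite /a exprMn; ring.
have close (m : probability (measurableTypeR R) R) : `|\int[m]_(t in I2) f t - \int[m]_(t in I2) P t| <= e / 2.
  have mf := continuous_integrable_segment m cf.
  have mP := continuous_integrable_segment m (cS (size p) a).
  have cfP : continuous (fun t => f t - P t).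
    by move=> t; apply: cvgB; [exact: cf|exact: cS].
  have mfP := continuous_integrable_segment m cfP.
  rewrite -RintegralB//; apply: (le_trans (le_normr_Rintegral _ _)) => //.
  have h : (\int[m]_(t in I2) `|f t - P t| <= \int[m]_(t in I2) (e / 2)).
    have cn : continuous (fun t => `|f t - P t|) by move=> t; apply: cvg_norm; exact: cfP.
    have cc : continuous (fun _ : R => e / 2) by exact: cst_continuous.
    apply: le_Rintegral => //.
    - exact: (continuous_integrable_segment m cn).
    - exact: (continuous_integrable_segment m cc).
    move=> t; rewrite /= in_itv/= => /andP[t1 t2]; rewrite PE.
    have -> : f t = f (4 * ((t + 2) / 4) - 2) by congr f; field.
    by apply: pP; apply/andP; split; lra.
  apply: (le_trans h); rewrite Rintegral_cst// ger_pMr//.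
  rewrite -lee_fin fineK ?probability_le1//.
  by rewrite ge0_fin_numE// (le_lt_trans (probability_le1 m _))// ltry.
have h1 := close k; have h2 := close k'; rewrite -(S_eq (size p) a) in h2.
rewrite (_ : _ - _ = (\int[k]_(t in I2) f t - \int[k]_(t in I2) P t) -
  (\int[k']_(t in I2) f t - \int[k]_(t in I2) P t)); last by ring.
by apply: (le_trans (ler_normB _ _)); lra.
Qed.

End moment_problem.

(** * The density of states *)

Section log_kernel.
Context {R : realType}.
Variables (x y : R).
Hypothesis y0 : 0 < y.

(** The modulus of t - z, in the shape to which [ln_lower] computes. *)
Let N (t : R) := Num.sqrt ((t - x) ^+ 2 + (0 - y) ^+ 2).

Let N0 t : 0 < N t.
Proof. by rewrite sqrtr_gt0 sub0r sqrrN ltr_wpDl ?sqr_ge0// exprn_gt0. Qed.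

Let cN : continuous N.
Proof.
have c1 : continuous (fun t : R => (t - x) ^+ 2 + (0 - y) ^+ 2).
  move=> t; apply: cvgD; last exact: cvg_cst.
  by apply: cvgM; (apply: cvgB; [exact: cvg_id|exact: cvg_cst]).
by move=> t; exact: (continuous_comp (c1 t) (@sqrt_continuous R _)).
Qed.

Lemma continuous_Re_ln_lower :
  continuous (fun t : R => complex.Re (ln_lower (t%:C - (x +i* y)))).
Proof.
rewrite (_ : (fun t => _) = @ln R \o N); last by apply/funext.
by move=> t; apply: continuous_comp; [exact: cN|exact: (continuous_ln (N0 t))].
Qed.

Lemma continuous_Im_ln_lower :
  continuous (fun t : R => complex.Im (ln_lower (t%:C - (x +i* y)))).
Proof.
rewrite (_ : (fun t => _) = -%R \o (@acos R \o (fun t => (t - x) / N t))); last by apply/funext.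
have cq : continuous (fun t => (t - x) / N t).
  move=> t; apply: cvgM; first by apply: cvgB; [exact: cvg_id|exact: cvg_cst].
  by apply: cvgV; [rewrite gt_eqF|exact: cN].
move=> t; apply: continuous_comp; last exact: opp_continuous.
apply: (continuous_comp (cq t)); apply: continuous_acos.
(* As y is nonzero the argument of [acos] stays strictly between -1 and 1, where continuity is
   available. *)
rewrite -ltr_norml normrM normfV (gtr0_norm (N0 t)) ltr_pdivrMr// mul1r.
rewrite -ltr_sqr ?nnegrE ?(ltW (N0 t))// real_normK ?num_real// sqr_sqrtr.
  by rewrite ltrDl sub0r sqrrN exprn_gt0.
by rewrite addr_ge0// sqr_ge0.
Qed.

End log_kernel.

Section density_of_states.
Context {R : realType}.
Implicit Types (mu : probability (borelJ2 R) R) (k : probability (measurableTypeR R) R).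
Local Notation I2 := (`[-2, 2]%classic : set (measurableTypeR R)).

Lemma X2X_real n i : complex.Im ((@X2 R) ^+ n)`_i = 0.
Proof.
elim: n i => [|n ih] i; first by rewrite expr0 coef1; case: (i == 0)%N.
rewrite exprS coefM Im_sumC big1// => j _.
move: (X2_real (R := R) j) (ih (i - j)%N).
by case: (X2`_j) => a b /= ->; case: (_`_(i - j)) => c d /= ->; rewrite !mulr0 mul0r addr0.
Qed.

Lemma dk_moment mu k n : is_dk mu k ->
  \int[k]_(t in I2) (t + 2) ^+ n = jint mu (mom (X2 ^+ n)).
Proof.
move=> [_ [rho [hrho hk]]].
have cX : {within `[-2, 2], continuous (fun t : R => (t + 2) ^+ n)}.
  apply: continuous_subspaceT.
  elim: n => [|n ih]; first by under eq_fun do rewrite expr0; exact: cst_continuous.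
  under eq_fun do rewrite exprS.
  by move=> t; apply: cvgM; [apply: cvgD; [exact: cvg_id|exact: cvg_cst]|exact: ih].
have cm := continuous_mom (X2X_real n).
rewrite /Rintegral hk// -[RHS]/(fine (jint mu (mom (X2 ^+ n)))%:E) -(jint_EFin mu cm).
by congr fine; apply: eq_integral => J _; exact: spectral_measure_moment.
Qed.

End density_of_states.

(** * Invariance of the density of states and of the logarithmic integral *)

Section main.
Context {R : realType} (phi : jacobi2 R -> jacobi2 R).
Hypothesis cphi : continuous phi.
Hypothesis bphi : bijective phi.
Hypothesis phi_shift : forall J, jshift (phi J) = phi (jshift J).
Hypothesis phi_spectrum : forall J, spectrum (jop (phi J)) = spectrum (jop J).
Implicit Types (mu : probability (borelJ2 R) R) (k : probability (measurableTypeR R) R).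

Lemma dk_image_eq mu k k' f : jinvariant mu -> is_dk mu k -> is_dk (image_measure cphi mu) k' ->
  continuous f -> \int[k']_(t in `[-2, 2]) f t = \int[k]_(t in `[-2, 2]) f t.
Proof.
move=> inv hk hk' cf; apply: same_moments => // n.
rewrite (dk_moment n hk) (dk_moment n hk').
rewrite (jint_image _ cphi (continuous_mom (X2X_real n))).
exact: (jint_mom_phi cphi phi_shift phi_spectrum (X2X_real n) inv).
Qed.

Lemma int_lna0_image mu : jinvariant mu -> int_lna0 (image_measure cphi mu) = int_lna0 mu.
Proof.
move=> inv; apply/eqP; rewrite eq_le (int_lna0_image_ge cphi phi_shift phi_spectrum inv) andbT.
have [psi K1 K2] := bphi.
have cpsi := bijective_inverse_continuous cphi K1 K2.
have psi_shift J : jshift (psi J) = psi (jshift J).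
  by apply: (can_inj K1); rewrite -phi_shift !K2.
have psi_spectrum J : spectrum (jop (psi J)) = spectrum (jop J).
  by rewrite -[in RHS](K2 J) phi_spectrum.
have inv' := jinvariant_image cphi phi_shift inv.
have := int_lna0_image_ge cpsi psi_shift psi_spectrum inv'.
have -> // : int_lna0 (image_measure cpsi (image_measure cphi mu)) = int_lna0 mu.
apply: eq_measure_integral => A mA _.
change (mu (phi @^-1` (psi @^-1` A)) = mu A); congr (mu _).
by apply/seteqP; split => J /=; rewrite K1.
Qed.

End main.

Theorem theorem10p1 (R : realType) (phi : jacobi2 R -> jacobi2 R)
  (cphi : continuous phi) (bphi : bijective phi)
  (phi_shift : forall J, jshift (phi J) = phi (jshift J))
  (phi_spectrum : forall J, spectrum (jop (phi J)) = spectrum (jop J))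
  (mu : probability (borelJ2 R) R) (mu0 : M0 mu) :
  M0 (image_measure cphi mu) /\
  forall k k' : probability (measurableTypeR R) R,
    is_dk mu k -> is_dk (image_measure cphi mu) k' ->
    forall z : R[i], 0 < complex.Im z ->
      w_fun (image_measure cphi mu) k' z = w_fun mu k z.
Proof.
have [inv fin] := mu0; have lnE := int_lna0_image cphi bphi phi_shift phi_spectrum inv.
split=> [|k k' hk hk' [x y] /= y0].
  by split; [exact: (jinvariant_image cphi phi_shift inv)|rewrite lnE].
rewrite /w_fun /Amu lnE /cintegral; congr (_ - (_ +i* _)).
  exact: (dk_image_eq phi_shift phi_spectrum inv hk hk' (continuous_Re_ln_lower y0)).
exact: (dk_image_eq phi_shift phi_spectrum inv hk hk' (continuous_Im_ln_lower y0)).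
Qed.
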